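(* Let $(\mathcal{M},\mathfrak{a})$ be a monomial generalized analytic manifold of dimension $n$. Then: a) There is a bijection between the set of m-standardizations of $(\mathcal{M},\mathfrak{a})$ and $\mathbb{R}^N_{>0}$, where $N$ is the number of components of the boundary $\partial M$. b) Given a corner point $p$ of $\mathcal{M}$ and a local m-standardization $\mathbf{u}_p$ of $(\mathcal{M},\mathfrak{a})$ at $p$, there is a bijective map $\mathbb{R}^{N-n}_{>0}\to\mathcal{E}(\mathbf{u}_p)$, where $\mathcal{E}(\mathbf{u}_p)$ is the set of m-standardizations of $(\mathcal{M},\mathfrak{a})$ extending $\mathbf{u}_p$.
   Context: Write $\mathbb{R}_+=[0,\infty)$. A convergent generalized power series in $X=(X_1,\dots,X_n)$ is $s=\sum_{\lambda\in\mathbb{R}_+^n}s_\lambda X^\lambda$, $s_\lambda\in\mathbb{R}$, with support contained in a product of $n$ well-ordered subsets of $\mathbb{R}$ and $\sum|s_\lambda|\rho^\lambda<\infty$ for some $\rho\in\mathbb{R}^n_{>0}$. $\mathbb{R}\{Y,Z^*\}$ denotes those in $(Y,Z)$ whose exponents in the variables $Y$ are natural numbers. A continuous function $g$ on an open subset of $\mathbb{R}_+^n$ is generalized analytic if for each point $a$ of its domain $x\mapsto g(a+x)$ is near $0$ the sum of a series in $\mathbb{R}\{Y,Z^*\}$, where $Z$ are the variables with index $i$ such that $a_i=0$ and $Y$ the others. These form a sheaf $\mathcal{G}_n$ on $\mathbb{R}_+^n$, containing the sheaf $\mathcal{O}_n$ of functions extending to real analytic functions on a neighborhood in $\mathbb{R}^n$.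 A generalized (resp. standard) analytic manifold of dimension $n$ is a locally ringed space $\mathcal{M}=(M,\mathcal{G}_M)$ (resp. $(M,\mathcal{O}_M)$), $M$ second countable Hausdorff, structural sheaf a subsheaf of the continuous real functions, locally isomorphic through homeomorphisms onto open subsets of $\mathbb{R}_+^n$ (local charts) to $(\mathbb{R}^n_+,\mathcal{G}_n)$ (resp. $(\mathbb{R}^n_+,\mathcal{O}_n)$). For $a\in M$, $e_a$ is the number of coordinates vanishing at $a$ in a chart (independent of the chart). Strata are the connected components of the fibers of $a\mapsto e_a$; a stratum with $e=e_S$ has dimension $n-e_S$; $\partial M=\{e>0\}$. $\mathcal{Z}$ is the set of closures of strata and $\mathcal{Z}^j\subset\mathcal{Z}$ those of dimension $j$ ($\mathcal{Z}^0$: corner points, $\mathcal{Z}^{n-1}$: components of $\partial M$). Let $\mathcal{M}$ have at least one corner point and finitely many boundary components $E_i$, $i\in I$, such that every intersection $\bigcap_{i\in J}E_i$, $J\subset I$, is connected or empty (with $J=\emptyset$ giving $M$). For a corner point $p$, $I_p=\{i\in I:p\in E_i\}$ (it has $n$ elements) and $V^\star_p$ is the union of the strata $S$ with $p\in\overline{S}$, an open neighborhood of $p$. An affine chart at $p$ is a chart $\mathbf{x}_p=(x_{p,i})_{i\in I_p}$ mapping $V_p^\star$ homeomorphically onto $\mathbb{R}_+^n$ with $p\mapsto 0$ and $E_i\cap V^\star_p=\{x_{p,i}=0\}$ (the ordering of coordinates is disregarded). A monomial atlas is an atlas $\mathfrak{a}=\{\mathbf{x}_p\}_{p\in\mathcal{Z}^0}$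 of affine charts whose changes of coordinates are purely monomial: $x_{q,i}=\prod_{j\in I_p}x_{p,j}^{C^{pq}_{ij}}$ for $i\in I_q$, on $V_p^\star\cap V_q^\star$, with $C^{pq}_{ij}\in\mathbb{R}$. A monomial generalized (resp. standard) analytic manifold is such a manifold together with a monomial atlas, written $(\mathcal{M},\mathfrak{a})$. A standardization of $\mathcal{M}=(M,\mathcal{G}_M)$ is a subsheaf $\mathcal{O}\subset\mathcal{G}_M$ such that $(M,\mathcal{O})$ is a standard analytic manifold whose enrichment (the sheaf of continuous functions with generalized analytic expression in charts of $(M,\mathcal{O})$) is $\mathcal{G}_M$. A local m-standardization of $(\mathcal{M},\mathfrak{a})$ at $p\in\mathcal{Z}^0$ is an affine coordinate system $\mathbf{u}_p$ over $V^\star_p$ with $u_{p,i}=x_{p,i}^{\alpha_{p,i}}$, $\alpha_{p,i}\in\mathbb{R}_{>0}$, $i\in I_p$, where $\mathbf{x}_p\in\mathfrak{a}$. An m-standardization of $(\mathcal{M},\mathfrak{a})$ is a pair $(\mathcal{O},\mathfrak{b})$ where $\mathcal{O}$ is a standardization of $\mathcal{M}$ and $\mathfrak{b}=\{\mathbf{u}_p\}_{p\in\mathcal{Z}^0}$ is a monomial atlas of the standard analytic manifold $(M,\mathcal{O})$ such that each $\mathbf{u}_p$ is a local m-standardization of $(\mathcal{M},\mathfrak{a})$ at $p$. It extends a local m-standardization $\mathbf{u}_p$ if $\mathbf{u}_p\in\mathfrak{b}$. *)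

(* Defs.v *)
From HB Require Import structures.
From mathcomp Require Import all_boot all_order all_algebra.
From mathcomp Require Import all_classical wochoice all_reals all_analysis.

Set Implicit Arguments.
Unset Strict Implicit.
Unset Printing Implicit Defensive.

Import Order.TTheory GRing.Theory Num.Theory.
Import numFieldNormedType.Exports.

Local Open Scope classical_set_scope.
Local Open Scope ring_scope.

(* A subsheaf of the sheaf of real functions on T, given by its sections:
   [O U f] means that the restriction of f to U is a section over U.  Sections
   are total functions whose values outside U are irrelevant; see [is_sheaf]. *)
Definition presheaf (R : realType) (T : Type) := set T -> set (T -> R).

Section PowerSeries.
Variables (R : realType) (n : nat).
Implicit Types (s g h : 'rV[R]_n -> R) (a x l rho : 'rV[R]_n).
Implicit Types (U W : set 'rV[R]_n) (Y : pred 'I_n).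

Definition orthant : set 'rV[R]_n := [set x | forall i, 0 <= x ord0 i].

Definition pos_orthant : set 'rV[R]_n := [set x | forall i, 0 < x ord0 i].

Definition open_in_orthant U := exists2 W, open W & U = W `&` orthant.

(* t ^ e, for e >= 0, with 0 ^ 0 = 1; a negative t is allowed when e is a
   natural number, and both clauses agree when moreover t >= 0. *)
Definition gpow (t e : R) : R :=
  if e \is a Num.nat then t ^+ Num.truncn e else t `^ e.

Definition gmonomial l x : R := \prod_(i < n) gpow (x ord0 i) (l ord0 i).

(* The coefficient family s is a generalized power series whose exponents in
   the variables of Y are natural numbers. *)
Definition gen_power_series Y s :=
  [/\ forall l, s l != 0 -> orthant l,
      exists W : 'I_n -> set R,
        (forall i, wo_chain <=%R [in W i]) /\
        (forall l, s l != 0 -> forall i, W i (l ord0 i))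
    & forall l, s l != 0 -> forall i, Y i -> l ord0 i \is a Num.nat].

Definition convergent s := exists2 rho, pos_orthant rho &
  summable setT (fun l => (s l * gmonomial l rho)%:E).

(* Sum of an absolutely convergent family: positive part minus negative part. *)
Definition gsum s x : R :=
  let f := fun l => (s l * gmonomial l x)%:E in
  fine (\esum_(l in setT) f^\+ l)%E - fine (\esum_(l in setT) f^\- l)%E.

Definition expands_at Y U g a := exists s,
  [/\ gen_power_series Y s, convergent s &
      \forall x \near a, U x -> g x = gsum s (x - a)].

Definition gen_analytic : presheaf R 'rV[R]_n := fun U g =>
  [/\ open_in_orthant U, {within U, continuous g} &
      forall a, U a -> expands_at [pred i | a ord0 i != 0] U g a].

Definition real_analytic W h := forall a, W a -> expands_at predT W h a.

Definition std_analytic : presheaf R 'rV[R]_n := fun U g =>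
  open_in_orthant U /\
  forall a, U a -> exists W h,
    [/\ open W, W a, real_analytic W h & forall x, U x -> W x -> g x = h x].

End PowerSeries.

Section Manifold.
Variables (R : realType) (n : nat) (M : topologicalType).
(* L is the local model, [gen_analytic] or [std_analytic]. *)
Variables (L : presheaf R 'rV[R]_n) (O : presheaf R M).
Implicit Types (U V W S : set M) (f g : M -> R) (a p : M).

(* The first and third clauses make two presheaves equal as soon as they have
   the same sections over every open set. *)
Definition is_sheaf :=
  [/\ forall U f, O U f -> open U,
      forall U f, O U f -> {within U, continuous f},
      forall U f g, O U f -> {in U, f =1 g} -> O U g,
      forall U V f, open V -> V `<=` U -> O U f -> O V f
    & forall U f, open U ->
        (forall a, U a -> exists V, [/\ V a, V `<=` U & O V f]) -> O U f].

(* A local chart with domain W: a homeomorphism onto a relatively open subset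
   of the orthant under which the sections of O and of L correspond. *)
Definition is_chart W (phi : M -> 'rV[R]_n) :=
  [/\ open W,
      {within W, continuous phi},
      {in W &, injective phi},
      forall U, open U -> U `<=` W -> open_in_orthant (phi @` U)
    & forall U f, open U -> U `<=` W ->
        (O U f <-> exists2 g, L (phi @` U) g & {in U, f =1 g \o phi})].

(* That the stalks are local rings, and that the sections over an open set
   form a ring, follows from the local description by charts. *)
Definition is_manifold :=
  [/\ @second_countable M, hausdorff_space M, is_sheaf &
      forall a, exists W phi, is_chart W phi /\ W a].

(* e_a; its value does not depend on the choice of a chart. *)
Definition edim a : nat := xget 0%N [set k | exists W phi,
  [/\ is_chart W phi, W a & k = #|[pred i | phi a ord0 i == 0]|]].

Definition stratum_of a : set M :=
  connected_component [set b | edim b = edim a] a.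

(* Closures of the strata of dimension n - k.  Indexing by the codimension
   avoids a truncated n - 1 for the boundary components when n = 0. *)
Definition stratum_closures (k : nat) : set (set M) :=
  [set closure (stratum_of a) | a in [set a | edim a = k]].

Definition corner : set M := [set p | stratum_closures n [set p]].

Definition boundary_component : set (set M) := stratum_closures 1.

Definition vstar p : set M := [set a | closure (stratum_of a) p].

Section Atlas.
(* E enumerates the boundary components. *)
Variables (I : finType) (E : I -> set M).

(* A family (x_(p,i)) of coordinate functions is encoded by total functions
   that vanish at irrelevant arguments, so that equality of families is
   Leibniz equality. *)
Definition coord_family := I -> M -> R.
Definition atlas := M -> coord_family.

Definition affine_chart p (x : coord_family) :=
  [/\ forall i a, ~ (E i p /\ vstar p a) -> x i a = 0,
      forall i, E i p -> forall a, vstar p a -> (E i a <-> x i a = 0),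
      forall i, E i p -> x i p = 0
    & exists sigma : 'I_n -> I,
        let phi := fun a => \row_k x (sigma k) a in
        [/\ injective sigma,
            range sigma = [set i | E i p],
            is_chart (vstar p) phi
          & phi @` vstar p = @orthant R n]].

(* A negative exponent C i j is harmless although 0 `^ c = 0 for c < 0: if
   x_(p,j) vanishes somewhere on the overlap, continuity of x_(q,i) forces
   C i j >= 0. *)
Definition monomial_atlas (x : atlas) :=
  [/\ forall p, ~ corner p -> x p = (fun _ _ => 0),
      forall p, corner p -> affine_chart p (x p),
      forall a, exists2 p, corner p & vstar p a
    & forall p q, corner p -> corner q -> exists C : I -> I -> R,
        forall i, E i q -> forall a, vstar p a -> vstar q a ->
          x q i a = \prod_(j : I | `[< E j p >]) (x p j a `^ C i j)].

Definition monomial_manifold (x : atlas) :=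
  [/\ is_manifold,
      corner !=set0,
      injective E /\ range E = boundary_component,
      forall J : {set I}, let EJ := \bigcap_(i in [set i | i \in J]) E i in
        EJ = set0 \/ connected EJ
    & monomial_atlas x].

End Atlas.
End Manifold.

Section Standardization.
Variables (R : realType) (n : nat) (M : topologicalType) (G : presheaf R M).

Definition enrichment (O : presheaf R M) : presheaf R M := fun U f =>
  [/\ open U, {within U, continuous f} &
      forall W (phi : M -> 'rV[R]_n), is_chart (@std_analytic R n) O W phi ->
        exists2 g, gen_analytic (phi @` (U `&` W)) g &
                   {in U `&` W, f =1 g \o phi}].

Definition standardization (O : presheaf R M) :=
  [/\ forall U, O U `<=` G U,
      is_manifold (@std_analytic R n) O
    & enrichment O = G].

Variables (I : finType) (E : I -> set M) (x : atlas R M I).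

Definition local_m_standardization p (u : coord_family R M I) :=
  affine_chart (@gen_analytic R n) G E p u /\
  exists alpha : I -> R, (forall i, 0 < alpha i) /\
    forall i, E i p -> forall a, vstar (@gen_analytic R n) G p a ->
      u i a = x p i a `^ alpha i.

Definition m_standardizations : set (presheaf R M * atlas R M I) :=
  [set Ob | [/\ standardization Ob.1,
                monomial_atlas (@std_analytic R n) Ob.1 E Ob.2 &
                forall p, corner (@gen_analytic R n) G p ->
                  local_m_standardization p (Ob.2 p)]].

Definition m_standardizations_extending p (u : coord_family R M I) :=
  [set Ob | m_standardizations Ob /\ Ob.2 p = u].

End Standardization.

Arguments m_standardizations {R} n {M} G {I} E x.
Arguments local_m_standardization {R} n {M} G {I} E x p u.
Arguments m_standardizations_extending {R} n {M} G {I} E x p u.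

(* Main.v *)
Require Import Defs.
From mathcomp Require Import all_boot all_order all_algebra.
From mathcomp Require Import all_classical wochoice all_reals all_analysis.
From mathcomp Require Import ring lra.

Set Implicit Arguments.
Unset Strict Implicit.
Unset Printing Implicit Defensive.

Import Order.TTheory GRing.Theory Num.Theory.
Import numFieldNormedType.Exports.

Local Open Scope classical_set_scope.
Local Open Scope ring_scope.

(** Fix, for each boundary component E_i, a corner point p of M on E_i. The claim
    is that an m-standardization is the same thing as a free choice, for each i,
    of the exponent with which the coordinate x_(p,i) is raised.

    Write the changes of coordinates as x_(q,i) = prod_j x_(p,j)^(C_ij). If E_i
    passes through both p and q, then C_ii is positive and the other entries C_ki
    vanish, as one sees at a generic point of E_i, where x_(p,i) is the only
    coordinate that vanishes ([transfer_exp_gt0], [transfer_exp_off]). After raising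
    x_(p,i) to the powers al_(p,i), the exponent C_ii becomes
    D = C_ii al_(q,i) / al_(p,i). A standard analytic function is Lipschitz, so
    D >= 1 if the new coordinates belong to one standard structure; by symmetry
    1 / D >= 1, hence D = 1 ([m_standardization_exponents]). Conversely, if all these
    exponents are 1, the changes of the new coordinates are, near any point, products
    of coordinates that vanish there and of real powers of coordinates that do not;
    they are analytic, and the functions analytic in the new coordinates form a
    standardization ([power_m_standardization]). The numbers C_ii satisfy a cocycle
    identity ([transfer_exp_cocycle]), so the relation D = 1 expresses all the
    exponents al_(q,i) through the one at the chosen corner point, which is free. When
    the exponents at one corner point p are prescribed, the n components through p
    are settled and the N - n others remain free.

    The analytic input is twofold.

    First, generalized analytic functions have to be invariant under power maps and
    under the transitions between arbitrary standard charts, since the enrichment of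
    a standard structure refers to all of its charts. Both follow from one substitution
    theorem for generalized power series ([comp_series]): one may replace a variable
    with natural exponents by an analytic germ, and a variable with real exponents by
    a real power of a coordinate times a unit. It is proved by estimating norms in
    the algebra of absolutely convergent series ([Rep], [Rep_sum]). To apply it to a
    standard isomorphism, each component that vanishes at a point is shown to be a
    coordinate times a unit ([unit_factor]).

    Secondly, the number of coordinates that vanish at a point has to be independent of
    the chart, and the same for the generalized and the standard structure
    ([edim_gen], [edim_std]); otherwise corner points and the open sets V*_p would
    depend on the structure. An induction on that number reduces this to the behaviour
    of rays leaving a stratum ([card_zeros_homeo]), where comparing orders of vanishing
    yields a contradiction ([std_leaves], [gen_leaves]). *)

(** * Unconditional sums of real families *)

Section Rsum.
Variable R : realType.

(** [gsum] is the instance of this sum over all exponents; the theory is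
    developed over an arbitrary index type because substitution produces
    families indexed by exponents, by naturals, and by pairs of these. *)
Definition rsum (K : choiceType) (c : K -> R) : R :=
  let f := fun k => (c k)%:E in
  fine (\esum_(k in setT) f^\+ k)%E - fine (\esum_(k in setT) f^\- k)%E.

Definition asum (K : choiceType) (c : K -> R) : \bar R :=
  (\esum_(k in setT) `|c k|%:E)%E.

Definition ppart (K : Type) (c : K -> R) k := Num.max (c k) 0.
Definition npart (K : Type) (c : K -> R) k := Num.max (- c k) 0.

Section Parts.
Variables (K : Type) (c : K -> R).

Lemma ppart_ge0 k : 0 <= ppart c k. Proof. by rewrite /ppart le_max lexx orbT. Qed.
Lemma npart_ge0 k : 0 <= npart c k. Proof. by rewrite /npart le_max lexx orbT. Qed.

Lemma partE k : c k = ppart c k - npart c k.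
Proof. by rewrite /ppart /npart !maxEle; case: leP => ?; case: leP => ?; lra. Qed.

Lemma ppart_le k : `|ppart c k| <= `|c k|.
Proof.
rewrite ger0_norm ?ppart_ge0// /ppart; case: (leP (c k) 0) => h //; exact: ler_norm.
Qed.

Lemma npart_le k : `|npart c k| <= `|c k|.
Proof.
rewrite ger0_norm ?npart_ge0// /npart; case: (leP (- c k) 0) => h //.
by rewrite -normrN ler_norm.
Qed.

End Parts.

#[local] Hint Resolve ppart_ge0 npart_ge0 ppart_le npart_le : core.

Section OneIndex.
Variable K : choiceType.
Implicit Types (a b c : K -> R) (B : R).

Lemma asum_ge0 c : (0 <= asum c)%E.
Proof. by apply: esum_ge0 => k _; rewrite lee_fin. Qed.

Lemma le_asum a b : (forall k, `|a k| <= `|b k|) -> (asum a <= asum b)%E.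
Proof. by move=> h; apply: le_esum => k _; rewrite lee_fin. Qed.

Lemma eq_asum a b : a =1 b -> asum a = asum b.
Proof. by move=> /funext ->. Qed.

Lemma asumD a b : (asum (fun k => (a k + b k)%R) <= asum a + asum b)%E.
Proof.
rewrite /asum -esumD; try by move=> k _; rewrite lee_fin.
by apply: le_esum => k _; rewrite -EFinD lee_fin ler_normD.
Qed.

Lemma asumZ r c : asum (fun k => r * c k) = (`|r|%:E * asum c)%E.
Proof.
have key : forall r' c', (`|r'|%:E * asum c' <= asum (fun k => (r' * c' k)%R))%E.
  move=> r' c'; have [->|r0] := eqVneq r' 0.
    by rewrite normr0 mul0e asum_ge0.
  rewrite muleC -lee_pdivlMr ?normr_gt0//.
  apply: ge_ereal_sup => _ [X [finX _] <-].
  rewrite lee_pdivlMr ?normr_gt0// muleC fsbig_finite//= ge0_sume_distrr; last by move=> *; rewrite lee_fin.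
  apply: esum_ge; exists X; first by split.
  rewrite fsbig_finite//=; apply: lee_sum => k _.
  by rewrite -EFinM -normrM.
apply/eqP; rewrite eq_le; apply/andP; split; last exact: key.
have [->|r0] := eqVneq r 0.
  rewrite normr0 mul0e /asum esum1// => k _.
  by rewrite mul0r normr0.
have /= := key r^-1 (fun k => r * c k).
under [X in (_ <= X)%E -> _]eq_asum do rewrite mulKf//.
move=> h; rewrite -[X in (X <= _)%E]mul1e -(@divff _ `|r|) ?normr_eq0//.
rewrite EFinM -muleA; apply: lee_pmul => //; rewrite ?lee_fin ?mule_ge0 ?lee_fin ?invr_ge0 ?asum_ge0//.
by rewrite normfV in h.
Qed.

Lemma ge0_rsumE c : (forall k, 0 <= c k) -> rsum c = fine (asum c).
Proof.
move=> c0; rewrite /rsum [X in _ - fine X](_ : _ = 0%E) ?subr0; last first.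
  by rewrite esum1// => k _; rewrite funenegE max_r// leeNl oppe0 lee_fin.
congr fine; apply: eq_esum => k _; rewrite funeposE max_l ?lee_fin//.
by rewrite ger0_norm.
Qed.

Lemma rsum_partE c : (asum c < +oo)%E ->
  rsum c = fine (asum (ppart c)) - fine (asum (npart c)).
Proof.
move=> cfin; rewrite /rsum; congr (fine _ - fine _); apply: eq_esum => k _.
  by rewrite funeposE ger0_norm// /ppart EFin_max.
by rewrite funenegE ger0_norm// /npart EFin_max.
Qed.

(** Any splitting of a family into two summable nonnegative parts computes its
    sum. Every linearity statement below reduces to this one, the canonical
    parts being badly behaved under addition. *)
Lemma rsum_diff c (f g : K -> R) : (forall k, 0 <= f k) -> (forall k, 0 <= g k) ->
  (asum f < +oo)%E -> (asum g < +oo)%E -> (forall k, c k = f k - g k) ->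
  rsum c = fine (asum f) - fine (asum g).
Proof.
move=> f0 g0 ff gf cE.
have := @esumB R K setT (EFin \o f) (EFin \o g) ff gf
  (fun k _ => f0 k) (fun k _ => g0 k).
have -> : ((EFin \o f) \- (EFin \o g))%E = (fun k => (c k)%:E).
  by apply/funext => k /=; rewrite cE EFinB.
have pf : (\esum_(k in setT) (fun k => (c k)%:E)^\+ k)%E \is a fin_num.
  rewrite ge0_fin_numE; last exact: esum_ge0.
  apply: le_lt_trans ff; apply: le_esum => k _.
  rewrite funeposE -EFin_max lee_fin ger0_norm// ge_max f0 andbT cE.
  by rewrite lerBlDr lerDl.
have nf : (\esum_(k in setT) (fun k => (c k)%:E)^\- k)%E \is a fin_num.
  rewrite ge0_fin_numE; last exact: esum_ge0.
  apply: le_lt_trans gf; apply: le_esum => k _.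
  rewrite funenegE -EFin_max lee_fin ger0_norm// ge_max g0 andbT cE.
  by rewrite opprB lerBlDr lerDl.
have -> : (\esum_(i in [set: K]) (EFin \o f) i)%E = asum f.
  by apply: eq_esum => k _ /=; rewrite ger0_norm.
have -> : (\esum_(i in [set: K]) (EFin \o g) i)%E = asum g.
  by apply: eq_esum => k _ /=; rewrite ger0_norm.
move=> h; rewrite /rsum -fineB// h fineB//.
  by rewrite ge0_fin_numE ?asum_ge0.
by rewrite ge0_fin_numE ?asum_ge0.
Qed.

Let fineD' (u v : \bar R) : (0 <= u)%E -> (0 <= v)%E -> (u < +oo)%E -> (v < +oo)%E ->
  fine (u + v) = fine u + fine v.
Proof. by move=> *; rewrite fineD// ge0_fin_numE. Qed.

Lemma ge0_asumD (f g : K -> R) : (forall k, 0 <= f k) -> (forall k, 0 <= g k) ->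
  asum (fun k => f k + g k) = (asum f + asum g)%E.
Proof.
move=> f0 g0; rewrite /asum -esumD; try by move=> k _; rewrite lee_fin.
by apply: eq_esum => k _; rewrite -EFinD !ger0_norm ?addr_ge0.
Qed.

Lemma rsumB a b : (asum a < +oo)%E -> (asum b < +oo)%E ->
  rsum (fun k => a k - b k) = rsum a - rsum b.
Proof.
move=> fa fb.
have pfin c : (asum c < +oo)%E -> (asum (ppart c) < +oo)%E.
  by apply: le_lt_trans; exact: le_asum.
have nfin c : (asum c < +oo)%E -> (asum (npart c) < +oo)%E.
  by apply: le_lt_trans; exact: le_asum.
have pa := pfin _ fa; have na := nfin _ fa; have pb := pfin _ fb; have nb := nfin _ fb.
rewrite (@rsum_diff _ (fun k => ppart a k + npart b k) (fun k => npart a k + ppart b k)); last 1 first.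
- by move=> k; rewrite (partE a) (partE b); ring.
- rewrite !ge0_asumD// !fineD' ?asum_ge0//.
  by rewrite !rsum_partE//; ring.
- by move=> k; rewrite addr_ge0.
- by move=> k; rewrite addr_ge0.
- by rewrite ge0_asumD// lte_add_pinfty.
- by rewrite ge0_asumD// lte_add_pinfty.
Qed.

Lemma eq_rsum a b : a =1 b -> rsum a = rsum b.
Proof. by move=> /funext ->. Qed.

Lemma rsum0 : rsum (fun _ : K => 0) = 0.
Proof. by rewrite ge0_rsumE// /asum esum1// => k _; rewrite normr0. Qed.

Lemma rsumN a : (asum a < +oo)%E -> rsum (fun k => - a k) = - rsum a.
Proof.
move=> fa; rewrite -[RHS]sub0r -rsum0 -rsumB//; last first.
  by rewrite /asum esum1 ?ltry// => k _; rewrite normr0.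
by apply: eq_rsum => k; rewrite sub0r.
Qed.

Lemma rsumD a b : (asum a < +oo)%E -> (asum b < +oo)%E ->
  rsum (fun k => a k + b k) = rsum a + rsum b.
Proof.
move=> fa fb; rewrite -[rsum b]opprK -rsumN// -rsumB//.
  by apply: eq_rsum => k; rewrite opprK.
by rewrite (eq_asum (b := fun k => -1 * b k)) ?asumZ ?normrN1 ?mul1e// => k; rewrite mulN1r.
Qed.

Lemma rsumZ r c : (asum c < +oo)%E -> rsum (fun k => r * c k) = r * rsum c.
Proof.
wlog r0 : r / 0 <= r.
  move=> h fc; have [r0|r0] := leP 0 r; first exact: h.
  rewrite -[r]opprK mulNr -h ?oppr_ge0 ?(ltW r0)//.
  rewrite -rsumN; last by rewrite asumZ; rewrite lte_mul_pinfty// lee_fin.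
  by apply: eq_rsum => k; rewrite !mulNr opprK.
move=> fc; have pa : (asum (ppart c) < +oo)%E by apply: le_lt_trans fc; exact: le_asum.
have na : (asum (npart c) < +oo)%E by apply: le_lt_trans fc; exact: le_asum.
rewrite (@rsum_diff _ (fun k => r * ppart c k) (fun k => r * npart c k)).
- rewrite !asumZ !fineM ?fin_numE// ?ger0_norm//= ?rsum_partE ?mulrBr//.
  + by rewrite -fin_numE ge0_fin_numE// asum_ge0.
  + by rewrite -fin_numE ge0_fin_numE// asum_ge0.
- by move=> k; rewrite mulr_ge0.
- by move=> k; rewrite mulr_ge0.
- by rewrite asumZ lte_mul_pinfty// lee_fin.
- by rewrite asumZ lte_mul_pinfty// lee_fin.
- by move=> k; rewrite -mulrBr -partE.
Qed.

Lemma rsum_le c B : (asum c <= B%:E)%E -> `|rsum c| <= B.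
Proof.
move=> h; have cf : (asum c < +oo)%E by apply: le_lt_trans h _; rewrite ltry.
have pa : (asum (ppart c) < +oo)%E by apply: le_lt_trans cf; exact: le_asum.
have na : (asum (npart c) < +oo)%E by apply: le_lt_trans cf; exact: le_asum.
have : (asum (ppart c) + asum (npart c) <= B%:E)%E.
  rewrite -ge0_asumD//; apply: le_trans h; apply: le_esum => k _; rewrite lee_fin.
  rewrite ger0_norm ?addr_ge0// /ppart /npart.
  have h1 := ler_norm (c k); have h2 := ler_norm (- c k); rewrite normrN in h2.
  by rewrite !maxEle; case: (leP (c k) 0) => ?; case: (leP (- c k) 0) => ?; lra.
rewrite -[asum (ppart c)]fineK ?ge0_fin_numE ?asum_ge0//.
rewrite -[asum (npart c)]fineK ?ge0_fin_numE ?asum_ge0// -EFinD lee_fin => hB.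
rewrite rsum_partE//; apply: le_trans hB.
rewrite (le_trans (ler_normB _ _))// !ger0_norm// fine_ge0// asum_ge0//.
Qed.

Lemma asum_single k0 c : (forall k, k != k0 -> c k = 0) -> asum c = `|c k0|%:E.
Proof.
move=> hc; rewrite /asum (esumID [set k0])//.
rewrite !setTI esum_set1 ?lee_fin// esum1 ?adde0 //.
by move=> k /= /eqP kk0; rewrite hc ?normr0.
Qed.

Lemma rsum_single k0 c : (forall k, k != k0 -> c k = 0) -> rsum c = c k0.
Proof.
wlog c0 : c / 0 <= c k0.
  move=> h hc; have [c0|c0] := leP 0 (c k0); first exact: h.
  have -> : c = (fun k => - (- c k)) by apply/funext => k; rewrite opprK.
  have hc' : forall k, k != k0 -> - c k = 0 by move=> k /hc ->; rewrite oppr0.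
  rewrite rsumN; first by rewrite h// oppr_ge0 ltW.
  by rewrite (asum_single hc') ltry.
move=> hc; have c_ge0 k : 0 <= c k by have [->//|/hc ->] := eqVneq k k0.
by rewrite ge0_rsumE// (asum_single hc) /= ger0_norm.
Qed.

Lemma asum_reindex (e : K -> K) c : bijective e -> asum (c \o e) = asum c.
Proof.
move=> h; rewrite /asum [RHS](reindex_esum setT setT e) //.
by rewrite setTT_bijective.
Qed.

Lemma rsum_reindex (e : K -> K) c : bijective e -> rsum (c \o e) = rsum c.
Proof.
rewrite -setTT_bijective => h; rewrite /rsum; congr (fine _ - fine _).
  by rewrite [RHS](reindex_esum setT setT e _ h); apply: eq_esum => k _; rewrite !funeposE.
by rewrite [RHS](reindex_esum setT setT e _ h); apply: eq_esum => k _; rewrite !funenegE.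
Qed.

End OneIndex.

Lemma ge0_asumE (K : choiceType) (c : K -> R) : (forall k, 0 <= c k) ->
  asum c = (\esum_(k in setT) (c k)%:E)%E.
Proof. by move=> c0; apply: eq_esum => k _; rewrite ger0_norm. Qed.

Lemma esum_swap (K L : choiceType) (c : K -> L -> \bar R) :
  (forall k l, 0 <= c k l)%E ->
  (\esum_(k in setT) \esum_(l in setT) c k l =
   \esum_(l in setT) \esum_(k in setT) c k l)%E.
Proof.
move=> c0; rewrite !esum_esum//.
rewrite (reindex_esum (setT `*`` (fun=> setT)) (setT `*`` (fun=> setT)) (fun x => (x.2, x.1)))//.
split => //=; first by move=> [i1 i2] [j1 j2] /= _ _ [] -> ->.
by move=> [k l] _; exists (l, k).
Qed.

(** Tonelli applied separately to the positive and negative parts. *)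
Lemma rsum_fubini (K L : choiceType) (c : K -> L -> R) :
  (\esum_(k in setT) asum (c k) < +oo)%E ->
  rsum (fun k => rsum (c k)) = rsum (fun l => rsum (c^~ l)).
Proof.
move=> cfin.
have ck k : (asum (c k) < +oo)%E.
  apply: le_lt_trans cfin; apply: esum_ge; exists [set k]; first by split.
  by rewrite fsbig_set1.
have cfin' : (\esum_(l in setT) asum (c^~ l) < +oo)%E.
  by rewrite /asum -esum_swap.
have cl l : (asum (c^~ l) < +oo)%E.
  apply: le_lt_trans cfin'; apply: esum_ge; exists [set l]; first by split.
  by rewrite fsbig_set1.
have fin_sub (q : K -> L -> R) : (forall k l, 0 <= q k l) -> (forall k l, `|q k l| <= `|c k l|) ->
    [/\ (asum (fun k => rsum (q k)) < +oo)%E, (asum (fun l => rsum (q^~ l)) < +oo)%E,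
       forall k, (asum (q k) < +oo)%E & forall l, (asum (q^~ l) < +oo)%E] /\
    rsum (fun k => rsum (q k)) = rsum (fun l => rsum (q^~ l)).
  move=> q0 qc.
  have fk k : (asum (q k) < +oo)%E by apply: le_lt_trans (ck k); exact: le_asum.
  have fl l : (asum (q^~ l) < +oo)%E by apply: le_lt_trans (cl l); exact: le_asum.
  have ek k : (rsum (q k))%:E = asum (q k).
    by rewrite ge0_rsumE// fineK// ge0_fin_numE// asum_ge0.
  have el l : (rsum (q^~ l))%:E = asum (q^~ l).
    by rewrite ge0_rsumE// fineK// ge0_fin_numE// asum_ge0.
  have rk k : 0 <= rsum (q k) by rewrite -lee_fin ek asum_ge0.
  have rl l : 0 <= rsum (q^~ l) by rewrite -lee_fin el asum_ge0.
  have E1 : asum (fun k => rsum (q k)) = (\esum_(k in setT) asum (q k))%E.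
    by rewrite ge0_asumE//; apply: eq_esum => k _; exact: ek.
  have E2 : asum (fun l => rsum (q^~ l)) = (\esum_(l in setT) asum (q^~ l))%E.
    by rewrite ge0_asumE//; apply: eq_esum => k _; exact: el.
  split; first split=> //.
  - by rewrite E1; apply: le_lt_trans cfin; apply: le_esum => k _; exact: le_asum.
  - by rewrite E2; apply: le_lt_trans cfin'; apply: le_esum => k _; exact: le_asum.
  - by rewrite !ge0_rsumE// E1 E2 /asum esum_swap.
have [[p1 p2 p3 p4] p5] := fin_sub _ (fun k => ppart_ge0 (c k)) (fun k => ppart_le (c k)).
have [[m1 m2 m3 m4] m5] := fin_sub _ (fun k => npart_ge0 (c k)) (fun k => npart_le (c k)).
transitivity (rsum (fun k => rsum (ppart (c k)) - rsum (npart (c k)))).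
  apply: eq_rsum => k; rewrite -rsumB//; apply: eq_rsum => l; exact: partE.
rewrite rsumB// p5 m5 -rsumB//; apply: eq_rsum => l; rewrite -rsumB//.
by apply: eq_rsum => k; rewrite -partE.
Qed.

(** Identifies unconditional sums over the naturals with limits of partial
    sums; it is what connects [rsum] to the exponential and the logarithm. *)
Lemma rsum_series (c : nat -> R) : (asum c < +oo)%E ->
  (series c @ \oo --> rsum c)%classic.
Proof.
move=> cf; have sm : summable [set: nat] (EFin \o c) by [].
have sm' : summable (fun _ : nat => true) (EFin \o c).
  move: sm; rewrite /summable; congr (_ < _)%E; congr esum.
  by apply/seteqP; split.
have st : (fun _ : nat => true) = [set: nat] :> set nat.
  by apply/seteqP; split.
have h1 := summable_cvg (f := ((EFin \o c)^\+)%E) (P := xpredT).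
have h2 := summable_cvg (f := ((EFin \o c)^\-)%E) (P := xpredT).
have h3 := summable_nneseries_lim (f := ((EFin \o c)^\+)%E) (P := xpredT).
have h4 := summable_nneseries_lim (f := ((EFin \o c)^\-)%E) (P := xpredT).
have {}h1 := h1 (fun _ _ => ltac:(by [])) (summable_funepos sm').
have {}h2 := h2 (fun _ _ => ltac:(by [])) (summable_funeneg sm').
have {}h3 := h3 (fun _ _ => ltac:(by [])) (summable_funepos sm').
have {}h4 := h4 (fun _ _ => ltac:(by [])) (summable_funeneg sm').
have -> : rsum c = lim ((fun n => (\sum_(0 <= k < n) fine (((EFin \o c)^\+)%E k))%R) @ \oo)
    - lim ((fun n => (\sum_(0 <= k < n) fine (((EFin \o c)^\-)%E k))%R) @ \oo).
  rewrite /rsum; congr (_ - _).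
    have -> : (\esum_(k in [set: nat]) (fun k0 => (c k0)%:E)^\+ k)%E =
       (\sum_(i <oo) ((EFin \o c)^\+)%E i)%E by rewrite nneseries_esumT.
    by rewrite h3.
  have -> : (\esum_(k in [set: nat]) (fun k0 => (c k0)%:E)^\- k)%E =
       (\sum_(i <oo) ((EFin \o c)^\-)%E i)%E by rewrite nneseries_esumT.
  by rewrite h4.
have -> : series c = (fun n => \sum_(0 <= k < n) fine (((EFin \o c)^\+)%E k) -
   \sum_(0 <= k < n) fine (((EFin \o c)^\-)%E k)).
  apply/funext => n; rewrite /series /= -sumrB; apply: eq_bigr => k _.
  rewrite funeposE funenegE /= -!EFin_max /=.
  by rewrite !maxEle; case: leP => ?; case: leP => ?; lra.
by apply: cvgB.
Qed.

Lemma asum_nat_le (c : nat -> R) B : (forall n, \sum_(0 <= k < n) `|c k| <= B) ->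
  (asum c <= B%:E)%E.
Proof.
move=> h; rewrite /asum -nneseries_esumT; last by move=> n; rewrite lee_fin.
apply: lime_le; first by apply: is_cvg_nneseries => n _ _; rewrite lee_fin.
by apply: nearW => n; rewrite sumEFin lee_fin.
Qed.

End Rsum.

(** * Generalized monomials and power series on a box *)

Section Monomials.
Variables (R : realType) (n : nat).
Implicit Types (l m y z rho : 'rV[R]_n) (Y : pred 'I_n) (t e : R).

Lemma rsum_le_asum (K : choiceType) (c : K -> R) : (`|rsum c|%:E <= asum c)%E.
Proof.
have [h|] := ltP (asum c) +oo%E; last by rewrite leye_eq => /eqP ->; rewrite leey.
rewrite -[asum c]fineK ?ge0_fin_numE ?asum_ge0// lee_fin; apply: rsum_le.
by rewrite fineK ?ge0_fin_numE ?asum_ge0.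
Qed.

Lemma gpow_powR t e : 0 <= t -> 0 <= e -> gpow t e = t `^ e.
Proof.
move=> t0 e0; rewrite /gpow; case: ifPn => // en.
by rewrite -powR_mulrn// truncnK.
Qed.

Lemma gpow_nat t e : e \is a Num.nat -> gpow t e = t ^+ Num.truncn e.
Proof. by rewrite /gpow => ->. Qed.

Lemma gpow_natr t k : gpow t k%:R = t ^+ k.
Proof. by rewrite gpow_nat ?natr_nat// natrK. Qed.

Lemma gpow0 t : gpow t 0 = 1.
Proof. by rewrite -[0]/(0%:R) gpow_natr expr0. Qed.

Lemma gpow_ge0 t e : 0 <= t -> 0 <= gpow t e.
Proof. by rewrite /gpow; case: ifP => _ t0; rewrite ?exprn_ge0 ?powR_ge0. Qed.

Lemma gpow_gt0 t e : 0 < t -> 0 < gpow t e.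
Proof. by rewrite /gpow; case: ifP => _ t0; rewrite ?exprn_gt0 ?powR_gt0. Qed.

Lemma powR_le t u e : 0 <= t -> t <= u -> 0 <= e -> t `^ e <= u `^ e.
Proof.
by move=> t0 tu e0; apply: ge0_ler_powR; rewrite ?nnegrE// (le_trans t0).
Qed.

Lemma gpow_le t u e : 0 <= t -> t <= u -> 0 <= e -> gpow t e <= gpow u e.
Proof.
by move=> t0 tu e0; have u0 := le_trans t0 tu; rewrite !gpow_powR//; exact: powR_le.
Qed.

Lemma gpow_norm t e : 0 <= e -> (e \is a Num.nat) || (0 <= t) ->
  `|gpow t e| = gpow `|t| e.
Proof.
move=> e0; have [en _|en /= t0] := boolP (e \is a Num.nat).
  by rewrite !gpow_nat// normrX.
by rewrite !ger0_norm// gpow_ge0.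
Qed.

Lemma powRD_ge0 t e f : 0 <= e -> 0 <= f -> t `^ (e + f) = t `^ e * t `^ f.
Proof.
move=> e0 f0; have [->|t0] := eqVneq t 0; last by rewrite powRD// t0 implybT.
have [->|ne] := eqVneq e 0; first by rewrite add0r powRr0 mul1r.
rewrite powRD//; apply/implyP; rewrite gt_eqF// ltr_wpDr// lt_neqAle eq_sym ne//.
Qed.

Lemma gpowD t e f : 0 <= e -> 0 <= f ->
  ((e \is a Num.nat) && (f \is a Num.nat)) || (0 <= t) ->
  gpow t (e + f) = gpow t e * gpow t f.
Proof.
move=> e0 f0; case/orP => [/andP[en fn]|t0].
  rewrite !gpow_nat ?rpredD// -exprD; congr (_ ^+ _).
  by rewrite truncnD ?nnegrE.
by rewrite !gpow_powR ?addr_ge0// powRD_ge0.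
Qed.

(** Exponents of a series in which the variables of [Y] carry natural powers. *)
Definition admissible Y : set 'rV[R]_n :=
  [set l | forall i, 0 <= l ord0 i /\ (Y i -> l ord0 i \is a Num.nat)].

(** The closed polydisc of polyradius [rho], cut by the half-spaces on which
    real powers of the variables outside [Y] make sense. *)
Definition box Y rho : set 'rV[R]_n :=
  [set y | forall i, `|y ord0 i| <= rho ord0 i /\ (~~ Y i -> 0 <= y ord0 i)].

Lemma admissibleD Y l m : admissible Y l -> admissible Y m -> admissible Y (l + m).
Proof.
move=> al am i; have [l0 ln] := al i; have [m0 mn] := am i; rewrite mxE.
by split; [rewrite addr_ge0|move=> Yi; rewrite rpredD ?ln ?mn].
Qed.

Lemma admissible0 Y : admissible Y 0.
Proof. by move=> i; rewrite mxE lexx; split. Qed.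

Lemma admissible_predT Y l : admissible predT l -> admissible Y l.
Proof. by move=> h i; have [h1 h2] := h i; split=> // _; exact: h2. Qed.

Lemma box_side Y l rho y : admissible Y l -> box Y rho y -> forall i,
  (l ord0 i \is a Num.nat) || (0 <= y ord0 i).
Proof.
move=> al by_ i; have [_ hn] := al i; have [_ hp] := by_ i.
by case: (boolP (Y i)) => [/hn ->|/hp ->]//; rewrite orbT.
Qed.

Lemma gmonomialD Y rho l m y : admissible Y l -> admissible Y m -> box Y rho y ->
  gmonomial (l + m) y = gmonomial l y * gmonomial m y.
Proof.
move=> al am yb; rewrite /gmonomial -big_split /=; apply: eq_bigr => i _.
have [l0 ln] := al i; have [m0 mn] := am i; have [_ yp] := yb i.
rewrite mxE gpowD//; case: (boolP (Y i)) => [Yi|/yp ->]; last by rewrite orbT.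
by rewrite ln ?mn.
Qed.

Lemma gmonomial_l0 y : gmonomial 0 y = 1.
Proof. by rewrite /gmonomial big1// => i _; rewrite mxE gpow0. Qed.

Lemma gmonomial_y0 l : (forall i, 0 <= l ord0 i) -> l != 0 -> gmonomial l 0 = 0 :> R.
Proof.
move=> l0 /rV0Pn[i hi].
rewrite /gmonomial (bigD1 i)//= mxE gpow_powR// powR0// mul0r//.
Qed.

Lemma gmonomial_gt0 l rho : pos_orthant rho -> 0 < gmonomial l rho.
Proof. by move=> h; apply: prodr_gt0 => i _; apply: gpow_gt0. Qed.

Lemma gmonomial_le Y l rho y : admissible Y l -> box Y rho y ->
  `|gmonomial l y| <= gmonomial l rho.
Proof.
move=> al yb; rewrite /gmonomial normr_prod; apply: ler_prod => i _.
have [l0 _] := al i; rewrite normr_ge0 /= gpow_norm ?(box_side al yb)//.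
by apply: gpow_le => //; case: (yb i).
Qed.

(** Shrinking one coordinate by a factor [e] gains [e `^ eta] as soon as that
    coordinate occurs with exponent at least [eta]. All the Lipschitz and
    Hölder estimates come from this termwise bound. *)
Lemma gmonomial_small Y l rho y (J : pred 'I_n) e eta : admissible Y l -> box Y rho y ->
  pos_orthant rho -> 0 <= e <= 1 -> 0 < eta ->
  (forall i, J i -> `|y ord0 i| <= e * rho ord0 i) ->
  (exists2 i, J i & eta <= l ord0 i) ->
  `|gmonomial l y| <= e `^ eta * gmonomial l rho.
Proof.
move=> al yb rho0 /andP[e0 e1] eta0 Jy [i Ji etai].
rewrite /gmonomial normr_prod (bigD1 i)//= [X in _ <= _ * X](bigD1 i)//= mulrA.
have l0 k : 0 <= l ord0 k by case: (al k).
apply: ler_pM => //; first by rewrite prodr_ge0.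
  rewrite gpow_norm ?(box_side al yb)//.
  rewrite !gpow_powR//; last exact/ltW/rho0.
  apply: (le_trans (powR_le _ (Jy i Ji) (l0 i))) => //.
  rewrite powRM//; last exact/ltW/rho0.
  rewrite ler_wpM2r ?powR_ge0//.
  have [->|ne0] := eqVneq e 0; first by rewrite !powR0 ?gt_eqF// (lt_le_trans eta0).
  by apply: ger_powR => //; rewrite e1 lt_neqAle eq_sym ne0 e0.
apply: ler_prod => k _; rewrite normr_ge0 /= gpow_norm ?(box_side al yb)//.
by apply: gpow_le => //; case: (yb k).
Qed.

Definition deg l : nat := (\sum_(i < n) Num.truncn (l ord0 i))%N.

Lemma gmonomialZ l e y : admissible predT l -> gmonomial l (e *: y) = e ^+ deg l * gmonomial l y.
Proof.
move=> al; rewrite /gmonomial /deg -prodrXr -big_split /=.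
apply: eq_bigr => i _; have [_ /(_ isT) ln] := al i.
by rewrite !gpow_nat// mxE exprMn.
Qed.

Lemma deg_eq0 l : admissible predT l -> deg l = 0%N -> l = 0.
Proof.
move=> al /eqP; rewrite sum_nat_eq0 => /forallP h.
apply/rowP => i; rewrite mxE; have [_ /(_ isT) ln] := al i.
by rewrite -(truncnK ln) (eqP (implyP (h i) isT)).
Qed.

End Monomials.

Section Rep.
Variables (R : realType) (n : nat).
Implicit Types (l m y z rho : 'rV[R]_n) (Y : pred 'I_n) (t e B : R).
Implicit Types (f g : 'rV[R]_n -> R) (L : set 'rV[R]_n).

(** [Rep Y L rho f B]: on the box of polyradius [rho] the function [f] is the
    sum of a series with exponents in [L] and with norm, the sum of the |s_l|
    rho^l, at most [B]. Keeping the bound explicit turns these functions into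
    a Banach algebra without ever forming the space. *)
Definition Rep Y L rho f B := exists s : 'rV[R]_n -> R,
  [/\ forall l, s l != 0 -> admissible Y l /\ L l,
      (asum (fun l => (s l * gmonomial l rho)%R) <= B%:E)%E
    & forall y, box Y rho y -> f y = rsum (fun l => s l * gmonomial l y)].

Lemma term_le Y (s : 'rV[R]_n -> R) rho y l : (s l != 0 -> admissible Y l) -> box Y rho y ->
  `|s l * gmonomial l y| <= `|s l * gmonomial l rho|.
Proof.
move=> al yb; have [->|sl] := eqVneq (s l) 0; first by rewrite !mul0r.
rewrite !normrM ler_wpM2l// (le_trans (gmonomial_le (al sl) yb))//.
exact: ler_norm.
Qed.

Lemma Rep_ge0 Y L rho f B : Rep Y L rho f B -> 0 <= B.
Proof. by move=> [s [_ h _]]; rewrite -lee_fin (le_trans (asum_ge0 _) h). Qed.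

Lemma Rep_bound Y L rho f B y : Rep Y L rho f B -> box Y rho y -> `|f y| <= B.
Proof.
move=> [s [sa h fE]] yb; rewrite fE//; apply: rsum_le; apply: le_trans h.
by apply: le_asum => l; apply: (term_le (Y := Y)) => // /sa[].
Qed.

Lemma Rep_ext Y L rho f g B : (forall y, box Y rho y -> f y = g y) ->
  Rep Y L rho f B -> Rep Y L rho g B.
Proof.
by move=> fg [s [sa h fE]]; exists s; split=> // y yb; rewrite -fg// fE.
Qed.

Lemma box_le Y rho rho' : (forall i, rho' ord0 i <= rho ord0 i) -> box Y rho' `<=` box Y rho.
Proof.
by move=> h y yb i; have [h1 h2] := yb i; split=> //; rewrite (le_trans h1).
Qed.

Lemma box_self Y rho : (forall i, 0 <= rho ord0 i) -> box Y rho rho.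
Proof. by move=> h i; rewrite ger0_norm// lexx; split. Qed.

Lemma Rep_le Y L L' rho rho' f B B' : L `<=` L' -> (forall i, 0 <= rho' ord0 i) ->
  (forall i, rho' ord0 i <= rho ord0 i) -> B <= B' ->
  Rep Y L rho f B -> Rep Y L' rho' f B'.
Proof.
move=> LL r0 rr BB [s [sa h fE]]; exists s; split.
- by move=> l /sa[? /LL].
- apply: (@le_trans _ _ B%:E); last by rewrite lee_fin.
  apply: le_trans h; apply: le_asum => l; apply: (term_le (Y := Y)); first by case/sa.
  exact: (box_le rr (box_self _ r0)).
- by move=> y /(box_le rr); exact: fE.
Qed.

Lemma Rep_anyY Y L rho f B : Rep predT L rho f B -> Rep Y (L `&` admissible predT) rho f B.
Proof.
move=> [s [sa h fE]]; exists s; split=> //.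
  by move=> l /sa[al Ll]; split=> //; exact: admissible_predT.
by move=> y yb; apply: fE => i; case: (yb i).
Qed.

Lemma Rep_shift Y L L' rho f B m c : pos_orthant rho -> admissible Y m ->
  (forall l, L l -> L' (m + l)) -> Rep Y L rho f B ->
  Rep Y L' rho (fun y => c * gmonomial m y * f y) (`|c| * gmonomial m rho * B).
Proof.
move=> rho0 am LL' [s [sa h fE]].
have bij : bijective (fun l : 'rV[R]_n => m + l).
  by exists (fun l => - m + l) => l; rewrite ?addKr ?addNKr.
exists (fun l => c * s (l - m)); split.
- move=> l sl; have /sa[a1 L1] : s (l - m) != 0 by apply: contraNneq sl => ->; rewrite mulr0.
  by rewrite -(subrK m l) addrC; split; [exact: admissibleD|exact: LL'].
- rewrite -(asum_reindex _ bij) (eq_asum (b := fun l => c * gmonomial m rho * (s l * gmonomial l rho))).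
    rewrite asumZ normrM (ger0_norm (ltW (gmonomial_gt0 _ rho0))) [leRHS]EFinM.
    by rewrite lee_wpmul2l// lee_fin mulr_ge0// ltW ?gmonomial_gt0.
  move=> l /=; rewrite addrC addKr; have [->|sl] := eqVneq (s l) 0; first by rewrite !(mul0r,mulr0).
  have [al _] := sa l sl.
  rewrite (gmonomialD am al (box_self Y _)); first by ring.
  by move=> i; exact: ltW.
- move=> y yb; rewrite fE// -[RHS](rsum_reindex _ bij) -rsumZ.
    apply: eq_rsum => l /=; rewrite [(m + l) - m]addrC addKr.
    have [->|sl] := eqVneq (s l) 0; first by rewrite !(mul0r,mulr0).
    have [al _] := sa l sl.
    by rewrite (gmonomialD am al yb); ring.
  apply: le_lt_trans (ltry B); apply: le_trans h; apply: le_asum => l.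
  by apply: (term_le (Y := Y)) => // /sa[].
Qed.

Lemma Rep_mon Y rho m : pos_orthant rho -> admissible Y m ->
  Rep Y [set m] rho (gmonomial m) (gmonomial m rho).
Proof.
move=> rho0 am; exists (fun l => (l == m)%:R); split.
- by move=> l; have [->|] := eqVneq l m; rewrite ?eqxx.
- rewrite (asum_single (k0 := m)); last by move=> l /negbTE ->; rewrite mul0r.
  by rewrite eqxx mul1r ger0_norm// ltW// gmonomial_gt0.
- move=> y _; rewrite (rsum_single (k0 := m)); first by rewrite eqxx mul1r.
  by move=> l /negbTE ->; rewrite mul0r.
Qed.

Lemma Rep_cst Y L rho c : pos_orthant rho -> L 0 -> Rep Y L rho (fun=> c) `|c|.
Proof.
move=> rho0 L0; exists (fun l => if l == 0 then c else 0); split.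
- by move=> l; have [->|] := eqVneq l 0; rewrite ?eqxx// => _; split=> //; exact: admissible0.
- rewrite (asum_single (k0 := 0)); last by move=> l /negbTE ->; rewrite mul0r.
  by rewrite eqxx gmonomial_l0 mulr1.
- move=> y _; rewrite (rsum_single (k0 := 0)); first by rewrite eqxx gmonomial_l0 mulr1.
  by move=> l /negbTE ->; rewrite mul0r.
Qed.

Lemma Rep_finite Y (s : 'rV[R]_n -> R) rho y B : (forall l, s l != 0 -> admissible Y l) ->
  (asum (fun l => (s l * gmonomial l rho)%R) <= B%:E)%E -> box Y rho y ->
  (asum (fun l => (s l * gmonomial l y)%R) < +oo)%E.
Proof.
move=> sa h yb; apply: le_lt_trans (ltry B); apply: le_trans h; apply: le_asum => l.
by apply: (term_le (Y := Y)) => // /sa.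
Qed.

Lemma Rep_scale Y L rho f B c : pos_orthant rho -> Rep Y L rho f B ->
  Rep Y L rho (fun y => c * f y) (`|c| * B).
Proof.
move=> rho0 h; have := Rep_shift c rho0 (@admissible0 R n Y) (L' := L) _ h.
rewrite gmonomial_l0 mulr1 => /(_ ltac:(by move=> l; rewrite add0r)).
by apply: Rep_ext => y _; rewrite gmonomial_l0 mulr1.
Qed.

Lemma Rep_add Y L rho f g B B' : Rep Y L rho f B -> Rep Y L rho g B' ->
  Rep Y L rho (fun y => f y + g y) (B + B').
Proof.
move=> [s [sa hs fE]] [t [ta ht gE]]; exists (fun l => s l + t l); split.
- move=> l; have [s0|s0] := eqVneq (s l) 0; last by move=> _; exact: sa.
  by rewrite s0 add0r; exact: ta.
- rewrite (eq_asum (b := fun l => s l * gmonomial l rho + t l * gmonomial l rho)); last by move=> l; rewrite mulrDl.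
  by rewrite (le_trans (asumD _ _))// EFinD leeD.
- move=> y yb; rewrite fE// gE// -rsumD.
  + by apply: eq_rsum => l; rewrite mulrDl.
  + by apply: (Rep_finite (Y := Y) _ hs yb) => l /sa[].
  + by apply: (Rep_finite (Y := Y) _ ht yb) => l /ta[].
Qed.

(** Completeness of the algebra: a family of functions whose norms are
    summable may be summed termwise, and the result is again a series.
    Products, exponentials, logarithms and substitutions are all obtained by
    writing them as such sums. *)
Lemma Rep_sum (K : choiceType) Y L rho (f : K -> 'rV[R]_n -> R) (Bk : K -> R) B :
  pos_orthant rho -> (forall k, Rep Y L rho (f k) (Bk k)) -> (asum Bk <= B%:E)%E ->
  Rep Y L rho (fun y => rsum (f^~ y)) B.
Proof.
move=> rho0 fR BkB.
have [s sP] := choice fR.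
have mp l : 0 < gmonomial l rho by exact: gmonomial_gt0.
have tot : (\esum_(k in setT) asum (fun l => (s k l * gmonomial l rho)%R) <= B%:E)%E.
  apply: le_trans BkB; apply: le_esum => k _; have [_ h _] := sP k.
  by rewrite ger0_norm//; exact: Rep_ge0 (fR k).
have tot' : (\esum_(l in setT) asum (fun k => (s k l * gmonomial l rho)%R) <= B%:E)%E.
  by rewrite /asum -esum_swap.
have fl l : (asum (s^~ l) < +oo)%E.
  have : (asum (fun k => ((gmonomial l rho)^-1 * (s k l * gmonomial l rho))%R) < +oo)%E.
    rewrite asumZ lte_mul_pinfty ?lee_fin//.
    apply: le_lt_trans (ltry B); apply: le_trans tot'.
    apply: esum_ge; exists [set l]; first by split.
    by rewrite fsbig_set1.
  rewrite (eq_asum (b := s^~ l))// => k; rewrite mulrCA mulVf ?mulr1//.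
  exact: lt0r_neq0.
exists (fun l => rsum (s^~ l)); split.
- move=> l hl; apply: contrapT => nL; move/eqP: hl; apply.
  rewrite -[RHS](rsum0 R K); apply: eq_rsum => k.
  by have [h _ _] := sP k; apply/eqP; apply: contrapT => /negP /h.
- apply: le_trans tot'; apply: le_esum => l _.
  have -> : rsum (s^~ l) * gmonomial l rho = rsum (fun k => s k l * gmonomial l rho).
    by rewrite mulrC -rsumZ//; apply: eq_rsum => k; rewrite mulrC.
  exact: rsum_le_asum.
- move=> y yb; transitivity (rsum (fun k => rsum (fun l => s k l * gmonomial l y))).
    by apply: eq_rsum => k; have [_ _ ->] := sP k.
  rewrite rsum_fubini.
    by apply: eq_rsum => l; rewrite mulrC -rsumZ//; apply: eq_rsum => k; rewrite mulrC.
  apply: le_lt_trans (ltry B); apply: le_trans tot; apply: le_esum => k _.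
  apply: le_asum => l; apply: (term_le (Y := Y)) => //.
  by have [h _ _] := sP k => /h[].
Qed.

(** The product is the sum over the exponents [l] of [f] of the shifted series
    s_l y^l g. *)
Lemma Rep_mul Y L1 L2 L rho f g B1 B2 : pos_orthant rho ->
  (forall l1 l2, L1 l1 -> L2 l2 -> L (l1 + l2)) ->
  Rep Y L1 rho f B1 -> Rep Y L2 rho g B2 ->
  Rep Y L rho (fun y => f y * g y) (B1 * B2).
Proof.
move=> rho0 LL [s [sa hs fE]] gR; have B20 := Rep_ge0 gR.
apply: (@Rep_ext _ _ _ (fun y => rsum (fun l => s l * gmonomial l y * g y))).
  move=> y yb; rewrite fE// mulrC -rsumZ; last by apply: (Rep_finite (Y := Y) _ hs yb) => l /sa[].
  by apply: eq_rsum => l; rewrite mulrC.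
apply: (@Rep_sum _ _ _ _ _ (fun l => `|s l| * gmonomial l rho * B2)) => //.
  move=> l; have [s0|sl] := eqVneq (s l) 0.
    apply: (@Rep_ext _ _ _ (fun=> 0)); first by move=> y _; rewrite s0 !mul0r.
    rewrite s0 normr0 !mul0r; exists (fun=> 0); split.
    - by move=> ?; rewrite eqxx.
    - by rewrite /asum esum1// => ? _; rewrite mul0r normr0.
    - by move=> y _; rewrite -[LHS](rsum0 R 'rV[R]_n); apply: eq_rsum => ?; rewrite mul0r.
  have [al Ll] := sa l sl; apply: Rep_shift gR => // l2 L2l2; exact: LL.
rewrite (eq_asum (b := fun l => B2 * `|s l * gmonomial l rho|)); last first.
  by move=> l; rewrite normrM (ger0_norm (ltW (gmonomial_gt0 _ rho0))) mulrC.
rewrite asumZ ger0_norm// mulrC EFinM lee_wpmul2l ?lee_fin//.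
by apply: le_trans hs; apply: le_asum => l; rewrite normr_id.
Qed.

End Rep.

(** * The logarithm and exponential series *)

Section LnSeries.
Variable R : realType.
Implicit Types x : R.

Lemma rsum_exp x : rsum (exp_coeff x) = expR x /\ (asum (exp_coeff x) <= (expR `|x|)%:E)%E.
Proof.
have le_part N : \sum_(0 <= k < N) `|exp_coeff x k| <= expR `|x|.
  rewrite (eq_bigr (exp_coeff `|x|)); last first.
    by move=> k _; rewrite /exp_coeff /= normrM normrX normfV normr_nat.
  apply: (nondecreasing_cvgn_le (u_ := series (exp_coeff `|x|))).
    by move=> i j ij; rewrite /series /=; apply: nondecreasing_series => // k _ _; rewrite /exp_coeff /= divr_ge0 ?exprn_ge0.
  exact: is_cvg_series_exp_coeff.
have a := asum_nat_le le_part; split=> //.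
have h : series (exp_coeff x) @ \oo --> rsum (exp_coeff x).
  by apply: rsum_series; apply: le_lt_trans a _; rewrite ltry.
by rewrite -(cvg_lim _ h)//.
Qed.

Definition ln_coeff x (k : nat) : R := (-1) ^+ k * x ^+ k.+1 / k.+1%:R.

Let lnp (N : nat) : {poly R} := \sum_(k < N) ((-1) ^+ k / k.+1%:R) *: 'X^(k.+1).

Let lnp_deriv N x : (1 + x) * (lnp N)^`().[x] = 1 - (- x) ^+ N.
Proof.
elim: N => [|N IH]; first by rewrite /lnp big_ord0 deriv0 horner0 expr0 subrr mulr0.
rewrite /lnp big_ord_recr /= derivD hornerD mulrDr IH derivZ derivXn hornerZ hornerMn hornerXn.
rewrite -mulr_natr /= (exprS (- x)) (exprNn x N).
have : N.+1%:R != 0 :> R by [].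
by move=> h; field.
Qed.

(** Only half of the disc of convergence is used, which makes the remainder
    estimate a one-line consequence of the mean value theorem: the difference
    between the logarithm and a partial sum has derivative (- u)^N / (1 + u). *)
Lemma rsum_ln x : `|x| <= 2^-1 ->
  rsum (ln_coeff x) = ln (1 + x) /\ (asum (ln_coeff x) <= 1%:E)%E.
Proof.
move=> hx; have /andP[hx1 hx2] : - 2^-1 <= x <= 2^-1 by rewrite -ler_norml.
have part N : \sum_(0 <= k < N) `|ln_coeff x k| <= 1 - 2^-1 ^+ N.
  elim: N => [|N IH]; first by rewrite big_nil expr0 subrr.
  rewrite big_nat_recr //=.
  have : `|ln_coeff x N| <= 2^-1 ^+ N.+1.
    rewrite /ln_coeff !normrM normrX normrN1 expr1n mul1r normfV normr_nat.
    rewrite ler_pdivrMr// -[leLHS]mulr1; apply: ler_pM; rewrite ?exprn_ge0// ?ler1n//.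
    by rewrite normrX lerXn2r// nnegrE.
  by rewrite exprS; move: IH; lra.
have a : (asum (ln_coeff x) <= 1%:E)%E.
  apply: asum_nat_le => N; apply: le_trans (part N) _.
  by rewrite lerBlDr lerDl exprn_ge0.
split=> //; have h : series (ln_coeff x) @ \oo --> rsum (ln_coeff x).
  by apply: rsum_series; apply: le_lt_trans a _; rewrite ltry.
suff h' : series (ln_coeff x) @ \oo --> ln (1 + x).
  by rewrite -(cvg_lim _ h)// (cvg_lim _ h').
have serE N : series (ln_coeff x) N = (lnp N).[x].
  rewrite /series /= big_mkord /lnp horner_sum; apply: eq_bigr => k _.
  by rewrite hornerZ hornerXn /ln_coeff mulrAC.
have dist N : `|ln (1 + x) - series (ln_coeff x) N| <= 2^-1 ^+ N.
  rewrite serE.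
  pose D := fun u : R => ln (1 + u) - (lnp N).[u].
  pose D' := fun u : R => (1 + u)^-1 - (lnp N)^`().[u].
  have D0 : D 0 = 0.
    rewrite /D addr0 ln1 /lnp horner_sum big1 ?subr0// => k _.
    by rewrite hornerZ hornerXn expr0n mulr0.
  have dD (u : R) : - 2^-1 <= u -> is_derive u 1 D (D' u).
    move=> hu; have u1 : 0 < 1 + u by lra.
    apply: is_deriveB.
    have dg : is_derive u 1 (fun u : R => 1 + u) 1.
      by have := is_deriveD (is_derive_cst (1 : R) u 1) (is_derive_id u 1); rewrite add0r.
    by have := is_derive1_comp (is_derive1_ln u1) dg; rewrite mulr1.
  have D'le (u : R) : - 2^-1 <= u <= 2^-1 -> `|D' u| <= 2 * 2^-1 ^+ N.
    move=> /andP[u1 u2]; have u0 : 0 < 1 + u by lra.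
    have -> : D' u = (1 + u)^-1 * (- u) ^+ N.
      rewrite /D'; have E := lnp_deriv N u.
      have -> : (lnp N)^`().[u] = (1 + u)^-1 * (1 - (- u) ^+ N).
        by rewrite -E mulKf// gt_eqF.
      by ring.
    rewrite normrM normrX normrN; apply: ler_pM => //.
      have h2 : (1 + u)^-1 <= 2 by rewrite -[2]invrK lef_pV2 ?posrE//; lra.
      by rewrite ger0_norm// invr_ge0 ltW.
    by rewrite lerXn2r ?nnegrE// ler_norml u1 u2.
  have Dcont (c d : R) : - 2^-1 <= c -> {within `[c, d], continuous D}.
    move=> ha; apply: derivable_within_continuous => u; rewrite in_itv /= => /andP[cu _].
    by have [] := dD u (le_trans ha cu).
  have bnd (c : R) : - 2^-1 <= c <= 2^-1 -> `|D' c * x| <= 2^-1 ^+ N.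
    move=> hc; rewrite normrM; apply: le_trans (ler_pM _ _ (D'le c hc) hx) _ => //.
    by rewrite mulrAC divff// mul1r.
  case: (leP 0 x) => x0.
    have [|||c] := @MVT_segment R D D' 0 x => //.
    - by move=> u; rewrite in_itv /= => /andP[? _]; apply: dD; lra.
    - by apply: Dcont; lra.
    - rewrite in_itv /= => /andP[c1 c2]; rewrite D0 !subr0 -/(D x) => ->.
      by apply: bnd; lra.
  have [|||c] := @MVT_segment R D D' x 0.
  - exact: ltW.
  - by move=> u; rewrite in_itv /= => /andP[? _]; apply: dD; lra.
  - exact: Dcont.
  - rewrite in_itv /= => /andP[c1 c2]; rewrite D0 !sub0r -/(D x) mulrN => /oppr_inj ->.
    by apply: bnd; lra.
apply/cvgrPdist_le => e e0.
have hg : (fun N => 2^-1 ^+ N : R) @ \oo --> (0 : R).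
  by apply: cvg_expr; rewrite ger0_norm// invf_lt1// ltr1n.
move/cvgrPdist_le : hg => /(_ e e0); apply: filterS => N.
by rewrite sub0r normrN ger0_norm ?exprn_ge0//; exact: le_trans (dist N).
Qed.

End LnSeries.

(** * Operations on power series and growth at the centre *)

Section RepFun.
Variables (R : realType) (n : nat).
Implicit Types (l m y z rho : 'rV[R]_n) (Y : pred 'I_n) (t e B : R).
Implicit Types (f g : 'rV[R]_n -> R) (L : set 'rV[R]_n).

Lemma Rep_pow Y L rho f B k : pos_orthant rho -> L 0 ->
  (forall l1 l2, L l1 -> L l2 -> L (l1 + l2)) ->
  Rep Y L rho f B -> Rep Y L rho (fun y => f y ^+ k) (B ^+ k).
Proof.
move=> rho0 L0 LL h; elim: k => [|k IH].
  have := @Rep_cst R n Y L rho 1 rho0 L0; rewrite normr1.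
  by apply: Rep_ext => y _; rewrite expr0.
by rewrite exprS; apply: Rep_ext (Rep_mul rho0 LL h IH) => y _; rewrite exprS.
Qed.

Lemma Rep_exp Y L rho f B : pos_orthant rho -> L 0 ->
  (forall l1 l2, L l1 -> L l2 -> L (l1 + l2)) ->
  Rep Y L rho f B -> Rep Y L rho (fun y => expR (f y)) (expR B).
Proof.
move=> rho0 L0 LL h; have B0 := Rep_ge0 h.
apply: (@Rep_ext _ _ _ _ _ (fun y => rsum (fun k => exp_coeff (f y) k))).
  by move=> y _; have [-> _] := rsum_exp (f y).
have [_ hB] := rsum_exp B; rewrite ger0_norm// in hB.
(* The bounds B^k / k! of the terms are themselves summable, with sum exp B. *)
apply: (@Rep_sum _ _ _ _ _ _ (fun k y => exp_coeff (f y) k) (exp_coeff B)) => // k.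
have := Rep_scale k`!%:R^-1 rho0 (Rep_pow k rho0 L0 LL h).
rewrite normfV normr_nat mulrC; apply: Rep_ext => y _.
by rewrite mulrC.
Qed.

Lemma Rep_ln Y L rho f B : pos_orthant rho -> L 0 ->
  (forall l1 l2, L l1 -> L l2 -> L (l1 + l2)) -> B <= 2^-1 ->
  Rep Y L rho f B -> Rep Y L rho (fun y => ln (1 + f y)) 1.
Proof.
move=> rho0 L0 LL hB h; have B0 := Rep_ge0 h.
apply: (@Rep_ext _ _ _ _ _ (fun y => rsum (fun k => ln_coeff (f y) k))).
  move=> y yb; have fB := Rep_bound h yb.
  by have [-> _] := @rsum_ln R (f y) (le_trans fB hB).
have nB : `|B| <= 2^-1 by rewrite ger0_norm.
have [_ hB1] := @rsum_ln R B nB.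
apply: (@Rep_sum _ _ _ _ _ _ (fun k y => ln_coeff (f y) k) (fun k => `|ln_coeff B k|)) => //.
  move=> k; have := Rep_scale ((-1) ^+ k / k.+1%:R) rho0 (Rep_pow k.+1 rho0 L0 LL h).
  rewrite /ln_coeff -[X in `|_| * X](ger0_norm (exprn_ge0 k.+1 B0)) -normrM mulrAC.
  by apply: Rep_ext => y _; rewrite mulrAC.
by apply: le_trans hB1; apply: le_asum => k; rewrite normr_id.
Qed.

Lemma Rep_at0 Y L rho f B : pos_orthant rho -> Rep Y L rho f B ->
  exists s : 'rV[R]_n -> R,
  [/\ forall l, s l != 0 -> admissible Y l /\ L l,
      (asum (fun l => (s l * gmonomial l rho)%R) <= B%:E)%E,
      forall y, box Y rho y -> f y = rsum (fun l => s l * gmonomial l y)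
    & f 0 = s 0].
Proof.
move=> rho0 [s [sa h fE]]; exists s; split=> //.
rewrite fE; last by move=> i; rewrite !mxE normr0; split=> //; apply/ltW/rho0.
rewrite (rsum_single (k0 := 0)); first by rewrite gmonomial_l0 mulr1.
move=> l l0; have [->|sl] := eqVneq (s l) 0; first by rewrite mul0r.
have [al _] := sa l sl; rewrite gmonomial_y0 ?mulr0//.
by move=> i; case: (al i).
Qed.

(** Away from the constant term every monomial contains a coordinate of [J]
    with exponent at least [eta], so the deviation from the value at the
    centre is of order [e `^ eta]. For natural exponents [eta] can be taken to
    be 1, which gives a Lipschitz bound; well-ordered exponents still leave a
    positive gap above 0. *)
Lemma Rep_holder Y L rho f B (J : pred 'I_n) eta e y : pos_orthant rho ->
  Rep Y L rho f B -> 0 < eta -> 0 <= e <= 1 ->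
  (forall l, admissible Y l -> L l -> forall i, J i -> l ord0 i != 0 -> eta <= l ord0 i) ->
  box Y rho y -> (forall i, J i -> `|y ord0 i| <= e * rho ord0 i) ->
  (forall i, ~~ J i -> y ord0 i = 0) ->
  `|f y - f 0| <= e `^ eta * B.
Proof.
move=> rho0 fR eta0 e01 Leta yb Jy nJy; have [s [sa h fE f0]] := Rep_at0 rho0 fR.
have fin_y := Rep_finite (fun l sl => (sa l sl).1) h yb.
have s0E : s 0 = rsum (fun l => if l == 0 then s 0 else 0).
  by rewrite (rsum_single (k0 := 0)) ?eqxx// => l /negbTE ->.
rewrite f0 s0E fE// -rsumB//; last first.
  by rewrite (asum_single (k0 := 0)) ?ltry// => l /negbTE ->.
apply: rsum_le; have e0 : 0 <= e `^ eta by exact: powR_ge0.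
rewrite EFinM; apply: le_trans (lee_wpmul2l _ h); last by rewrite lee_fin.
rewrite -[X in (X%:E * _)%E](ger0_norm e0) -asumZ.
apply: le_asum => l; have [->|l0] := eqVneq l 0.
  by rewrite gmonomial_l0 mulr1 subrr normr0.
rewrite subr0; have [->|sl] := eqVneq (s l) 0; first by rewrite !(mul0r, mulr0).
have [al Ll] := sa l sl.
rewrite !normrM (ger0_norm e0) mulrCA ler_wpM2l//.
rewrite (ger0_norm (ltW (gmonomial_gt0 _ rho0))).
have [[i Ji li]|nex] := pselect (exists2 i, J i & l ord0 i != 0).
  apply: (gmonomial_small (J := J) al yb) => //; exists i => //.
  exact: Leta.
suff -> : gmonomial l y = 0.
  by rewrite normr0 mulr_ge0// ltW// gmonomial_gt0.
have /rV0Pn[i li] := l0; have nJi : ~~ J i by apply/negP => Ji; apply: nex; exists i.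
rewrite /gmonomial (bigD1 i)//= nJy// gpow_powR//; last by case: (al i).
by rewrite powR0// mul0r.
Qed.

Lemma admissible_ge1 (Y : pred 'I_n) l i : Y i -> admissible Y l -> l ord0 i != 0 -> 1 <= l ord0 i.
Proof.
move=> Yi al li; have [_ /(_ Yi) ln] := al i.
rewrite -(truncnK ln) ler1n lt0n; apply: contra li => /eqP h.
by rewrite -(truncnK ln) h.
Qed.

Lemma Rep_lip rho f B e y : pos_orthant rho -> Rep predT setT rho f B -> 0 <= e <= 1 ->
  (forall i, `|y ord0 i| <= e * rho ord0 i) -> `|f y - f 0| <= e * B.
Proof.
move=> rho0 fR e01 ye; have /andP[e0 e1] := e01.
rewrite -[e in e * B]powRr1//; apply: (Rep_holder (J := predT) rho0 fR) => //.
  by move=> l al _ i _; exact: (admissible_ge1 (Y := predT)).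
move=> i; split=> //; apply: le_trans (ye i) _.
by rewrite ger_pMl//; exact: rho0.
Qed.

(** In the even part of an analytic function the linear terms cancel, which
    leaves an error of second order. *)
Lemma Rep_quad rho f B e y : pos_orthant rho -> Rep predT setT rho f B -> 0 < e <= 1 ->
  (forall i, `|y ord0 i| <= e * rho ord0 i) ->
  `|f y + f (- y) - 2 * f 0| <= 2 * e ^+ 2 * B.
Proof.
move=> rho0 fR /andP[e0 e1] ye; have [s [sa h fE f0]] := Rep_at0 rho0 fR.
pose z := e^-1 *: y.
have yE : y = e *: z by rewrite scalerA divff ?scale1r// gt_eqF.
have zb : box predT rho z.
  move=> i; split=> //; rewrite mxE normrM ger0_norm ?invr_ge0 ?(ltW e0)//.
  by rewrite mulrC ler_pdivrMr// mulrC.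
clearbody z; have yb : box predT rho y.
  by move=> i; split=> //; apply: le_trans (ye i) _; rewrite ger_pMl//; exact: rho0.
have nyb : box predT rho (- y) by move=> i; split=> //; rewrite mxE normrN; case: (yb i).
have fin1 := Rep_finite (fun l sl => (sa l sl).1) h yb.
have fin2 := Rep_finite (fun l sl => (sa l sl).1) h nyb.
have s0E : 2 * s 0 = rsum (fun l => if l == 0 then 2 * s 0 else 0).
  by rewrite (rsum_single (k0 := 0)) ?eqxx// => l /negbTE ->.
rewrite f0 s0E !fE// -rsumD// -rsumB//; last 2 first.
- by apply: le_lt_trans (asumD _ _) _; rewrite lte_add_pinfty.
- by rewrite (asum_single (k0 := 0)) ?ltry// => l /negbTE ->.
apply: rsum_le; have e20 : 0 <= 2 * e ^+ 2 by rewrite mulr_ge0// exprn_ge0// ltW.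
rewrite EFinM; apply: le_trans (lee_wpmul2l _ h); last by rewrite lee_fin.
rewrite -[X in (X%:E * _)%E](ger0_norm e20) -asumZ.
apply: le_asum => l; have [->|l0] := eqVneq l 0.
  by rewrite !gmonomial_l0 mulr1 (_ : s 0 + s 0 - 2 * s 0 = 0) ?normr0//; ring.
rewrite subr0; have [->|sl] := eqVneq (s l) 0; first by rewrite !(mul0r, mulr0) addr0.
have [al _] := sa l sl.
have -> : - y = (- e) *: z by rewrite yE scaleNr.
rewrite yE !gmonomialZ// exprNn.
have := gmonomial_le al zb; set M := gmonomial l z; set P := gmonomial l rho => MP.
have P0 : 0 < P by exact: gmonomial_gt0.
case E : (deg l) => [|[|d]].
- by move: l0; rewrite (deg_eq0 al E) eqxx.
- have -> : s l * (e ^+ 1 * M) + s l * ((-1) ^+ 1 * e ^+ 1 * M) = 0 by ring.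
  by rewrite normr0.
- have ed : e ^+ d.+2 <= e ^+ 2.
    by rewrite -[d.+2]/(2 + d)%N exprD ger_pMr ?exprn_gt0// exprn_ile1// ltW.
  rewrite -mulrDr [leRHS]normrM (ger0_norm e20) !(normrM (s l)).
  rewrite (ger0_norm (ltW P0)) (mulrCA _ `|s l|) ler_wpM2l//.
  have q0 : 0 <= e ^+ d.+2 by rewrite exprn_ge0// ltW.
  have s1 : `|(-1) ^+ d.+2| = 1 :> R by rewrite normrX normrN1 expr1n.
  move: (e ^+ d.+2) ((-1) ^+ d.+2) s1 q0 ed => q s1 hs1 q0 qe.
  apply: le_trans (ler_normD _ _) _; rewrite !normrM hs1 mul1r (ger0_norm q0).
  by have := ler_pM q0 (normr_ge0 M) qe MP; lra.
Qed.

(** For a function vanishing at the centre, shrinking the polydisc makes the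
    norm as small as desired; this is what allows it to be substituted into
    another series. *)
Lemma Rep_small rho f B e : pos_orthant rho -> Rep predT setT rho f B -> f 0 = 0 ->
  0 < e <= 1 -> Rep predT setT (e *: rho) f (e * B).
Proof.
move=> rho0 fR ff0 /andP[e0 e1]; have [s [sa h fE f0]] := Rep_at0 rho0 fR.
have rb : box predT rho (e *: rho).
  move=> i; split=> //; rewrite mxE ger0_norm; first by rewrite ger_pMl//; exact: rho0.
  by rewrite mulr_ge0// ltW//; exact: rho0.
exists s; split=> //.
  rewrite EFinM; apply: le_trans (lee_wpmul2l _ h); last by rewrite lee_fin ltW.
  rewrite -[X in (X%:E * _)%E](ger0_norm (ltW e0)) -asumZ.
  apply: le_asum => l; have [->|sl] := eqVneq (s l) 0; first by rewrite !(mul0r, mulr0).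
  have [al _] := sa l sl; rewrite !normrM (ger0_norm (ltW e0)) mulrCA ler_wpM2l//.
  rewrite (ger0_norm (ltW (gmonomial_gt0 _ rho0))).
  have l0 : l != 0 by apply: contraNneq sl => ->; rewrite -f0 ff0.
  have /rV0Pn[i li] := l0.
  rewrite -[X in X * _](powRr1 (ltW e0)).
  apply: (gmonomial_small (J := predT) al rb) => //; first by rewrite (ltW e0) e1.
    by move=> k _; rewrite mxE ger0_norm// mulr_ge0 ?(ltW e0)// ltW//; exact: rho0.
  by exists i => //; exact: (admissible_ge1 (Y := predT)).
move=> y yb; apply: fE; apply: box_le yb => i; rewrite mxE ger_pMl//; exact: rho0.
Qed.

Definition unit_row (j : 'I_n) : 'rV[R]_n := delta_mx ord0 j.

Lemma unit_rowE j i : unit_row j ord0 i = (i == j)%:R.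
Proof. by rewrite mxE eqxx. Qed.

Lemma gmonomial_scale_unit_row j e y : gmonomial (e *: unit_row j) y = gpow (y ord0 j) e.
Proof.
rewrite /gmonomial (bigD1 j)//= !mxE !eqxx mulr1 big1 ?mulr1// => i /negbTE ij.
by rewrite !mxE ij andbF mulr0 gpow0.
Qed.

Lemma gmonomial_unit_row j y : gmonomial (unit_row j) y = y ord0 j.
Proof. by rewrite -[unit_row j]scale1r gmonomial_scale_unit_row -[1]/(1%:R) gpow_natr expr1. Qed.

Lemma admissible_unit_row j : admissible predT (unit_row j).
Proof. by move=> i; rewrite unit_rowE; split=> //; rewrite natr_nat. Qed.

Definition kill (j : 'I_n) y : 'rV[R]_n := \row_i (if i == j then 0 else y ord0 i).

(** The quotient is obtained by lowering the [j]-th exponent in the terms that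
    contain the variable; the remaining terms are exactly the value at [kill j
    y]. *)
Lemma Rep_div rho f B j : pos_orthant rho -> Rep predT setT rho f B ->
  exists U, Rep predT setT rho U (B / rho ord0 j) /\
    forall y, box predT rho y -> f y - f (kill j y) = y ord0 j * U y.
Proof.
move=> rho0 [s [sa h fE]]; have rj := rho0 j.
have rj0 : 0 <= (rho ord0 j)^-1 by rewrite invr_ge0 ltW.
pose t l := if `[< admissible predT l >] then s (l + unit_row j) else 0.
have bij : bijective (fun l : 'rV[R]_n => l + unit_row j).
  by exists (fun l => l - unit_row j) => l; rewrite ?addrK ?subrK.
have tE rho' y l : box predT rho' y -> y ord0 j * (t l * gmonomial l y) =
    (if `[< admissible predT l >] then s (l + unit_row j) * gmonomial (l + unit_row j) y else 0).
  move=> yb; rewrite /t; case: asboolP => al; last by rewrite mul0r mulr0.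
  by rewrite (gmonomialD al (admissible_unit_row j) yb) gmonomial_unit_row; ring.
have rb : box predT rho rho by apply: box_self => i; exact/ltW.
have tB : (asum (fun l => (t l * gmonomial l rho)%R) <= (B / rho ord0 j)%:E)%E.
  rewrite mulrC EFinM; apply: le_trans (lee_wpmul2l _ h); last by rewrite lee_fin invr_ge0 ltW.
  rewrite -[X in (_ <= _ * X)%E](asum_reindex _ bij) -[X in (X%:E * _)%E](ger0_norm rj0).
  rewrite -asumZ; apply: le_asum => l /=.
  have -> : t l * gmonomial l rho = (rho ord0 j)^-1 * (rho ord0 j * (t l * gmonomial l rho)).
    by rewrite mulKf// gt_eqF.
  rewrite (tE rho)// !normrM ler_wpM2l//; case: asboolP => _; first by rewrite normrM.
  by rewrite normr0 mulr_ge0.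
have ta l : t l != 0 -> admissible predT l.
  by rewrite /t; case: asboolP => //; rewrite eqxx.
exists (fun y => rsum (fun l => t l * gmonomial l y)); split.
  by exists t; split=> // l /ta.
move=> y yb; rewrite -rsumZ; last exact: (Rep_finite ta tB yb).
under eq_rsum do rewrite (tE rho)//.
have kb : box predT rho (kill j y).
  move=> i; rewrite mxE; split=> //; case: ifP => _; last by case: (yb i).
  by rewrite normr0 ltW//; exact: rho0.
rewrite !fE// -rsumB; last 2 first.
- exact: (Rep_finite (fun l sl => (sa l sl).1) h yb).
- exact: (Rep_finite (fun l sl => (sa l sl).1) h kb).
rewrite -[LHS](rsum_reindex _ bij); apply: eq_rsum => l /=.
have [sl|sl] := eqVneq (s (l + unit_row j)) 0.
  by rewrite sl !mul0r subrr; case: asboolP.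
have [al _] := sa _ sl.
have lnat i : i != j -> 0 <= l ord0 i /\ l ord0 i \is a Num.nat.
  move=> ij; have := al i; rewrite mxE unit_rowE (negbTE ij) addr0 => -[? hn].
  by split=> //; exact: hn.
case: asboolP => al'.
  suff -> : gmonomial (l + unit_row j) (kill j y) = 0 by rewrite mulr0 subr0.
  rewrite /gmonomial (bigD1 j)//= mxE eqxx gpow_powR//; last by case: (al j).
  rewrite powR0 ?mul0r// mxE unit_rowE eqxx.
  have [lj _] := al' j; rewrite gt_eqF// ltr_wpDl//.
suff lj : l ord0 j = -1.
  suff -> : gmonomial (l + unit_row j) (kill j y) = gmonomial (l + unit_row j) y by rewrite subrr.
  apply: eq_bigr => i _; rewrite mxE; case: eqP => // ->.
  by rewrite mxE unit_rowE eqxx lj addNr !gpow0.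
have [a0 /(_ isT) an] := al j; rewrite mxE unit_rowE eqxx in a0 an.
have /natrP[[|k] kE] := an.
  by move/eqP: kE; rewrite addr_eq0 => /eqP.
exfalso; apply: al' => i; have [->|/lnat] := eqVneq i j; last by move=> [? ?]; split.
suff -> : l ord0 j = k%:R by split=> //; rewrite natr_nat.
by move: kE; rewrite -natr1 => /addIr.
Qed.

End RepFun.

(** * Well-ordered exponents and germs of analytic functions *)

Section WellOrdered.
Variable R : realType.
Implicit Types (A V W : set R).

(** Well-ordered subsets of the reals, without the boolean predicates of
    [wo_chain]. *)
Definition wo_set W := forall A, A `<=` W -> A !=set0 ->
  exists z, A z /\ forall x, A x -> z <= x.

Lemma wo_setP W : wo_chain <=%R [in W] <-> wo_set W.
Proof.
split=> [h A AW [x Ax]|h].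
  have [z [[zA zmin] _]] := h [in A] (fun u hu => mem_set (AW u (set_mem hu)))
     (ex_intro _ x (mem_set Ax)).
  exists z; split; first exact: (set_mem zA).
  by move=> u Au; apply: zmin; exact: mem_set.
apply: antisymmetric_wo_chain.
  by move=> x y _ _; exact: le_anti.
move=> P PW [x Px]; have [z [Pz zmin]] := h [set u | u \in P] (fun u Pu => set_mem (PW u Pu)) (ex_intro _ x Px).
by exists z; split.
Qed.

Lemma wo_set_sub V W : V `<=` W -> wo_set W -> wo_set V.
Proof. by move=> VW h A AV; apply: h => x /AV/VW. Qed.

Lemma wo_setU V W : wo_set V -> wo_set W -> wo_set (V `|` W).
Proof.
move=> hV hW A AVW [x Ax].
have [vne|ve] := pselect ((A `&` V) !=set0); last first.
  have AW : A `<=` W.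
    move=> u Au; case: (AVW u Au) => // Vu; exfalso; apply: ve.
    by exists u.
  by apply: hW => //; exists x.
have [wne|we] := pselect ((A `&` W) !=set0); last first.
  have AV : A `<=` V.
    move=> u Au; case: (AVW u Au) => // Wu; exfalso; apply: we.
    by exists u.
  by apply: hV => //; exists x.
have [u [[Au Vu] umin]] := hV _ (@subIsetr _ _ _) vne.
have [v [[Av Wv] vmin]] := hW _ (@subIsetr _ _ _) wne.
exists (Num.min u v); split; first by case: (leP u v).
move=> y Ay; rewrite ge_min; case: (AVW y Ay) => h.
  by rewrite umin.
by rewrite vmin ?orbT.
Qed.

Lemma wo_set_image V (f : R -> R) : {in V &, {homo f : x y / x <= y}} -> wo_set V -> wo_set (f @` V).
Proof.
move=> fmono hV A AfV [y Ay].
have [||v [[Vv Afv] vmin]] := hV [set v | V v /\ A (f v)]; first by move=> v [].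
  by have [v Vv fv] := AfV y Ay; exists v; split=> //; rewrite fv.
exists (f v); split=> // u Au; have [w Vw fw] := AfV u Au; rewrite -fw.
by apply: fmono; rewrite ?inE//; apply: vmin; split=> //; rewrite fw.
Qed.

Lemma wo_set1 x : wo_set [set x].
Proof.
move=> A Ax [y Ay]; exists y; split=> // z Az.
by rewrite (Ax y Ay) (Ax z Az).
Qed.

(** Below a given element only finitely many natural translates matter, and a
    finite union of well-ordered sets is well ordered. *)
Lemma wo_set_add_nat V : (forall v, V v -> 0 <= v) -> wo_set V ->
  wo_set [set x | exists v k, V v /\ x = v + k%:R].
Proof.
move=> V0 hV; have hK K : wo_set [set x | exists v k, [/\ V v, (k < K)%N & x = v + k%:R]].
  elim: K => [|K IH]; first by move=> A AE [x /AE[v [k []]]].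
  apply: (@wo_set_sub _ ([set x | exists v k, [/\ V v, (k < K)%N & x = v + k%:R]]
     `|` ((fun v => v + K%:R) @` V))).
    move=> x [v [k [Vv]]]; rewrite ltnS leq_eqVlt => /orP[/eqP -> ->|kK ->].
      by right; exists v.
    by left; exists v, k.
  by apply: wo_setU => //; apply: wo_set_image => // u v _ _; rewrite lerD2r.
move=> A AV [a Aa].
have [|z [[Az _] zmin]] := hK (Num.truncn a).+1 (A `&` [set x | x <= a]) _ (ex_intro _ a (conj Aa (lexx _))).
  move=> x [Ax xa]; have [v [k [Vv xE]]] := AV x Ax; exists v, k; split=> //.
  rewrite ltnS truncn_ge_nat; last first.
    by have [v' [k' [Vv' ->]]] := AV a Aa; rewrite addr_ge0// V0.
  by apply: le_trans xa; rewrite xE lerDr V0.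
exists z; split=> // x Ax; have [xa|/ltW ax] := leP x a; first by apply: zmin.
by apply: le_trans ax; apply: zmin; split=> //=; exact: lexx.
Qed.

(** The least positive exponent, replaced by 1 when it is larger or does not
    exist; it serves as a Hölder exponent. *)
Lemma wo_set_gap W : wo_set W -> exists eta, [/\ 0 < eta, eta <= 1 & forall w, W w -> 0 < w -> eta <= w].
Proof.
move=> hW; have [ne|e] := pselect ((W `&` [set w | 0 < w]) !=set0).
  have [z [[Wz z0] zmin]] := hW _ (@subIsetl _ _ _) ne.
  exists (Num.min z 1); split; rewrite ?lt_min ?z0 ?ltr01//.
    by rewrite ge_min lexx orbT.
  by move=> w Ww w0; rewrite ge_min zmin.
exists 1; split=> // w Ww w0; exfalso; apply: e; by exists w.
Qed.

End WellOrdered.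

Section Small.
Variable R : realType.

Lemma half_lt (u : R) : 0 < u -> u / 2 < u.
Proof. by move=> u0; rewrite ltr_pdivrMr// ltr_pMr// ltr1n. Qed.

(** Conditions that hold for all sufficiently small positive reals are stable
    under finite conjunction; every choice of a radius below goes through this
    lemma or the next one. *)
Lemma small_all (T : finType) (P : T -> R -> Prop) :
  (forall i, exists2 e, 0 < e & forall t, 0 < t -> t <= e -> P i t) ->
  exists2 e, 0 < e & forall t, 0 < t -> t <= e -> forall i, P i t.
Proof.
move=> h; have /choice[e eP] : forall i, exists e, 0 < e /\ forall t, 0 < t -> t <= e -> P i t.
  by move=> i; have [e e0 he] := h i; exists e.
exists (\big[Num.min/1]_(i : T) e i).
  elim/big_ind: _ => //; first by move=> x y x0 y0; rewrite lt_min x0 y0.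
  by move=> i _; have [] := eP i.
move=> t t0 te i; have [_ he] := eP i; apply: he => //; apply: le_trans te _.
by rewrite (bigD1 i)//= ge_min lexx.
Qed.

Lemma small_and (P Q : R -> Prop) :
  (exists2 e, 0 < e & forall t, 0 < t -> t <= e -> P t) ->
  (exists2 e, 0 < e & forall t, 0 < t -> t <= e -> Q t) ->
  exists2 e, 0 < e & forall t, 0 < t -> t <= e -> P t /\ Q t.
Proof.
move=> [e e0 he] [d d0 hd]; exists (Num.min e d); first by rewrite lt_min e0 d0.
by move=> t t0; rewrite le_min => /andP[te td]; split; [exact: he|exact: hd].
Qed.

Lemma small_mul (B c : R) : 0 < c -> exists2 e, 0 < e & forall t, 0 < t -> t <= e -> t * B <= c.
Proof.
move=> c0; have d0 : 0 < `|B| + 1 by rewrite ltr_wpDl.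
exists (c / (`|B| + 1)); first by rewrite divr_gt0.
move=> t t0; rewrite ler_pdivlMr// => h; apply: le_trans h.
by rewrite ler_wpM2l ?(ltW t0)// (le_trans (ler_norm B))// lerDl.
Qed.

Lemma small_pow (ga r B c : R) : 0 < ga -> 0 < r -> 0 < B -> 0 < c ->
  exists2 e, 0 < e & forall t, 0 < t -> t <= e -> (t * r) `^ ga * B <= c.
Proof.
move=> ga0 r0 B0 c0; exists ((c / B) `^ ga^-1 / r).
  by rewrite divr_gt0// powR_gt0// divr_gt0.
move=> t t0; rewrite ler_pdivlMr// => h.
rewrite -ler_pdivlMr//; have := powR_le (mulr_ge0 (ltW t0) (ltW r0)) h (ltW ga0).
by rewrite -powRrM mulVf ?gt_eqF// powRr1// divr_ge0// ltW.
Qed.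

End Small.

Section Germs.
Variables (R : realType) (n : nat).
Implicit Types (l m y z rho a b x : 'rV[R]_n) (Y : pred 'I_n) (t e B r : R).
Implicit Types (f g : 'rV[R]_n -> R) (L U : set 'rV[R]_n).

(** Closeness coordinate by coordinate, which avoids the norm of row vectors
    and makes sense in dimension 0. *)
Definition rclose r x a := forall i, `|x ord0 i - a ord0 i| < r.

Lemma near_rowP a (P : 'rV[R]_n -> Prop) :
  (\forall x \near a, P x) <-> exists2 r, 0 < r & forall x, rclose r x a -> P x.
Proof.
split=> [/nbhs_ballP[r /= r0 h]|[r r0 h]].
  exists r => // x xa; apply: h; split=> // i j; rewrite (ord1 i) /ball /= distrC.
  exact: xa.
apply/nbhs_ballP; exists r => //= x xa; apply: h => i.
by have [_ /(_ ord0 i)] := xa; rewrite /ball /= distrC.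
Qed.

Lemma pos_const r : 0 < r -> pos_orthant (const_mx r : 'rV[R]_n).
Proof. by move=> r0 i; rewrite mxE. Qed.

(** Germs at 0 of real analytic functions. A single radius for all the
    variables is enough since polydiscs may be shrunk. *)
Definition agerm f := exists r B, 0 < r /\ Rep predT setT (const_mx r) f B.

Lemma Rep_const Y L rho f B : pos_orthant rho -> Rep Y L rho f B ->
  exists2 r, 0 < r & Rep Y L (const_mx r) f B.
Proof.
move=> rho0 h; have [|r r0 hr] := @small_all R 'I_n (fun i t => t <= rho ord0 i).
  by move=> i; exists (rho ord0 i) => //; exact: rho0.
exists r => //; apply: Rep_le h => // i; rewrite mxE; first exact: ltW.
exact: hr.
Qed.

Lemma Rep_shrink Y L r r' f B : 0 < r' -> r' <= r -> Rep Y L (const_mx r) f B ->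
  Rep Y L (const_mx r') f B.
Proof. by move=> r0 rr; apply: Rep_le => // i; rewrite !mxE// ltW. Qed.

Lemma agerm_ext r f g : 0 < r -> (forall y, box predT (const_mx r) y -> f y = g y) ->
  agerm f -> agerm g.
Proof.
move=> r0 fg [r' [B [r'0 h]]]; exists (Num.min r r'), B; split; first by rewrite lt_min r0.
have m0 : 0 < Num.min r r' by rewrite lt_min r0.
apply: Rep_ext (Rep_shrink m0 _ h); last by rewrite ge_min lexx orbT.
move=> y yb; apply: fg; apply: box_le yb => i; rewrite !mxE.
by rewrite ge_min lexx.
Qed.

Lemma agerm_pair f g : agerm f -> agerm g -> exists r B B', [/\ 0 < r,
  Rep predT setT (const_mx r) f B & Rep predT setT (const_mx r) g B'].
Proof.
move=> [r [B [r0 h]]] [r' [B' [r'0 h']]]; exists (Num.min r r'), B, B'.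
have m0 : 0 < Num.min r r' by rewrite lt_min r0.
by split=> //; [apply: Rep_shrink h|apply: Rep_shrink h'] => //; rewrite ge_min lexx ?orbT.
Qed.

Lemma agerm_cst c : agerm (fun=> c).
Proof. by exists 1, `|c|; split=> //; apply: Rep_cst => //; exact: pos_const. Qed.

Lemma agerm_coord i : agerm (fun y => y ord0 i).
Proof.
exists 1, (gmonomial (unit_row R i) (const_mx 1)); split=> //.
apply: (@Rep_ext _ _ _ _ _ (gmonomial (unit_row R i))); first by move=> y _; rewrite gmonomial_unit_row.
have r1 : pos_orthant (const_mx 1 : 'rV[R]_n) by exact: pos_const.
apply: Rep_le (Rep_mon r1 (admissible_unit_row R i)) => // j; rewrite mxE//.
Qed.

Lemma agerm_add f g : agerm f -> agerm g -> agerm (fun y => f y + g y).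
Proof.
by move=> hf /(agerm_pair hf)[r [B [B' [r0 h h']]]]; exists r, (B + B'); split=> //; exact: Rep_add.
Qed.

Lemma agerm_mul f g : agerm f -> agerm g -> agerm (fun y => f y * g y).
Proof.
move=> hf /(agerm_pair hf)[r [B [B' [r0 h h']]]]; exists r, (B * B'); split=> //.
by apply: Rep_mul h h' => //; exact: pos_const.
Qed.

Lemma agerm_scale c f : agerm f -> agerm (fun y => c * f y).
Proof. by move=> h; apply: agerm_mul => //; exact: agerm_cst. Qed.

Lemma agerm_prod (T : Type) (s : seq T) (P : pred T) (f : T -> 'rV[R]_n -> R) :
  (forall i, P i -> agerm (f i)) -> agerm (fun y => \prod_(i <- s | P i) f i y).
Proof.
move=> h; elim: s => [|i s IH].
  have := agerm_cst 1; congr agerm; by apply/funext => y; rewrite big_nil.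
case: (boolP (P i)) => Pi; last first.
  by move: IH; congr agerm; apply/funext => y; rewrite big_cons (negbTE Pi).
have := agerm_mul (h i Pi) IH; congr agerm; by apply/funext => y; rewrite big_cons Pi.
Qed.

Lemma agerm_exp f : agerm f -> agerm (fun y => expR (f y)).
Proof.
move=> [r [B [r0 h]]]; exists r, (expR B); split=> //; apply: Rep_exp => //.
exact: pos_const.
Qed.

Lemma agerm_lip f : agerm f -> exists r B, [/\ 0 < r, 0 <= B & forall y e, 0 <= e <= 1 ->
  (forall i, `|y ord0 i| <= e * r) -> `|f y - f 0| <= e * B].
Proof.
move=> [r [B [r0 h]]]; exists r, B; split=> //; first exact: Rep_ge0 h.
move=> y e e01 ye; apply: (Rep_lip (pos_const r0) h e01) => i; rewrite mxE.
exact: ye.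
Qed.

Lemma agerm_vanish f : agerm f -> f 0 = 0 -> exists r B, 0 < r /\
  forall e, 0 < e <= 1 -> Rep predT setT (const_mx (e * r)) f (e * B).
Proof.
move=> [r [B [r0 h]]] f0; exists r, B; split=> // e e01.
have -> : const_mx (e * r) = e *: const_mx r :> 'rV[R]_n by apply/rowP => i; rewrite !mxE.
exact: (Rep_small (pos_const r0) h f0 e01).
Qed.

(** Near the centre f = f(0) (1 + v) with v of norm at most 1/2, so that the
    logarithmic series applies to v. *)
Lemma agerm_ln f : agerm f -> 0 < f 0 -> agerm (fun y => ln (f y)).
Proof.
move=> hf f00; pose v y := (f 0)^-1 * f y - 1.
have hv : agerm v by apply: agerm_add (agerm_cst (-1)); exact: agerm_scale.
have v0 : v 0 = 0 by rewrite /v mulVf ?subrr// gt_eqF.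
have [r [B [r0 hB]]] := agerm_vanish hv v0.
have [|e e0 he] := @small_mul R B 2^-1; first by rewrite invr_gt0.
pose d := Num.min e 1; have d0 : 0 < d by rewrite lt_min e0 ltr01.
have d1 : 0 < d <= 1 by rewrite d0 /d ge_min lexx orbT.
have dB : d * B <= 2^-1 by apply: he => //; rewrite /d ge_min lexx.
have rep := hB d d1; have dr0 : 0 < d * r by rewrite mulr_gt0.
have hl : agerm (fun y => ln (1 + v y)).
  by exists (d * r), 1; split=> //; apply: Rep_ln rep => //; exact: pos_const.
apply: (@agerm_ext (d * r) (fun y => ln (f 0) + ln (1 + v y))) => //; last first.
  by apply: agerm_add => //; exact: agerm_cst.
move=> y yb; have := Rep_bound rep yb => vb.
have vy : 0 < 1 + v y by have := le_trans vb dB; rewrite ler_norml => /andP[]; lra.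
rewrite -lnM ?posrE//; congr ln; rewrite /v addrC subrK mulrA divff ?mul1r//.
by rewrite gt_eqF.
Qed.

(** Real powers of a coordinate are analytic away from 0, being exponentials
    of multiples of a logarithm. *)
Lemma agerm_powR_coord i c e : 0 < c -> agerm (fun y => (c + y ord0 i) `^ e).
Proof.
move=> c0; have h : agerm (fun y => c + y ord0 i) by apply: agerm_add; [exact: agerm_cst|exact: agerm_coord].
have := agerm_exp (agerm_scale e (agerm_ln h _)); rewrite mxE addr0 => /(_ c0).
apply: (@agerm_ext (c / 2)); first by rewrite divr_gt0.
move=> y /(_ i)[+ _]; rewrite mxE ler_norml => /andP[h1 _].
have cy : 0 < c + y ord0 i by lra.
by rewrite -ln_powR lnK// posrE powR_gt0.
Qed.

Lemma series_Rep Y s : gen_power_series Y s -> convergent s -> exists r B, 0 < r /\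
  Rep Y [set l | s l != 0] (const_mx r) (gsum s) B.
Proof.
move=> [s0 _ snat] [rho rho0 sm].
have sa l : s l != 0 -> admissible Y l.
  by move=> sl i; split; [exact: s0|move=> Yi; exact: snat].
have [|r r0 rep] := @Rep_const Y [set l | s l != 0] rho (gsum s)
  (fine (asum (fun l => s l * gmonomial l rho))) rho0.
  exists s; split=> //; first by move=> l sl; split=> //; exact: sa.
  by rewrite fineK// ge0_fin_numE ?asum_ge0.
by exists r, (fine (asum (fun l => s l * gmonomial l rho))).
Qed.

Lemma series_norm Y s : gen_power_series Y s -> convergent s -> exists r B, 0 < r /\
  (asum (fun l => (s l * gmonomial l (const_mx r : 'rV[R]_n))%R) <= B%:E)%E.
Proof.
move=> [s0 _ snat] [rho rho0 sm].
have [r r0 rrho] := @small_all R 'I_n (fun i t => t <= rho ord0 i)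
  (fun i => ex_intro2 _ _ (rho ord0 i) (rho0 i) (fun t _ h => h)).
exists r, (fine (asum (fun l => s l * gmonomial l rho))); split=> //.
rewrite fineK ?ge0_fin_numE ?asum_ge0//; apply: le_asum => l; apply: (term_le (Y := Y)).
  by move=> sl i; split; [exact: s0|move=> Yi; exact: snat].
move=> i; rewrite mxE ger0_norm ?(ltW r0)//; split=> //; exact: rrho.
Qed.

Lemma expands_Rep Y U g a : expands_at Y U g a -> exists s r B,
  [/\ 0 < r, gen_power_series Y s, convergent s,
     Rep Y [set l | s l != 0] (const_mx r) (gsum s) B
   & forall x, rclose r x a -> U x -> g x = gsum s (x - a)].
Proof.
move=> [s [gs cs /near_rowP[r r0 gE]]].
have [r' [B [r'0 rep']]] := series_Rep gs cs.
have m0 : 0 < Num.min r r' by rewrite lt_min r0.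
exists s, (Num.min r r'), B; split=> //.
  by apply: Rep_shrink rep' => //; rewrite ge_min lexx orbT.
move=> x xa; apply: gE => i; apply: lt_le_trans (xa i) _.
by rewrite ge_min lexx.
Qed.

Lemma expands_agerm U g a : expands_at predT U g a -> exists f r,
  [/\ agerm f, 0 < r & forall x, rclose r x a -> U x -> g x = f (x - a)].
Proof.
move=> /expands_Rep[s [r [B [r0 _ _ rep gE]]]]; exists (gsum s), r; split=> //.
by exists r, B; split=> //; apply: Rep_le rep => // i; rewrite mxE// ltW.
Qed.

Lemma Rep_expands Y L r f B U g a (W : 'I_n -> set R) : 0 < r -> Rep Y L (const_mx r) f B ->
  (forall i, wo_set (W i)) -> (forall l i, admissible Y l -> L l -> W i (l ord0 i)) ->
  (forall x, rclose r x a -> U x -> (forall i, ~~ Y i -> a ord0 i <= x ord0 i) /\ g x = f (x - a)) ->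
  expands_at Y U g a.
Proof.
move=> r0 [s [sa h fE]] hW LW gE; exists s; split.
- split.
  + by move=> l /sa[al _] i; case: (al i).
  + exists W; split; first by move=> i; apply/wo_setP.
    by move=> l /sa[al Ll] i; exact: LW.
  + by move=> l /sa[al _] i Yi; have [_ hn] := al i; exact: hn.
- exists (const_mx r); first exact: pos_const.
  rewrite /summable; apply: le_lt_trans (ltry B); apply: le_trans h.
  by apply: le_esum => l _.
apply/near_rowP; exists r => // x xa Ux; have [xp ->] := gE x xa Ux.
rewrite fE// => i; rewrite !mxE; split; first exact/ltW/xa.
by move=> nY; rewrite subr_ge0 xp.
Qed.

Lemma wo_set_nat : wo_set [set x : R | x \is a Num.nat].
Proof.
apply: (@wo_set_sub _ _ [set x | exists v k, [set 0] v /\ x = v + k%:R]).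
  by move=> x /natrP[k ->]; exists 0, k; rewrite add0r.
by apply: wo_set_add_nat; [move=> v ->|exact: wo_set1].
Qed.

Lemma agerm_expands Y U f g a r : agerm f -> 0 < r ->
  (forall x, rclose r x a -> U x -> (forall i, ~~ Y i -> a ord0 i <= x ord0 i) /\ g x = f (x - a)) ->
  expands_at Y U g a.
Proof.
move=> [r' [B [r'0 /(Rep_anyY Y) h]]] r0 gE.
have m0 : 0 < Num.min r r' by rewrite lt_min r0.
apply: (Rep_expands (W := fun=> [set x | x \is a Num.nat]) m0 (Rep_shrink m0 _ h)).
- by rewrite ge_min lexx orbT.
- by move=> i; exact: wo_set_nat.
- by move=> l i _ [_ al]; have [_ hn] := al i; exact: hn.
- move=> x xa; apply: gE => i; apply: lt_le_trans (xa i) _.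
  by rewrite ge_min lexx.
Qed.

End Germs.

(** * Substitution into generalized power series *)

Section Comp.
Variables (R : realType) (n : nat).
Implicit Types (l m y z rho a b x : 'rV[R]_n) (Y : pred 'I_n) (t e B r : R).
Implicit Types (f g : 'rV[R]_n -> R) (L U : set 'rV[R]_n).

Definition natv : set 'rV[R]_n := admissible predT.

Lemma natvD l m : natv l -> natv m -> natv (l + m).
Proof. exact: admissibleD. Qed.

Lemma natv0 : natv 0. Proof. exact: admissible0. Qed.

(** Products of factors whose exponents lie in translates of the natural
    vectors: the translations add up. *)
Lemma Rep_prod_shift Y rho (T : Type) (s : seq T) (m : T -> 'rV[R]_n)
    (f : T -> 'rV[R]_n -> R) (B : T -> R) : pos_orthant rho ->
  (forall i, Rep Y [set m i + k | k in natv] rho (f i) (B i)) ->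
  Rep Y [set \sum_(i <- s) m i + k | k in natv] rho
    (fun y => \prod_(i <- s) f i y) (\prod_(i <- s) B i).
Proof.
move=> rho0 h; elim: s => [|i s IH].
  have := @Rep_cst R n Y [set \sum_(i <- [::]) m i + k | k in natv] rho 1 rho0.
  rewrite normr1 !big_nil; move=> H; apply: Rep_ext (H _) => //.
    by move=> y _; rewrite big_nil.
  by exists 0; [exact: natv0|rewrite addr0].
rewrite !big_cons; apply: (@Rep_ext _ _ _ _ _ (fun y => f i y * \prod_(j <- s) f j y)).
  by move=> y _; rewrite big_cons.
apply: Rep_mul (h i) IH => //= _ _ [k hk <-] [k' hk' <-].
by exists (k + k'); [exact: natvD|rewrite addrACA].
Qed.

Variables (YT YS : pred 'I_n) (s : 'rV[R]_n -> R).
Variables (w Lx : 'I_n -> 'rV[R]_n -> R) (sg : 'I_n -> 'I_n) (ga : 'I_n -> R).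
Hypothesis gs : gen_power_series YT s.
Hypothesis cs : convergent s.
Hypothesis hN : forall i, YT i -> agerm (w i) /\ w i 0 = 0.
Hypothesis hR : forall i, ~~ YT i -> [/\ 0 < ga i, agerm (Lx i) & ~~ YS (sg i)].
Hypothesis sg_inj : forall i j, ~~ YT i -> ~~ YT j -> sg i = sg j -> i = j.
Hypothesis wE : forall i y, ~~ YT i -> 0 <= y ord0 (sg i) ->
  w i y = y ord0 (sg i) `^ ga i * expR (Lx i y).

Let shiftm (l : 'rV[R]_n) (i : 'I_n) : 'rV[R]_n :=
  if YT i then 0 else (ga i * l ord0 i) *: unit_row R (sg i).

(** On a small enough polydisc the norm of each substituted component is below
    the radius of convergence [rT], hence the norm of each of its powers is
    below the power of [rT]. *)
Let factor_small rT : 0 < rT -> exists2 r, 0 < r & forall l, s l != 0 -> forall i,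
  Rep YS [set shiftm l i + k | k in natv] (const_mx r)
    (fun y => gpow (w i y) (l ord0 i)) (gpow rT (l ord0 i)).
Proof.
move=> rT0; have [s0 _ snat] := gs.
suff [r r0 hr] : exists2 r, 0 < r & forall t, 0 < t -> t <= r -> forall i l, s l != 0 ->
  Rep YS [set shiftm l i + k | k in natv] (const_mx t)
    (fun y => gpow (w i y) (l ord0 i)) (gpow rT (l ord0 i)).
  by exists r => // l sl i; exact: hr.
apply: small_all => i; case: (boolP (YT i)) => Yi.
  have [NGw w0] := hN Yi; have [r [B [r0 h]]] := agerm_vanish NGw w0.
  have [e e0 he] := small_mul B rT0.
  have m0 : 0 < Num.min e 1 by rewrite lt_min e0 ltr01.
  exists (Num.min e 1 * r); first by rewrite mulr_gt0.
  move=> t t0; rewrite -ler_pdivrMr// le_min => /andP[te t1] l sl.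
  have tr0 : 0 < t / r by rewrite divr_gt0.
  have rep := h (t / r); rewrite tr0 t1 divfK ?gt_eqF// in rep.
  have {}rep := Rep_anyY YS (rep isT).
  have ln := snat l sl i Yi; rewrite gpow_nat//.
  apply: (@Rep_ext _ _ _ _ _ (fun y => w i y ^+ Num.truncn (l ord0 i))).
    by move=> y _; rewrite gpow_nat.
  have tp : pos_orthant (const_mx t : 'rV[R]_n) by exact: pos_const.
  have := @Rep_pow _ _ _ _ _ _ _ (Num.truncn (l ord0 i)) tp _ _ rep.
  move=> /(_ (conj I natv0)) /(_ (fun l1 l2 h1 h2 => conj I (natvD h1.2 h2.2))).
  apply: Rep_le.
  - by move=> k [_ nk]; exists k => //; rewrite /shiftm Yi add0r.
  - by move=> j; rewrite mxE ltW.
  - by [].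
  - by rewrite lerXn2r ?nnegrE ?(ltW rT0) ?(Rep_ge0 rep)//; exact: he.
have [g0 [r [B [r0 h]]] nYS] := hR Yi.
have [e e0 he] := @small_pow R (ga i) 1 (expR B) rT g0 ltr01 (expR_gt0 B) rT0.
exists (Num.min e r); first by rewrite lt_min e0.
move=> t t0; rewrite le_min => /andP[te tr] l sl.
have tp : pos_orthant (const_mx t : 'rV[R]_n) by exact: pos_const.
have l0 : 0 <= l ord0 i by exact: s0.
have rep : Rep YS natv (const_mx t) (fun y => expR (l ord0 i * Lx i y)) (expR (l ord0 i * B)).
  apply: Rep_exp => //; [exact: natv0|exact: natvD|].
  rewrite -[X in X * B](ger0_norm l0); apply: Rep_scale => //.
  apply: Rep_le (Rep_anyY YS (Rep_shrink t0 tr h)).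
  - by move=> k [].
  - by move=> j; rewrite mxE ltW.
  - by [].
  - by [].
have am : admissible YS (shiftm l i).
  move=> j; rewrite /shiftm (negbTE Yi) mxE unit_rowE; case: eqVneq => [->|_].
    by rewrite mulr1 mulr_ge0 ?(ltW g0)//; split=> // h'; move: nYS; rewrite h'.
  by rewrite mulr0; split.
have := @Rep_shift _ _ _ _ [set shiftm l i + k | k in natv] _ _ _ _ 1 tp am _ rep.
move=> /(_ (fun k hk => imageP _ hk)) rep'.
have gm y : 0 <= y ord0 (sg i) -> gmonomial (shiftm l i) y = y ord0 (sg i) `^ (ga i * l ord0 i).
  move=> y0; rewrite /shiftm (negbTE Yi) gmonomial_scale_unit_row gpow_powR//.
  by rewrite mulr_ge0// ltW.
have expm c : expR (l ord0 i * c) = expR c `^ (l ord0 i).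
  by rewrite /powR gt_eqF ?expR_gt0// expRK.
apply: (@Rep_ext _ _ _ _ _ (fun y => 1 * gmonomial (shiftm l i) y * expR (l ord0 i * Lx i y))).
  move=> y yb; have y0 : 0 <= y ord0 (sg i) by case: (yb (sg i)) => _; exact.
  have w0 : 0 <= w i y by rewrite wE// mulr_ge0 ?powR_ge0// ltW ?expR_gt0.
  rewrite mul1r gm// gpow_powR// wE// powRM ?powR_ge0 ?(ltW (expR_gt0 _))//.
  by rewrite -powRrM expm.
apply: Rep_le rep' => //; try by move=> j; rewrite mxE ltW.
rewrite normr1 mul1r gm ?mxE ?(ltW t0)// expm powRrM -powRM ?powR_ge0 ?(ltW (expR_gt0 _))//.
rewrite gpow_powR ?(ltW rT0)//; apply: powR_le => //.
  by rewrite mulr_ge0 ?powR_ge0// ltW ?expR_gt0.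
by have := he t t0 te; rewrite mulr1.
Qed.

Let W (j : 'I_n) (hW : 'I_n -> set R) : set R :=
  [set x | x = 0 \/ exists i v, [/\ ~~ YT i, sg i = j, hW i v, 0 <= v & x = ga i * v]].

Let W_wos hW j : (forall i, wo_set (hW i)) -> wo_set (W j hW).
Proof.
move=> hWwo; have [[i0 [Yi0 sj]]|nex] := pselect (exists i, ~~ YT i /\ sg i = j).
  apply: (@wo_set_sub _ _ ([set 0] `|` ((fun v => ga i0 * v) @` hW i0))).
    move=> x [->|[i [v [Yi si hv v0 ->]]]]; first by left.
    move: hv; have -> : i = i0 by apply: sg_inj => //; rewrite si.
    by move=> hv; right; exists v.
  apply: wo_setU; first exact: wo_set1.
  apply: wo_set_image => // u v _ _ uv; rewrite ler_wpM2l//.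
  by have [/ltW] := hR Yi0.
apply: (@wo_set_sub _ _ [set 0]); last exact: wo_set1.
by move=> x [->//|[i [v [Yi si _ _ _]]]]; exfalso; apply: nex; exists i.
Qed.

Let W_shift hW (l : 'rV[R]_n) j : (forall i, hW i (l ord0 i)) -> (forall i, 0 <= l ord0 i) ->
  W j hW ((\sum_i shiftm l i) ord0 j).
Proof.
move=> hWl l0; rewrite summxE.
have sE i : shiftm l i ord0 j = if YT i then 0 else ga i * l ord0 i * (j == sg i)%:R.
  by rewrite /shiftm; case: (YT i); rewrite mxE ?unit_rowE.
have [[i0 [Yi0 sj]]|nex] := pselect (exists i, ~~ YT i /\ sg i = j).
  right; exists i0, (l ord0 i0); split=> //.
  rewrite (bigD1 i0)//= big1 ?addr0; first by rewrite sE (negbTE Yi0) sj eqxx mulr1.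
  move=> i ii0; rewrite sE; case: (boolP (YT i)) => // Yi.
  case: eqP => [jE|_]; last by rewrite mulr0.
  by case/eqP: ii0; apply: sg_inj => //; rewrite -jE sj.
left; apply: big1 => i _; rewrite sE; case: (boolP (YT i)) => // Yi.
case: eqP => [jE|_]; last by rewrite mulr0.
by exfalso; apply: nex; exists i.
Qed.

(** Substitution. The series [s] is evaluated on components of two kinds:
    germs of analytic functions vanishing at the centre for the variables with
    natural exponents, and x^ga exp(L), a real power of one coordinate times a
    unit, for the others. Real powers of the second kind stay of the same
    form, (x^ga exp(L))^v = x^(ga v) exp(v L), so every term is a monomial
    times an analytic function. Since distinct components use distinct
    coordinates, the exponents of a coordinate form a set [{ga v + k}], which
    is well ordered. *)
Lemma comp_series : exists L r B (Ws : 'I_n -> set R),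
  [/\ 0 < r, forall i, wo_set (Ws i), forall l i, admissible YS l -> L l -> Ws i (l ord0 i)
    & Rep YS L (const_mx r) (fun y => gsum s (\row_i w i y)) B].
Proof.
have [s0 [hW [hWwo sW]] snat] := gs; have [rT [B [rT0 hBT]]] := series_norm gs cs.
have [r r0 fac] := factor_small rT0.
have rp : pos_orthant (const_mx r : 'rV[R]_n) by exact: pos_const.
pose W' := fun j => W j hW.
pose Ws := fun j => [set x | exists v k, W' j v /\ x = v + k%:R].
pose L := [set l : 'rV[R]_n | forall j, Ws j (l ord0 j)].
exists L, r, B, Ws; split=> //.
  move=> j; apply: wo_set_add_nat; last by apply: W_wos => i; apply/wo_setP.
  move=> v [->//|[i [u [Yi _ _ u0 ->]]]]; rewrite mulr_ge0//.
  by have [/ltW] := hR Yi.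
apply: (@Rep_ext _ _ _ _ _ (fun y => rsum (fun l => s l * \prod_(i < n) gpow (w i y) (l ord0 i)))).
  move=> y _; rewrite /gsum -/(rsum _); apply: eq_rsum => l; congr (_ * _).
  by apply: eq_bigr => i _; rewrite mxE.
apply: (@Rep_sum _ _ _ _ _ _ _ (fun l => `|s l * gmonomial l (const_mx rT : 'rV[R]_n)|)) => //; last first.
  by apply: le_trans hBT; apply: le_asum => l; rewrite normr_id.
move=> l; have [sl0|sl] := eqVneq (s l) 0.
  apply: (@Rep_ext _ _ _ _ _ (fun=> 0)); first by move=> y _; rewrite sl0 mul0r.
  have L0 : L 0 by move=> j; exists 0, 0%N; rewrite mxE addr0; split=> //; left.
  by have := @Rep_cst R n YS L _ 0 rp L0; rewrite sl0 mul0r.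
rewrite normrM [X in _ * X]ger0_norm; last first.
  by apply: ltW; apply: gmonomial_gt0; exact: pos_const.
apply: Rep_scale => //; have := Rep_prod_shift (index_enum 'I_n) rp (fac l sl).
have -> : \prod_(i < n) gpow rT (l ord0 i) = gmonomial l (const_mx rT : 'rV[R]_n).
  by apply: eq_bigr => i _; rewrite mxE.
apply: Rep_le => //; last by move=> j; rewrite mxE ltW.
move=> _ [k nk <-] j; rewrite mxE.
have [_ /(_ isT) /natrP[d ->]] := nk j.
exists ((\sum_i shiftm l i) ord0 j), d; split=> //.
by apply: W_shift => i; [exact: sW|exact: s0].
Qed.

End Comp.

Section ExpandsComp.
Variables (R : realType) (n : nat).
Implicit Types (a b x y : 'rV[R]_n) (U : set 'rV[R]_n) (r : R).

(** The hypotheses only concern points of [U] close to [a]: there the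
    components of [th] must agree with the germs that are substituted. *)
Lemma expands_comp (YT YS : pred 'I_n) (U U' : set 'rV[R]_n) (g : 'rV[R]_n -> R)
    (th : 'rV[R]_n -> 'rV[R]_n) a b (w Lx : 'I_n -> 'rV[R]_n -> R)
    (sg : 'I_n -> 'I_n) (ga : 'I_n -> R) r0 :
  expands_at YT U' g b ->
  (forall i, YT i -> agerm (w i) /\ w i 0 = 0) ->
  (forall i, ~~ YT i -> [/\ 0 < ga i, agerm (Lx i) & ~~ YS (sg i)]) ->
  (forall i j, ~~ YT i -> ~~ YT j -> sg i = sg j -> i = j) ->
  (forall i y, ~~ YT i -> 0 <= y ord0 (sg i) ->
     w i y = y ord0 (sg i) `^ ga i * expR (Lx i y)) ->
  0 < r0 ->
  (forall x, rclose r0 x a -> U x -> [/\ U' (th x), forall i, ~~ YS i -> a ord0 i <= x ord0 i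
     & forall i, th x ord0 i = b ord0 i + w i (x - a)]) ->
  (forall e, 0 < e -> exists2 d, 0 < d & forall x, rclose d x a -> U x -> rclose e (th x) b) ->
  expands_at YS U (g \o th) a.
Proof.
move=> [s [gs cs /near_rowP[r1 r10 gE]]] hN hR sg_inj wE r00 thE thc.
have [L [r [B [Ws [rp Wswo LWs rep]]]]] := comp_series gs cs hN hR sg_inj wE.
have [d d0 hd] := thc r1 r10.
pose m := Num.min r (Num.min r0 d).
have m0 : 0 < m by rewrite !lt_min rp r00 d0.
apply: (Rep_expands m0 (Rep_shrink m0 _ rep) Wswo LWs); first by rewrite /m ge_min lexx.
move=> x xa Ux.
have x0 : rclose r0 x a by move=> i; apply: lt_le_trans (xa i) _; rewrite /m !ge_min lexx orbT.
have xd : rclose d x a by move=> i; apply: lt_le_trans (xa i) _; rewrite /m !ge_min lexx !orbT.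
have [U'x ax xE] := thE x x0 Ux; split=> //=.
rewrite gE//; last exact: hd.
congr (gsum s _); apply/rowP => i; rewrite !mxE xE addrC addKr//.
Qed.

End ExpandsComp.

(** * Vanishing coordinates and homeomorphisms of orthants *)

Section Orthant.
Variables (R : realType) (n : nat).
Implicit Types (a b x y : 'rV[R]_n) (U V W : set 'rV[R]_n) (r t e : R).
Implicit Types (J : {set 'I_n}) (th ps : 'rV[R]_n -> 'rV[R]_n).

Definition zeros x : {set 'I_n} := [set i | x ord0 i == 0].

(** Moves the coordinates of [J] by [t]; for small [t] and [J] inside the zero
    set this is a ray that enters a larger stratum. *)
Definition bump b J t : 'rV[R]_n := \row_i (b ord0 i + t * (i \in J)%:R).

Lemma rclose_refl r x : 0 < r -> rclose r x x.
Proof. by move=> r0 i; rewrite subrr normr0. Qed.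

Lemma rclose_trans r r' x y z : rclose r x y -> rclose r' y z -> rclose (r + r') x z.
Proof.
move=> h h' i; have -> : x ord0 i - z ord0 i = (x ord0 i - y ord0 i) + (y ord0 i - z ord0 i) by ring.
by apply: le_lt_trans (ler_normD _ _) _; apply: ltrD.
Qed.

Lemma rclose_le r r' x y : r <= r' -> rclose r x y -> rclose r' x y.
Proof. by move=> rr h i; apply: lt_le_trans (h i) rr. Qed.

Lemma openP W : open W <-> forall x, W x -> exists2 r, 0 < r & forall y, rclose r y x -> W y.
Proof.
rewrite openE; split=> h x Wx; first by apply/near_rowP; exact: h.
by apply/near_rowP; exact: h.
Qed.

Lemma open_in_orthantP U : open_in_orthant U <->
  (U `<=` @orthant R n /\
   forall a, U a -> exists2 r, 0 < r & forall x, rclose r x a -> orthant x -> U x).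
Proof.
split=> [[W /openP oW ->]|[Uo hU]].
  split=> [x []//|a [Wa oa]]; have [r r0 hr] := oW a Wa.
  by exists r => // x xa ox; split=> //; exact: hr.
exists [set x | exists2 r, 0 < r & forall y, rclose r y x -> orthant y -> U y].
  apply/openP => x [r r0 hr]; have r2 : 0 < r / 2 by rewrite divr_gt0.
  exists (r / 2) => // y yx; exists (r / 2) => // z zy; apply: hr.
  by rewrite [r]splitr; exact: rclose_trans zy yx.
apply/seteqP; split=> [x Ux|x [[r r0 hr] ox]]; first by split; [exact: hU|exact: Uo].
by apply: hr => //; exact: rclose_refl.
Qed.

Lemma open_in_orthant_sub U a : open_in_orthant U -> U a -> orthant a.
Proof. by move=> /open_in_orthantP[h _]; exact: h. Qed.

Lemma zeros_near a : exists2 r, 0 < r & forall x, rclose r x a -> zeros x \subset zeros a.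
Proof.
have [i|r r0 hr] := @small_all R 'I_n (fun i t => a ord0 i != 0 -> t <= `|a ord0 i|).
  have [a0|a0] := eqVneq (a ord0 i) 0; first by exists 1.
  by exists `|a ord0 i|; rewrite ?normr_gt0.
exists r => // x xa; apply/fintype.subsetP => i; rewrite !inE => /eqP xi.
apply: contraT => ai; have := hr r r0 (lexx _) i ai.
by have := xa i; rewrite xi sub0r normrN => h1 h2; move: (lt_le_trans h1 h2); rewrite ltxx.
Qed.

Lemma bump_orthant b J t : orthant b -> 0 <= t -> orthant (bump b J t).
Proof. by move=> ob t0 i; rewrite mxE addr_ge0// mulr_ge0. Qed.

Lemma bump_rclose b J t r : 0 <= t -> t < r -> rclose r (bump b J t) b.
Proof.
move=> t0 tr i; rewrite mxE addrC addKr ger0_norm ?mulr_ge0//.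
by case: (i \in J); rewrite ?mulr1// mulr0 (le_lt_trans t0).
Qed.

Lemma zeros_bump b J t : orthant b -> 0 < t -> zeros (bump b J t) = zeros b :\: J.
Proof.
move=> ob t0; apply/setP => i; rewrite !inE mxE.
case: (i \in J) => /=; last by rewrite mulr0 addr0.
by rewrite mulr1 gt_eqF// ltr_wpDl//; exact: ob.
Qed.

Definition rcont U th := forall a, U a -> forall e, 0 < e ->
  exists2 d, 0 < d & forall x, rclose d x a -> U x -> rclose e (th x) (th a).

Definition homeo U V th ps :=
  [/\ forall x, U x -> V (th x), forall y, V y -> U (ps y),
      forall x, U x -> ps (th x) = x, forall y, V y -> th (ps y) = y
    & rcont U th /\ rcont V ps].

Lemma homeo_sym U V th ps : homeo U V th ps -> homeo V U ps th.
Proof. by move=> [h1 h2 h3 h4 [h5 h6]]; split. Qed.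

(** The hypothesis under which zeros can be counted: a ray that leaves the
    stratum of [th a] is not the image of points of the stratum of [a]. Both
    the standard and the generalized analytic case reduce to it. *)
Definition leaves U V th ps := forall a, U a -> forall J, J != finset.set0 ->
  J \subset zeros (th a) ->
  ~ exists2 t0, 0 < t0 & forall t, 0 < t -> t <= t0 ->
      V (bump (th a) J t) /\ zeros (ps (bump (th a) J t)) = zeros a.

(** Strong induction on the number [k] of zeros, for [th] and [ps] at the same
    time. If [th a] had more than [k] zeros, a ray from it into a stratum with
    exactly [k] zeros would pull back to points near [a] with at least [k]
    zeros by induction and at most [k] by proximity, hence in the stratum of
    [a], against [leaves]. *)
Lemma card_zeros_step k U V th ps : open_in_orthant U -> open_in_orthant V ->
  homeo U V th ps -> leaves U V th ps ->
  (forall j, (j < k)%N -> forall x, U x -> #|zeros x| = j -> #|zeros (th x)| = j) ->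
  (forall j, (j < k)%N -> forall y, V y -> #|zeros y| = j -> #|zeros (ps y)| = j) ->
  forall a, U a -> #|zeros a| = k -> #|zeros (th a)| = k.
Proof.
move=> oU oV [hUV hVU psK thK [thc psc]] lv IHt IHp a Ua ak.
have Va := hUV a Ua; have ob := open_in_orthant_sub oV Va.
have kle : (k <= #|zeros (th a)|)%N.
  rewrite leqNgt; apply/negP => lt.
  have := IHp _ lt (th a) Va erefl; rewrite psK// ak => h.
  by rewrite h ltnn in lt.
apply/eqP; rewrite eqn_leq kle andbT leqNgt; apply/negP => lt.
have [J [Jsub Jk]] : exists J : {set 'I_n}, J \subset zeros (th a) /\ #|zeros (th a) :\: J| = k.
  pose K := [set i in take k (enum (zeros (th a)))]%SET.
  have KZ : K \subset zeros (th a).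
    by apply/fintype.subsetP => i; rewrite inE => /mem_take; rewrite mem_enum.
  exists (zeros (th a) :\: K)%SET; split; first exact: finset.subsetDl.
  rewrite finset.setDDr finset.setDv finset.set0U (finset.setIidPr KZ) cardsE.
  have /card_uniqP -> : uniq (take k (enum (zeros (th a)))) by rewrite take_uniq// enum_uniq.
  by rewrite size_takel// -cardE ltnW.
have J0 : J != finset.set0.
  by apply: contraTneq lt => JE; rewrite -Jk JE finset.setD0 ltnn.
apply: (lv a Ua J J0 Jsub).
have [r1 r10 hr1] := zeros_near a.
have /open_in_orthantP[_ /(_ _ Va)[r2 r20 hr2]] := oV.
have [d d0 hd] := psc (th a) Va r1 r10.
have m0 : 0 < Num.min r2 d by rewrite lt_min r20.
exists (Num.min r2 d / 2); first by rewrite divr_gt0.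
move=> t t0 tle; have tm : t < Num.min r2 d.
  by apply: le_lt_trans tle _; exact: half_lt.
move: tm; rewrite lt_min => /andP[tr2 td].
have Vb : V (bump (th a) J t).
  by apply: hr2; [apply: bump_rclose => //; exact: ltW|apply: bump_orthant => //; exact: ltW].
split=> //; apply/eqP; rewrite eqEcard.
have /hr1 -> : rclose r1 (ps (bump (th a) J t)) a.
  by rewrite -{2}(psK a Ua); apply: hd => //; apply: bump_rclose => //; exact: ltW.
rewrite ak leqNgt /=; apply/negP => lt'.
have := IHt _ lt' _ (hVU _ Vb) erefl; rewrite thK// zeros_bump// Jk => h.
by rewrite -h ltnn in lt'.
Qed.

Lemma card_zeros_homeo U V th ps : open_in_orthant U -> open_in_orthant V ->
  homeo U V th ps -> leaves U V th ps -> leaves V U ps th ->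
  forall a, U a -> #|zeros (th a)| = #|zeros a|.
Proof.
move=> oU oV hm lv lv'.
suff H k : (forall j, (j < k)%N -> forall x, U x -> #|zeros x| = j -> #|zeros (th x)| = j) /\
     (forall j, (j < k)%N -> forall y, V y -> #|zeros y| = j -> #|zeros (ps y)| = j).
  by move=> a Ua; have [h _] := H #|zeros a|.+1; exact: (h _ (ltnSn _)).
elim: k => [|k [IH1 IH2]]; first by split.
split=> j; rewrite ltnS leq_eqVlt => /orP[/eqP ->|]; [|exact: IH1| |exact: IH2].
  exact: (card_zeros_step oU oV hm lv IH1 IH2).
exact: (card_zeros_step oV oU (homeo_sym hm) lv' IH2 IH1).
Qed.

End Orthant.

(** * Rays leaving a stratum *)

Section Leaves.
Variables (R : realType) (n : nat).
Implicit Types (a b x y : 'rV[R]_n) (U V W : set 'rV[R]_n) (r t e : R).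
Implicit Types (J : {set 'I_n}) (th ps : 'rV[R]_n -> 'rV[R]_n) (g : 'rV[R]_n -> R).

Definition std_map U th := forall i, std_analytic U (fun x => th x ord0 i).

(** All positive powers of the components are required: this is what
    distinguishes coordinates that vanish on the boundary from functions such
    as z_1 + z_2, whose square root is not generalized analytic. *)
Definition gen_pow_map U th := forall i c, 0 < c ->
  gen_analytic U (fun x => th x ord0 i `^ c).

Lemma std_agerm U g a : std_analytic U g -> U a -> exists f r,
  [/\ agerm f, 0 < r & forall x, rclose r x a -> U x -> g x = f (x - a)].
Proof.
move=> [_ h] Ua; have [W [u [oW Wa ra gu]]] := h a Ua.
have [f [r [NGf r0 fE]]] := expands_agerm (ra a Wa).
have /openP/(_ a Wa)[r' r'0 hr'] := oW.
exists f, (Num.min r r'); split=> //; first by rewrite lt_min r0.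
move=> x xa Ux; have xW : W x by apply: hr'; apply: rclose_le xa; rewrite ge_min lexx orbT.
by rewrite gu// fE//; apply: rclose_le xa; rewrite ge_min lexx.
Qed.

Lemma small_const c : 0 < c -> exists2 e, 0 < e & forall t, 0 < t -> t <= e -> t <= c.
Proof. by exists c. Qed.

(** The constant is written [e^-1] with the same small [e] that bounds [t], so
    that one parameter controls a statement stable under shrinking. *)
Lemma lip_along V g b J : std_analytic V g -> V b ->
  exists2 e0, 0 < e0 & forall e, 0 < e -> e <= e0 -> forall t, 0 < t -> t <= e ->
    V (bump b J t) -> `|g (bump b J t) - g b| <= e^-1 * t.
Proof.
move=> sg Vb; have [f [r [NGf r0 gE]]] := std_agerm sg Vb.
have [r' [B [r'0 B0 lip]]] := agerm_lip NGf.
have [e1 e10 he1] := @small_mul R (B / r') 1 ltr01.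
have r2 : 0 < r / 2 by rewrite divr_gt0.
exists (Num.min e1 (Num.min r' (r / 2))); first by rewrite !lt_min e10 r'0.
move=> e e0; rewrite !le_min => /and3P[ee1 er' er] t t0 te Vbt.
have tr : t < r by exact: le_lt_trans (le_trans te er) (half_lt r0).
rewrite !gE//; [|exact: rclose_refl|by apply: bump_rclose => //; exact: ltW].
rewrite subrr; apply: (@le_trans _ _ (t / r' * B)).
  apply: lip; first by rewrite divr_ge0 ?(ltW t0) ?(ltW r'0)//= ler_pdivrMr// mul1r (le_trans te).
  move=> i; rewrite divfK ?gt_eqF// !mxE addrC addKr ger0_norm ?mulr_ge0 ?(ltW t0)//.
  by case: (i \in J); rewrite ?mulr1// mulr0 ltW.
have -> : t / r' * B = B / r' * t by ring.
rewrite ler_wpM2r ?(ltW t0)// -[e^-1]mul1r ler_pdivlMr// mulrC.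
exact: he1.
Qed.

(** Let [i] be in [J] and let [x] be the point over the ray at time [t]. The
    preimage moves at most linearly in [t]. The [i]-th component of [th] is
    nonnegative and vanishes at [a], and the reflection of [x] through [a]
    stays in the orthant as [x] lies in the stratum of [a]; the component is
    thus bounded by its even part, which is quadratic. This gives t <= C t^2. *)
Lemma std_leaves U V th ps : open_in_orthant U -> open_in_orthant V ->
  homeo U V th ps -> std_map U th -> std_map V ps -> leaves U V th ps.
Proof.
move=> oU oV [hUV hVU psK thK [thc psc]] sth sps a Ua J J0 JZ [t0 t00 ht].
have Vb := hUV a Ua; have oa := open_in_orthant_sub oU Ua.
have [i iJ] : exists i, i \in J by apply/finset.set0Pn.
have bi : th a ord0 i = 0 by apply/eqP; have /(fintype.subsetP JZ) := iJ; rewrite inE.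
have [e e0 he] := small_all (fun j => lip_along J (sps j) Vb).
have {he}hlip := he e e0 (lexx _).
have [f [r1 [[r [B [r0 rep]]] r10 fE]]] := std_agerm (sth i) Ua.
have B0 := Rep_ge0 rep.
have /open_in_orthantP[_ /(_ _ Ua)[r2 r20 hr2]] := oU.
have [j|am am0 ham] := @small_all R 'I_n (fun j t => a ord0 j != 0 -> t <= a ord0 j).
  have [a0|a0] := eqVneq (a ord0 j) 0; first by exists 1.
  by exists (a ord0 j) => //; rewrite lt_neqAle eq_sym a0; exact: oa.
have ei0 : 0 < e^-1 by rewrite invr_gt0.
have half (u : R) : 0 < u -> 0 < u / 2 by move=> u0; rewrite divr_gt0.
have [|d d0 hd] := small_and (small_const t00) (small_and (small_const e0)
   (small_and (@small_mul R (e^-1 / r) 1 ltr01) (small_and (@small_mul R e^-1 _ (half _ r10))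
   (small_and (@small_mul R e^-1 _ (half _ r20)) (small_and (@small_mul R e^-1 _ am0)
   (@small_mul R (2 * (e^-1 / r) ^+ 2 * B) (2^-1) _)))))); first by rewrite invr_gt0.
have [tt0 [te [ter [tr1 [tr2 [tam tC]]]]]] := hd d d0 (lexx d).
move: d d0 tt0 te ter tr1 tr2 tam tC {hd} => t tp tt0 te ter tr1 tr2 tam tC.
have [Vt Zt] := ht t tp tt0.
set x := ps (bump (th a) J t) in Zt.
have Ux : U x by exact: hVU.
have xa j : `|x ord0 j - a ord0 j| <= e^-1 * t.
  by have := hlip j t tp te Vt; rewrite psK.
have hlt (u : R) : 0 < u -> t * e^-1 <= u / 2 -> e^-1 * t < u.
  move=> u0; rewrite mulrC => h; apply: le_lt_trans h _.
  exact: half_lt.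
pose y := x - a.
have fy : f y = t.
  rewrite -fE//; last by move=> j; apply: le_lt_trans (xa j) _; exact: hlt.
  by rewrite thK// mxE bi add0r iJ mulr1.
have f0 : f 0 = 0.
  by rewrite -(subrr a) -fE//; exact: rclose_refl.
have Uay : U (a - y).
  apply: hr2 => j.
    have -> : (a - y) ord0 j - a ord0 j = - (x ord0 j - a ord0 j) by rewrite !mxE; ring.
    by rewrite normrN; apply: le_lt_trans (xa j) _; exact: hlt.
  have -> : (a - y) ord0 j = a ord0 j - (x ord0 j - a ord0 j) by rewrite !mxE.
  have [aj|aj] := eqVneq (a ord0 j) 0.
    have : j \in zeros x by rewrite Zt inE aj.
    by rewrite inE aj => /eqP ->; rewrite !subr0.
  have := ham am am0 (lexx _) j aj; have := xa j; rewrite mulrC => h1 h2.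
  by have := le_trans h1 (le_trans tam h2); rewrite ler_norml => /andP[_ h]; lra.
have fny : 0 <= f (- y).
  have -> : - y = (a - y) - a by rewrite addrAC subrr add0r.
  rewrite -fE//.
    by have /(open_in_orthant_sub oV) := hUV _ Uay; apply.
  move=> j; have -> : (a - y) ord0 j - a ord0 j = - (x ord0 j - a ord0 j) by rewrite !mxE; ring.
  by rewrite normrN; apply: le_lt_trans (xa j) _; exact: hlt.
have epos : 0 < t * (e^-1 / r) by rewrite mulr_gt0// divr_gt0.
have := @Rep_quad R n (const_mx r) f B (t * (e^-1 / r)) y (pos_const r0) rep.
rewrite epos ter => /(_ isT) H.
have : f y + f (- y) <= 2 * (t * (e^-1 / r)) ^+ 2 * B.
  have := H _; rewrite f0 mulr0 subr0 => H'.
  apply: le_trans (ler_norm _) (H' _) => j.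
  by rewrite !mxE mulrA divfK ?gt_eqF// [t * _]mulrC; exact: xa.
rewrite fy => H2; have : t <= t * (t * (2 * (e^-1 / r) ^+ 2 * B)).
  apply: le_trans (_ : t + f (- y) <= _); first by rewrite lerDl.
  apply: le_trans H2 _; rewrite le_eqVlt; apply/orP; left; apply/eqP; ring.
(* Here t <= t * (t * C) while t was chosen with t * C <= 1 / 2. *)
move=> H3; have := le_trans H3 (ler_wpM2l (ltW tp) tC).
by move: tp; lra.
Qed.

Lemma holder_along V g b J : open_in_orthant V -> gen_analytic V g -> V b ->
  J \subset zeros b ->
  exists2 e0, 0 < e0 & forall e, 0 < e -> e <= e0 -> forall t, 0 < t -> t <= e ->
    V (bump b J t) -> `|g (bump b J t) - g b| <= e^-1 * t `^ e.
Proof.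
move=> oV [_ _ hg] Vb JZ; have ob := open_in_orthant_sub oV Vb.
have [s [r [B [r0 [s0 [W [Wwo sW]] snat] cs rep gE]]]] := expands_Rep (hg b Vb).
have [i|eta eta0 heta] := @small_all R 'I_n (fun i t => t <= 1 /\ forall w, W i w -> 0 < w -> t <= w).
  have /wo_setP/wo_set_gap[z [z0 z1 hz]] := Wwo i; exists z => // t t0 tz; split; first exact: le_trans tz z1.
  by move=> w Ww w0; apply: le_trans tz (hz w Ww w0).
have B0 := Rep_ge0 rep.
have [e1 e10 he1] := @small_mul R (r `^ (- eta) * B) 1 ltr01.
have r2 : 0 < r / 2 by rewrite divr_gt0.
exists (Num.min e1 (Num.min (Num.min eta 1) (r / 2))); first by rewrite !lt_min e10 eta0 ltr01.
move=> e e0; rewrite !le_min => /and3P[ee1 /andP[eeta e1'] er] t t0 te Vbt.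
have tr : t < r by exact: le_lt_trans (le_trans te er) (half_lt r0).
rewrite !gE//; [|exact: rclose_refl|by apply: bump_rclose => //; exact: ltW].
rewrite subrr.
have yE i : (bump b J t - b) ord0 i = t * (i \in J)%:R by rewrite !mxE addrC addKr.
apply: (@le_trans _ _ ((t / r) `^ eta * B)).
  apply: (Rep_holder (J := [pred i | i \in J]) (pos_const r0) rep) => //.
  - by rewrite divr_ge0 ?(ltW t0) ?(ltW r0)//= ler_pdivrMr// mul1r ltW.
  - move=> l al sl i _ li; have [_ h] := heta _ eta0 (lexx _) i.
    by apply: h; [exact: sW|rewrite lt_neqAle eq_sym li; case: (al i)].
  - move=> i; rewrite yE mxE ger0_norm ?mulr_ge0 ?(ltW t0)//.
    split; first by case: (i \in J); rewrite ?mulr1 ?mulr0 ltW.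
    by [].
  - by move=> i /= iJ; rewrite yE iJ mulr1 mxE divfK ?gt_eqF// ger0_norm// ltW.
  - by move=> i /= /negbTE iJ; rewrite yE iJ mulr0.
rewrite powRM ?invr_ge0 ?(ltW t0) ?(ltW r0)// -powR_inv1 ?(ltW r0)// -powRrM mulN1r.
rewrite -mulrA mulrC; apply: ler_pM; rewrite ?mulr_ge0 ?powR_ge0//.
  by rewrite -[e^-1]mul1r ler_pdivlMr// mulrC; exact: he1.
by apply: ger_powR => //; rewrite t0 (le_trans te).
Qed.

(** As in the standard case, with flatness in place of evenness: a small power
    of the [i]-th component is still Lipschitz along the stratum, where the
    exponents are natural, while the preimage of the ray moves like a power of
    [t]. Taking half of that Hölder exponent as the power gives [t `^ (e / 2)
    <= C * t `^ e]. *)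
Lemma gen_leaves U V th ps : open_in_orthant U -> open_in_orthant V ->
  homeo U V th ps -> gen_pow_map U th -> gen_pow_map V ps -> leaves U V th ps.
Proof.
move=> oU oV [hUV hVU psK thK [thc psc]] sth sps a Ua J J0 JZ [t0 t00 ht].
have Vb := hUV a Ua; have oa := open_in_orthant_sub oU Ua.
have [i iJ] : exists i, i \in J by apply/finset.set0Pn.
have bi : th a ord0 i = 0 by apply/eqP; have /(fintype.subsetP JZ) := iJ; rewrite inE.
have [e e0 he] := small_all (fun j => holder_along oV (sps j 1 ltr01) Vb JZ).
have {he}hlip := he e e0 (lexx _).
have e20 : 0 < e / 2 by rewrite divr_gt0.
have [_ _ /(_ a Ua)/expands_Rep[s [r1 [B [r10 gs cs rep fE]]]]] := sth i (e / 2) e20.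
have B0 := Rep_ge0 rep.
have ei0 : 0 < e^-1 by rewrite invr_gt0.
have half (u : R) : 0 < u -> 0 < u / 2 by move=> u0; rewrite divr_gt0.
have ei1 : 0 < e^-1 / r1 by rewrite divr_gt0.
have C0 : 0 < e^-1 / r1 * B + 1 by rewrite ltr_wpDl// mulr_ge0 ?(ltW ei1).
have [|d d0 hd] := small_and (small_const t00) (small_and (small_const e0)
   (small_and (small_pow e0 ltr01 ei1 ltr01) (small_and (small_pow e0 ltr01 ei0 (half _ r10))
   (@small_pow R (e / 2) 1 (e^-1 / r1 * B + 1) (2^-1) e20 ltr01 C0 _)))).
  by rewrite invr_gt0.
have [tt0 [te [ter [tr1 tC]]]] := hd d d0 (lexx d).
move: d d0 tt0 te ter tr1 tC {hd} => t tp tt0 te; rewrite mulr1 => ter tr1 tC.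
have [Vt Zt] := ht t tp tt0.
set x := ps (bump (th a) J t) in Zt.
have Ux : U x by exact: hVU.
have ox := open_in_orthant_sub oU Ux.
have xa j : `|x ord0 j - a ord0 j| <= e^-1 * t `^ e.
  have := hlip j t tp te Vt; rewrite psK// -/x powRr1 ?powRr1//.
have xr1 : rclose r1 x a.
  move=> j; apply: le_lt_trans (xa j) _; rewrite mulrC; apply: le_lt_trans tr1 _.
  exact: half_lt.
have fx : gsum s (x - a) = t `^ (e / 2).
  by rewrite -fE// thK// mxE bi add0r iJ mulr1.
have f0 : gsum s 0 = 0.
  rewrite -(subrr a) -fE//; last exact: rclose_refl.
  by rewrite bi powR0// gt_eqF.
pose e' := t `^ e * (e^-1 / r1).
have e'1 : 0 <= e' <= 1 by rewrite ter mulr_ge0 ?powR_ge0 ?(ltW ei1).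
have := @Rep_holder R n [pred i | a ord0 i != 0] _ _ _ _ [pred i | a ord0 i != 0] 1 e' (x - a)
   (pos_const r10) rep ltr01 e'1.
have xae j : `|(x - a) ord0 j| <= e' * r1.
  by rewrite /e' mulrA divfK ?gt_eqF// !mxE [t `^ _ * _]mulrC; exact: xa.
have H1 : forall l, admissible [pred i | a ord0 i != 0] l -> [set l | s l != 0] l ->
    forall i0, [pred i | a ord0 i != 0] i0 -> l ord0 i0 != 0 -> 1 <= l ord0 i0.
  by move=> l al _ j Yj lj; exact: (admissible_ge1 Yj al).
have H2 : box [pred i | a ord0 i != 0] (const_mx r1) (x - a).
  move=> j; split; first by rewrite [X in _ <= X]mxE ltW// !mxE; exact: xr1.
  by rewrite /= negbK => /eqP aj; rewrite !mxE aj subr0; exact: ox.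
have H3 : forall i0, [pred i | a ord0 i != 0] i0 -> `|(x - a) ord0 i0| <= e' * (const_mx r1 : 'rV[R]_n) ord0 i0.
  by move=> j Yj; rewrite [X in _ * X]mxE.
have H4 : forall i0, ~~ [pred i | a ord0 i != 0] i0 -> (x - a) ord0 i0 = 0.
  move=> j; rewrite /= negbK => aj; have : j \in zeros x by rewrite Zt inE.
  by rewrite inE !mxE => /eqP ->; rewrite (eqP aj) subr0.
move=> /(_ H1 H2 H3 H4); rewrite fx f0 subr0 powRr1; last by case/andP: e'1.
rewrite ger0_norm ?powR_ge0// => H.
have tE : t `^ e = t `^ (e / 2) * t `^ (e / 2).
  by rewrite -powRD; [rewrite -splitr|rewrite (gt_eqF tp) implybT].
have tp2 : 0 < t `^ (e / 2) by rewrite powR_gt0.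
move: H tC; rewrite /e' tE; set u := t `^ (e / 2) in tp2 *; set c := e^-1 / r1 * B.
move=> H tC; have : u <= u * (u * c) by rewrite /c; move: H; congr (_ <= _); ring.
move=> H5; have : u * (u * c) <= u * (u * (c + 1)) by rewrite !ler_wpM2l ?(ltW tp2)// lerDl.
move=> H6; have := le_trans (le_trans H5 H6) (ler_wpM2l (ltW tp2) tC).
by move: tp2; lra.
Qed.

End Leaves.

(** * Local properties of analytic functions and monomial substitutions *)

Section Compositions.
Variables (R : realType) (n : nat).
Implicit Types (a b x y : 'rV[R]_n) (U V W : set 'rV[R]_n) (r t e : R).
Implicit Types (th ps : 'rV[R]_n -> 'rV[R]_n) (f g : 'rV[R]_n -> R) (Y : pred 'I_n).

Definition rcontR U g := forall a, U a -> forall e, 0 < e ->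
  exists2 d, 0 < d & forall x, rclose d x a -> U x -> `|g x - g a| < e.

Lemma within_contP U g : {within U, continuous g} <-> rcontR U g.
Proof.
rewrite subspace_continuousP; split=> h a Ua.
  move=> e e0; have /cvgrPdist_lt/(_ e e0) := h a Ua.
  rewrite near_withinE => /near_rowP[d d0 hd]; exists d => // x xa Ux.
  by rewrite distrC; exact: hd.
apply/cvgrPdist_lt => e e0; rewrite near_withinE; apply/near_rowP.
by have [d d0 hd] := h a Ua e e0; exists d => // x xa Ux; rewrite distrC; exact: hd.
Qed.

Lemma agerm_cont f : agerm f -> forall e, 0 < e -> exists2 d, 0 < d &
  forall y, (forall i, `|y ord0 i| <= d) -> `|f y - f 0| < e.
Proof.
move=> /agerm_lip[r [B [r0 B0 lip]]] e e0.
have e2 : 0 < e / 2 by rewrite divr_gt0.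
have [d d0 hd] := @small_mul R B _ e2.
have m0 : 0 < Num.min d 1 by rewrite lt_min d0 ltr01.
exists (Num.min d 1 * r); first by rewrite mulr_gt0.
move=> y yd; apply: (@le_lt_trans _ _ (e / 2)); last exact: half_lt.
apply: le_trans (hd _ m0 _); last by rewrite ge_min lexx.
by apply: lip => //; rewrite (ltW m0) ge_min lexx orbT.
Qed.

Lemma std_rcontR U g : std_analytic U g -> rcontR U g.
Proof.
move=> sg a Ua e e0; have [f [r [NGf r0 fE]]] := std_agerm sg Ua.
have [d d0 hd] := agerm_cont NGf e0; exists (Num.min r d); first by rewrite lt_min r0.
move=> x xa Ux; rewrite !fE//; [|exact: rclose_refl|by apply: rclose_le xa; rewrite ge_min lexx].
rewrite subrr; apply: hd => i; rewrite !mxE ltW//; apply: lt_le_trans (xa i) _.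
by rewrite ge_min lexx orbT.
Qed.

Lemma std_gen U g : std_analytic U g -> gen_analytic U g.
Proof.
move=> sg; have oU : open_in_orthant U by case: sg.
split=> //; first by apply/within_contP; exact: std_rcontR.
move=> a Ua; have [f [r [NGf r0 fE]]] := std_agerm sg Ua.
apply: (agerm_expands NGf r0) => x xa Ux; split; last exact: fE.
by move=> i; rewrite /= negbK => /eqP ->; exact: (open_in_orthant_sub oU Ux).
Qed.

Lemma gen_ext U f g : (forall x, U x -> f x = g x) -> gen_analytic U f -> gen_analytic U g.
Proof.
move=> fg [oU /within_contP cf ef]; split=> //.
  apply/within_contP => a Ua e e0; have [d d0 hd] := cf a Ua e e0.
  by exists d => // x xa Ux; rewrite -!fg//; exact: hd.
move=> a Ua; have [s [gs cs h]] := ef a Ua; exists s; split=> //.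
by move: h; apply: filterS => x h Ux; rewrite -fg//; exact: h.
Qed.

Lemma std_ext U f g : (forall x, U x -> f x = g x) -> std_analytic U f -> std_analytic U g.
Proof.
move=> fg [oU h]; split=> // a Ua; have [W [u [oW Wa ra gu]]] := h a Ua.
by exists W, u; split=> // x Ux Wx; rewrite -fg//; exact: gu.
Qed.

Lemma gen_sub U V g : open_in_orthant V -> V `<=` U -> gen_analytic U g -> gen_analytic V g.
Proof.
move=> oV VU [oU /within_contP cg eg]; split=> //.
  apply/within_contP => a Va e e0; have [d d0 hd] := cg a (VU a Va) e e0.
  by exists d => // x xa Vx; apply: hd => //; exact: VU.
move=> a Va; have [s [gs cs h]] := eg a (VU a Va); exists s; split=> //.
by move: h; apply: filterS => x h Vx; apply: h; exact: VU.
Qed.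

Lemma std_sub U V g : open_in_orthant V -> V `<=` U -> std_analytic U g -> std_analytic V g.
Proof.
move=> oV VU [oU h]; split=> // a Va; have [W [u [oW Wa ra gu]]] := h a (VU a Va).
by exists W, u; split=> // x Vx Wx; apply: gu => //; exact: VU.
Qed.

Lemma near_sub U V a : open_in_orthant U -> open_in_orthant V -> V `<=` U -> V a ->
  exists2 r, 0 < r & forall x, rclose r x a -> U x -> V x.
Proof.
move=> oU oV VU Va; have /open_in_orthantP[_ /(_ a Va)[r r0 hr]] := oV.
by exists r => // x xa Ux; apply: hr => //; exact: open_in_orthant_sub Ux.
Qed.

Lemma gen_glue U g : open_in_orthant U ->
  (forall a, U a -> exists V, [/\ V a, V `<=` U & gen_analytic V g]) -> gen_analytic U g.
Proof.
move=> oU h; split=> //.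
  apply/within_contP => a Ua e e0; have [V [Va VU [oV /within_contP cg _]]] := h a Ua.
  have [d d0 hd] := cg a Va e e0; have [r r0 hr] := near_sub oU oV VU Va.
  exists (Num.min d r); first by rewrite lt_min d0.
  move=> x xa Ux; apply: hd; first by apply: rclose_le xa; rewrite ge_min lexx.
  by apply: hr => //; apply: rclose_le xa; rewrite ge_min lexx orbT.
move=> a Ua; have [V [Va VU [oV _ eg]]] := h a Ua.
have [s [gs cs hs]] := eg a Va; exists s; split=> //.
have [r r0 hr] := near_sub oU oV VU Va; move/near_rowP: hs => [r' r'0 hs].
apply/near_rowP; exists (Num.min r r'); first by rewrite lt_min r0.
move=> x xa Ux; apply: hs; first by apply: rclose_le xa; rewrite ge_min lexx orbT.
by apply: hr => //; apply: rclose_le xa; rewrite ge_min lexx.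
Qed.

Lemma std_glue U g : open_in_orthant U ->
  (forall a, U a -> exists V, [/\ V a, V `<=` U & std_analytic V g]) -> std_analytic U g.
Proof.
move=> oU h; split=> // a Ua; have [V [Va VU [oV sg]]] := h a Ua.
have [W [u [oW Wa ra gu]]] := sg a Va.
have [V' oV' VE] := oV.
exists (W `&` V'), u; split.
- exact: openI.
- by split=> //; move: Va; rewrite VE => -[].
- move=> x [Wx _]; have [s [gs cs /near_rowP[r r0 hs]]] := ra x Wx.
  exists s; split=> //; apply/near_rowP; exists r => // z zx [Wz _].
  exact: hs.
- move=> x Ux [Wx V'x]; apply: gu => //; rewrite VE; split=> //.
  exact: open_in_orthant_sub Ux.
Qed.

(** [th] has near [a] the form required by substitution: analytic components
    for the indices in [YT], and for the others a real power of a coordinate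
    outside [YS] times a unit. *)
Definition adapted (YT YS : pred 'I_n) U th a := 
  exists (w Lx : 'I_n -> 'rV[R]_n -> R) (sg : 'I_n -> 'I_n) (ga : 'I_n -> R) r0,
  [/\ (forall i, YT i -> agerm (w i) /\ w i 0 = 0),
      (forall i, ~~ YT i -> [/\ 0 < ga i, agerm (Lx i), ~~ YS (sg i) &
         forall y, 0 <= y ord0 (sg i) -> w i y = y ord0 (sg i) `^ ga i * expR (Lx i y)]),
      (forall i j, ~~ YT i -> ~~ YT j -> sg i = sg j -> i = j),
      0 < r0
    & forall x, rclose r0 x a -> U x -> (forall i, ~~ YS i -> a ord0 i <= x ord0 i) /\
     forall i, th x ord0 i = th a ord0 i + w i (x - a)].

Lemma adapted_cont YT YS U th a : adapted YT YS U th a ->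
  forall e, 0 < e -> exists2 d, 0 < d & forall x, rclose d x a -> U x -> rclose e (th x) (th a).
Proof.
move=> [w [Lx [sg [ga [r0 [hN hR _ r00 thE]]]]]] e e0.
have [i|d d0 hd] := @small_all R 'I_n (fun i d => forall x, rclose r0 x a -> rclose d x a -> U x ->
    `|w i (x - a)| < e).
  case: (boolP (YT i)) => Yi.
    have [NGw w0] := hN i Yi; have [d d0 hd] := agerm_cont NGw e0.
    exists d => // t t0 td x _ xa Ux; rewrite -[w i _]subr0 -w0; apply: hd => k.
    rewrite !mxE ltW//; exact: lt_le_trans (xa k) td.
  have [g0 NGL nYS wE] := hR i Yi; have NGE := agerm_exp NGL.
  have [d1 d10 hd1] := agerm_cont NGE ltr01.
  have C0 : 0 < expR (Lx i 0) + 1 by rewrite addr_gt0// expR_gt0.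
  have e2 : 0 < e / 2 by rewrite divr_gt0.
  have [d2 d20 hd2] := small_pow g0 ltr01 C0 e2.
  exists (Num.min d1 d2); first by rewrite lt_min d10.
  move=> t t0; rewrite le_min => /andP[td1 td2] x x0 xa Ux.
  have [ax _] := thE x x0 Ux; have y0 : 0 <= (x - a) ord0 (sg i) by rewrite !mxE subr_ge0 ax.
  rewrite wE// ger0_norm ?mulr_ge0 ?powR_ge0 ?(ltW (expR_gt0 _))//.
  have h1 : expR (Lx i (x - a)) <= expR (Lx i 0) + 1.
    have : `|expR (Lx i (x - a)) - expR (Lx i 0)| < 1.
      by apply: hd1 => k; rewrite !mxE ltW//; exact: lt_le_trans (xa k) td1.
    by rewrite ltr_norml => /andP[_ ?]; lra.
  have h2 : (x - a) ord0 (sg i) `^ ga i <= (t * 1) `^ ga i.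
    apply: powR_le => //; last exact: ltW.
    by apply: le_trans (ler_norm _) _; rewrite !mxE mulr1 ltW.
  apply: (@le_lt_trans _ _ (e / 2)); last exact: half_lt.
  apply: le_trans (hd2 t t0 td2); apply: ler_pM => //; rewrite ?powR_ge0 ?(ltW (expR_gt0 _))//.
exists (Num.min d r0); first by rewrite lt_min d0.
move=> x xa Ux i; have x0 : rclose r0 x a by apply: rclose_le xa; rewrite ge_min lexx orbT.
have [_ ->] := thE x x0 Ux; rewrite addrC addKr.
by apply: (hd d) => //; apply: rclose_le xa; rewrite ge_min lexx.
Qed.

Lemma adapted_expands YT YS U V th a g : adapted YT YS U th a ->
  (forall x, U x -> V (th x)) -> expands_at YT V g (th a) -> expands_at YS U (g \o th) a.
Proof.
move=> ad UV eg; have cont := adapted_cont ad.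
have [w [Lx [sg [ga [r0 [hN hR inj r00 thE]]]]]] := ad.
apply: (expands_comp (w := w) (Lx := Lx) (sg := sg) (ga := ga) eg hN _ inj _ r00 _ cont).
- by move=> i /hR[].
- by move=> i y /hR[_ _ _]; apply.
- by move=> x xa Ux; have [h1 h2] := thE x xa Ux; split=> //; exact: UV.
Qed.

Definition nz x : pred 'I_n := [pred i | x ord0 i != 0].

(** The expansion at each point comes from the expansion of [g] at its image;
    continuity is inherited from [adapted_cont]. *)
Lemma gen_comp U V th g : open_in_orthant U -> (forall x, U x -> V (th x)) ->
  (forall a, U a -> adapted (nz (th a)) (nz a) U th a) ->
  gen_analytic V g -> gen_analytic U (g \o th).
Proof.
move=> oU UV ad [oV /within_contP cg eg]; split=> //.
  apply/within_contP => a Ua e e0; have [d d0 hd] := cg (th a) (UV a Ua) e e0.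
  have [d' d'0 hd'] := adapted_cont (ad a Ua) d0.
  by exists d' => // x xa Ux; apply: hd; [exact: hd'|exact: UV].
by move=> a Ua; apply: adapted_expands (ad a Ua) UV (eg _ (UV a Ua)).
Qed.

(** A power map is the transition between a chart and its local
    m-standardization. *)
Definition pw (ga : 'I_n -> R) x : 'rV[R]_n := \row_i (x ord0 i `^ ga i).

Lemma pw_orthant ga x : orthant (pw ga x).
Proof. by move=> i; rewrite mxE powR_ge0. Qed.

Lemma pwK ga x : (forall i, 0 < ga i) -> orthant x -> pw (fun i => (ga i)^-1) (pw ga x) = x.
Proof.
by move=> g0 ox; apply/rowP => i; rewrite !mxE -powRrM divff ?gt_eqF// powRr1//.
Qed.

Lemma pw_adapted ga U a : (forall i, 0 < ga i) -> open_in_orthant U -> U a ->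
  adapted (nz (pw ga a)) (nz a) U (pw ga) a.
Proof.
move=> g0 oU Ua; have oa := open_in_orthant_sub oU Ua.
have nzE i : nz (pw ga a) i = nz a i by rewrite /nz /= mxE powR_eq0 (gt_eqF (g0 i)) andbT.
exists (fun i y => if nz a i then (a ord0 i + y ord0 i) `^ ga i - a ord0 i `^ ga i
   else y ord0 i `^ ga i * expR 0), (fun _ _ => 0), id, ga, 1; split=> //.
- move=> i; rewrite nzE => Yi; cbv beta; rewrite Yi; split; last by rewrite mxE addr0 subrr.
  have ai : 0 < a ord0 i by rewrite lt_neqAle eq_sym; apply/andP; split; [exact: Yi|exact: oa].
  exact: (agerm_add (agerm_powR_coord i (ga i) ai) (agerm_cst _ (- (a ord0 i `^ ga i)))).
- move=> i; rewrite nzE => Yi; split=> //; first exact: agerm_cst.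
  by move=> y _; cbv beta; rewrite (negbTE Yi).
- move=> x xa Ux; have ox := open_in_orthant_sub oU Ux; split=> i.
    by rewrite negbK => /eqP ->; exact: ox.
  rewrite !mxE; case: ifPn => [_|]; first by rewrite (addrC (a ord0 i)) subrK addrC subrK.
  by rewrite negbK => /eqP ->; rewrite powR0 ?gt_eqF// subr0 add0r expR0 mulr1.
Qed.

Lemma gen_pw ga U V g : (forall i, 0 < ga i) -> open_in_orthant U ->
  (forall x, U x -> V (pw ga x)) -> gen_analytic V g -> gen_analytic U (g \o pw ga).
Proof. by move=> g0 oU UV; apply: gen_comp => // a Ua; exact: pw_adapted. Qed.

Lemma pw_rcont ga U : (forall i, 0 < ga i) -> open_in_orthant U -> rcont U (pw ga).
Proof. by move=> g0 oU a Ua; apply: adapted_cont (pw_adapted g0 oU Ua). Qed.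

Lemma pw_open ga U : (forall i, 0 < ga i) -> open_in_orthant U -> open_in_orthant (pw ga @` U).
Proof.
move=> g0 oU; apply/open_in_orthantP; split=> [_ [x _ <-]|_ [a Ua <-]]; first exact: pw_orthant.
have oo : open_in_orthant (@orthant R n) by exists setT; [exact: openT|rewrite setTI].
have gi0 i : 0 < (ga i)^-1 by rewrite invr_gt0.
have /open_in_orthantP[Uo /(_ a Ua)[r r0 hr]] := oU.
have [d d0 hd] := pw_rcont gi0 oo (pw_orthant ga a) r0.
exists d => // y ya oy; exists (pw (fun i => (ga i)^-1) y).
  apply: hr (pw_orthant _ _); rewrite -[a in rclose _ _ a](pwK g0 (Uo a Ua)).
  exact: hd.
have := pwK gi0 oy; congr (_ = _).
by apply/rowP => i; rewrite !mxE invrK.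
Qed.

Lemma real_analytic_comp W W' th h : real_analytic W' h -> (forall x, W x -> W' (th x)) ->
  (forall a, W a -> forall i, exists2 f, agerm f & forall y, W (a + y) -> th (a + y) ord0 i = f y) ->
  real_analytic W (h \o th).
Proof.
move=> rh WW' thN a Wa; have [f fP] := choice (fun i => 
  let: ex_intro2 f h1 h2 := thN a Wa i in ex_intro (fun f => agerm f /\ forall y, W (a + y) -> th (a + y) ord0 i = f y) f (conj h1 h2)).
have fE x i : W x -> th x ord0 i = f i (x - a).
  by move=> Wx; have [_ <-] := fP i; rewrite addrC subrK.
apply: adapted_expands (rh _ (WW' a Wa)) => //.
exists (fun i y => f i y - f i 0), (fun _ _ => 0), id, (fun=> 1), 1; split=> //.
- move=> i _; split; last by rewrite subrr.
  by have [NGf _] := fP i; exact: (agerm_add NGf (agerm_cst _ (- f i 0))).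
- by move=> x xa Wx; split=> // i; rewrite (fE x)// (fE a)// subrr [RHS]addrC subrK.
Qed.

Lemma agerm_rcont W th a : W a ->
  (forall i, exists2 f, agerm f & forall y, W (a + y) -> th (a + y) ord0 i = f y) ->
  forall e, 0 < e -> exists2 d, 0 < d & forall x, rclose d x a -> W x -> rclose e (th x) (th a).
Proof.
move=> Wa thN e e0.
have [i|d d0 hd] := @small_all R 'I_n (fun i d => forall x, rclose d x a -> W x ->
    `|th x ord0 i - th a ord0 i| < e).
  have [f NGf fE] := thN i; have [d d0 hd] := agerm_cont NGf e0.
  have fE' x : W x -> th x ord0 i = f (x - a).
    by move=> Wx; rewrite -fE addrC subrK.
  exists d => // t t0 td x xa Wx; rewrite !fE'// subrr; apply: hd => k.
  by rewrite !mxE ltW//; exact: lt_le_trans (xa k) td.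
by exists d => // x xa Wx i; exact: (hd d).
Qed.

(** The extension to a neighbourhood of [a] keeps, in place of x^0 and x^1 for
    the coordinates vanishing at [a], the constant 1 and the coordinate
    itself, which are defined for negative values too. *)
Lemma std_monomial U V th g (A : 'I_n -> 'I_n -> R) : open_in_orthant U ->
  (forall x, U x -> V (th x)) ->
  (forall x, U x -> forall k, th x ord0 k = \prod_m (x ord0 m `^ A k m)) ->
  (forall a, U a -> forall m, a ord0 m = 0 -> forall k, A k m = 0 \/ A k m = 1) ->
  std_analytic V g -> std_analytic U (g \o th).
Proof.
move=> oU UV thE hA [oV sg]; split=> // a Ua; have oa := open_in_orthant_sub oU Ua.
have [W' [h [oW' W'b rh gh]]] := sg (th a) (UV a Ua).
pose fac (x : 'rV[R]_n) k m := if a ord0 m == 0 then (if A k m == 1 then x ord0 m else 1)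
   else x ord0 m `^ A k m.
(* The analytic extension of [th] across the faces through [a]. *)
pose th' x : 'rV[R]_n := \row_k \prod_m fac x k m.
pose W0 := [set x : 'rV[R]_n | forall m, a ord0 m != 0 -> 0 < x ord0 m].
have W0a : W0 a by move=> m am; rewrite lt_neqAle eq_sym am; exact: oa.
have thN c : W0 c -> forall i, exists2 f, agerm f & forall y, th' (c + y) ord0 i = f y.
  move=> W0c i; exists (fun y => \prod_m fac (c + y) i m); last by move=> y; rewrite mxE.
  apply: agerm_prod => m _; rewrite /fac; case: (boolP (a ord0 m == 0)) => am.
    case: (A i m == 1); last exact: agerm_cst.
    have : agerm (fun y : 'rV[R]_n => c ord0 m + y ord0 m) by apply: agerm_add; [exact: agerm_cst|exact: agerm_coord].
    by congr agerm; apply/funext => y; rewrite mxE.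
  have := @agerm_powR_coord R n m (c ord0 m) (A i m) (W0c m am).
  by congr agerm; apply/funext => y; rewrite mxE.
have thE' x : U x -> th' x = th x.
  move=> Ux; apply/rowP => k; rewrite mxE thE//; apply: eq_bigr => m _; rewrite /fac.
  case: eqP => // am; have [A0|A1] := hA a Ua m am k.
    by rewrite A0 powRr0 ifN// eq_sym oner_eq0.
  have xm : 0 <= x ord0 m by exact: (open_in_orthant_sub oU Ux).
  by rewrite A1 eqxx powRr1.
pose W := W0 `&` [set x | W' (th' x)].
exists W, (h \o th'); split.
- apply/openP => c [W0c W'c].
  have [m|d d0 hd] := @small_all R 'I_n (fun m d => a ord0 m != 0 -> d <= c ord0 m).
    have [am|am] := eqVneq (a ord0 m) 0; first by exists 1.
    by exists (c ord0 m) => //; exact: W0c.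
  have /openP/(_ _ W'c)[e e0 he] := oW'.
  have [|d' d'0 hd'] := @agerm_rcont setT th' c I _ e e0.
    by move=> i; have [f NGf fE] := thN c W0c i; exists f.
  exists (Num.min d d'); first by rewrite lt_min d0.
  move=> x xc; split.
    move=> m am; have := hd d d0 (lexx _) m am.
    have := lt_le_trans (xc m) (_ : Num.min d d' <= d); rewrite ge_min lexx => /(_ isT).
    by rewrite ltr_norml => /andP[? _]; lra.
  by apply: he; apply: hd' => //; apply: rclose_le xc; rewrite ge_min lexx orbT.
- by split=> //=; rewrite thE'.
- apply: real_analytic_comp rh _ _; first by move=> x [].
  by move=> c [W0c _] i; have [f NGf fE] := thN c W0c i; exists f.
- by move=> x Ux [_ /=]; rewrite thE'// => W'x; apply: gh => //; exact: UV.
Qed.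

Lemma std_coord U i : open_in_orthant U -> std_analytic U (fun x => x ord0 i).
Proof.
move=> oU; split=> // a Ua; exists setT, (fun x => x ord0 i); split=> //; first exact: openT.
move=> c _; have h : agerm (fun y : 'rV[R]_n => c ord0 i + y ord0 i).
  by apply: agerm_add; [exact: agerm_cst|exact: agerm_coord].
apply: (agerm_expands h ltr01) => x _ _; split=> //.
by rewrite !mxE [RHS]addrC subrK.
Qed.

Lemma gen_coord_pow U i c : 0 < c -> open_in_orthant U -> gen_analytic U (fun x => x ord0 i `^ c).
Proof.
move=> c0 oU; have := @gen_pw (fun=> c) U _ (fun x => x ord0 i) (fun=> c0) oU (fun x Ux => imageP _ Ux).
move=> /(_ (std_gen (std_coord i (pw_open (fun=> c0) oU)))).
by apply: gen_ext => x _ /=; rewrite mxE.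
Qed.

End Compositions.

(** * Standard isomorphisms of orthants *)

Section Facets.
Variables (R : realType) (n : nat).
Implicit Types (a b x y : 'rV[R]_n) (U V W : set 'rV[R]_n) (r t e : R).
Implicit Types (th ps : 'rV[R]_n -> 'rV[R]_n) (f g : 'rV[R]_n -> R) (J : {set 'I_n}).

(** Connectedness of the unit interval, for functions into an arbitrary type. *)
Lemma locally_const (T : Type) (f : R -> T) :
  (forall s, 0 <= s <= 1 -> exists2 d, 0 < d &
     forall u, 0 <= u <= 1 -> `|u - s| < d -> f u = f s) -> f 1 = f 0.
Proof.
move=> loc; pose S := [set s : R | 0 <= s <= 1 /\ forall u, 0 <= u -> u <= s -> f u = f 0].
have S0 : S 0.
  by split; [rewrite lexx ler01|move=> u u0 u1; congr f; apply/le_anti/andP; split].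
have hS : has_sup S.
  by split; [exists 0|exists 1 => s [/andP[]]].
pose c := sup S.
have c0 : 0 <= c by apply: ub_le_sup => //; case: hS.
have c1 : c <= 1 by apply: ge_sup; [exists 0|move=> s [/andP[]]].
have c01 : 0 <= c <= 1 by rewrite c0 c1.
have [d d0 hd] := loc c c01.
have [s Ss sc] := sup_adherent d0 hS; rewrite -/c in sc.
have [/andP[s0 s1] hs] := Ss.
have sle : s <= c by apply: ub_le_sup => //; case: hS.
have far u : 0 <= u <= 1 -> u < c + d -> f u = f 0.
  move=> /andP[u0 u1] uc; have [us|su] := leP u s; first exact: hs.
  have uc' : `|u - c| < d by rewrite ltr_norml; apply/andP; split; lra.
  have sc' : `|s - c| < d by rewrite distrC ger0_norm; lra.
  by rewrite (hd u _ uc') ?u0// -(hs s s0 (lexx _)) (hd s _ sc')// s0.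
have [cd|cd] := ltP 1 (c + d); first by apply: far => //; rewrite ler01 lexx.
have d2 : 0 < d / 2 by rewrite divr_gt0.
have dd : d / 2 + d / 2 = d by rewrite -splitr.
have : S (c + d / 2).
  split; first by apply/andP; split; lra.
  move=> u u0 uc; apply: far; last by lra.
  by rewrite u0; lra.
by move=> /(ub_le_sup hS.2); rewrite -/c => h; exfalso; lra.
Qed.

Variables (U V : set 'rV[R]_n) (th ps : 'rV[R]_n -> 'rV[R]_n).
Hypothesis oU : open_in_orthant U.
Hypothesis oV : open_in_orthant V.
Hypothesis hm : homeo U V th ps.
Hypothesis cards : forall a, U a -> #|zeros (th a)| = #|zeros a|.

(** A radius within which points of the orthant lie in [U] and have images
    with no new zeros. *)
Lemma facet_radius a : U a -> exists2 r, 0 < r & forall x, rclose r x a -> orthant x ->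
  U x /\ zeros (th x) \subset zeros (th a).
Proof.
move=> Ua; have [hUV _ _ _ [thc _]] := hm.
have [r1 r10 hr1] := zeros_near (th a).
have [d d0 hd] := thc a Ua r1 r10.
have /open_in_orthantP[_ /(_ a Ua)[r2 r20 hr2]] := oU.
exists (Num.min d r2); first by rewrite lt_min d0.
move=> x xa ox; have Ux : U x by apply: hr2 => //; apply: rclose_le xa; rewrite ge_min lexx orbT.
by split=> //; apply: hr1; apply: hd => //; apply: rclose_le xa; rewrite ge_min lexx.
Qed.

(** Along a segment inside a stratum the number of zeros of [th] is constant,
    and nearby zero sets are included in one another; so they are locally
    constant. *)
Lemma zeros_segment a r x0 x1 J : U a ->
  (forall x, rclose r x a -> orthant x -> U x) ->
  rclose r x0 a -> rclose r x1 a -> orthant x0 -> orthant x1 -> zeros x0 = J -> zeros x1 = J ->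
  zeros (th x1) = zeros (th x0).
Proof.
move=> Ua hr xa0 xa1 o0 o1 z0 z1; have [_ _ _ _ [thc _]] := hm.
pose xs (s : R) : 'rV[R]_n := (1 - s) *: x0 + s *: x1.
have xsE s i : xs s ord0 i = (1 - s) * x0 ord0 i + s * x1 ord0 i by rewrite !mxE.
have xso s : 0 <= s <= 1 -> orthant (xs s).
  by move=> /andP[s0 s1] i; rewrite xsE addr_ge0// mulr_ge0// ?subr_ge0//.
have xsa s : 0 <= s <= 1 -> rclose r (xs s) a.
  move=> /andP[s0 s1] i; rewrite xsE.
  have -> : (1 - s) * x0 ord0 i + s * x1 ord0 i - a ord0 i =
     (1 - s) * (x0 ord0 i - a ord0 i) + s * (x1 ord0 i - a ord0 i) by ring.
  apply: le_lt_trans (ler_normD _ _) _; rewrite !normrM (ger0_norm s0) ger0_norm ?subr_ge0//.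
  have h0 := xa0 i; have h1 := xa1 i.
  have [sE|sn] := eqVneq s 0; first by rewrite sE subr0 mul1r mul0r addr0.
  have sp : 0 < s by rewrite lt_neqAle eq_sym sn.
  have -> : r = (1 - s) * r + s * r by ring.
  apply: ler_ltD; last by rewrite ltr_pM2l.
  by rewrite ler_wpM2l ?subr_ge0// ltW.
have xsz s : 0 <= s <= 1 -> zeros (xs s) = J.
  move=> /andP[s0 s1]; apply/setP => i; rewrite !inE xsE.
  have zi0 : (x0 ord0 i == 0) = (i \in J) by rewrite -z0 inE.
  have zi1 : (x1 ord0 i == 0) = (i \in J) by rewrite -z1 inE.
  case: (boolP (i \in J)) zi0 zi1 => _ /eqP h0 /eqP h1.
    by rewrite h0 h1 !mulr0 addr0 eqxx.
  have p0 : 0 < x0 ord0 i by rewrite lt_neqAle eq_sym; apply/andP; split; [exact/eqP|exact: o0].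
  have p1 : 0 < x1 ord0 i by rewrite lt_neqAle eq_sym; apply/andP; split; [exact/eqP|exact: o1].
  apply/negbTE; rewrite gt_eqF//.
  have [sE|sn] := eqVneq s 0; first by rewrite sE subr0 mul1r mul0r addr0.
  have sp : 0 < s by rewrite lt_neqAle eq_sym sn.
  by rewrite ltr_wpDl ?mulr_gt0// mulr_ge0 ?subr_ge0// ltW.
have x0E : xs 0 = x0 by rewrite /xs subr0 scale1r scale0r addr0.
have x1E : xs 1 = x1 by rewrite /xs subrr scale1r scale0r add0r.
rewrite -{1}x1E -{1}x0E; apply: (@locally_const _ (fun s => zeros (th (xs s)))).
move=> s s01; have Us : U (xs s) by apply: hr; [exact: xsa|exact: xso].
have [r1 r10 hr1] := zeros_near (th (xs s)).
have [d d0 hd] := thc _ Us r1 r10.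
(* A Lipschitz constant for the segment; adding 1 keeps it positive when the
   end points agree. *)
pose M := \sum_i `|x1 ord0 i - x0 ord0 i| + 1.
have M0 : 0 < M by rewrite ltr_wpDl// sumr_ge0.
exists (d / M); first by rewrite divr_gt0.
move=> u u01; rewrite ltr_pdivlMr// => us.
have Uu : U (xs u) by apply: hr; [exact: xsa|exact: xso].
apply/eqP; rewrite eqEcard; apply/andP; split; last by rewrite !cards// !xsz.
apply: hr1; apply: hd => // i; rewrite !xsE.
have -> : (1 - u) * x0 ord0 i + u * x1 ord0 i - ((1 - s) * x0 ord0 i + s * x1 ord0 i) =
  (u - s) * (x1 ord0 i - x0 ord0 i) by ring.
rewrite normrM; apply: le_lt_trans us; rewrite ler_wpM2l// /M (bigD1 i)//=.
by rewrite -addrA lerDl addr_ge0// sumr_ge0.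
Qed.

(** Each coordinate [i] vanishing at [th a] corresponds to one coordinate [sg
    i] vanishing at [a]: a ray issued from [th a] inside the facet [i] pulls
    back to a point with exactly one zero, and by [zeros_segment] the facet
    through that point is mapped into the facet [i] near [a]. *)
Lemma facet a : U a -> exists (sg : 'I_n -> 'I_n) r, [/\ 0 < r,
  forall i, i \in zeros (th a) -> sg i \in zeros a,
  forall i j, i \in zeros (th a) -> j \in zeros (th a) -> sg i = sg j -> i = j
  & forall i x, i \in zeros (th a) -> rclose r x a -> orthant x -> x ord0 (sg i) = 0 ->
      U x /\ th x ord0 i = 0].
Proof.
move=> Ua; have [hUV hVU psK thK [thc psc]] := hm.
have Vb := hUV a Ua; have ob := open_in_orthant_sub oV Vb.
have [r r0 hr] := facet_radius Ua.
have hrU x : rclose r x a -> orthant x -> U x by move=> xa ox; case: (hr x xa ox).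
have pt i : i \in zeros (th a) -> exists j x0, [/\ rclose r x0 a, orthant x0, zeros x0 = [set j]%SET,
    zeros (th x0) = [set i]%SET & j \in zeros a].
  move=> iz; have [d d0 hd] := psc (th a) Vb r r0.
  have [r3 r30 hr3] := zeros_near a; have [d3 d30 hd3] := psc (th a) Vb r3 r30.
  have /open_in_orthantP[_ /(_ _ Vb)[r2 r20 hr2]] := oV.
  pose m := Num.min d (Num.min r2 d3).
  have m0 : 0 < m by rewrite !lt_min d0 r20.
  pose t := m / 2; have t0 : 0 < t by rewrite divr_gt0.
  have tm : t < m by exact: half_lt.
  pose y := bump (th a) (zeros (th a) :\ i)%SET t.
  have yb r' : m <= r' -> rclose r' y (th a).
    by move=> mr; apply: bump_rclose; [exact: ltW|exact: lt_le_trans tm mr].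
  have Vy : V y.
    apply: hr2; last by apply: bump_orthant => //; exact: ltW.
    by apply: yb; rewrite /m !ge_min lexx orbT.
  have zy : zeros y = [set i]%SET.
    rewrite /y zeros_bump//; apply/setP => k; rewrite !inE.
    by case: eqVneq => [->|_] //=; [move: iz; rewrite inE => ->|rewrite andNb].
  have Ux : U (ps y) by exact: hVU.
  have c1 : #|zeros (ps y)| = 1%N by rewrite -cards// thK// zy cards1.
  have /eqP/cards1P[j zx] := c1.
  exists j, (ps y); split=> //.
  - by rewrite -[a](psK a Ua); apply: hd => //; apply: yb; rewrite /m ge_min lexx.
  - exact: open_in_orthant_sub Ux.
  - by rewrite thK.
  - have /hr3/fintype.subsetP : rclose r3 (ps y) a.
      by rewrite -[a](psK a Ua); apply: hd3 => //; apply: yb; rewrite /m !ge_min lexx !orbT.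
    by apply; rewrite zx inE.
have /choice[sg sgP] : forall i, exists j, i \in zeros (th a) ->
    exists x0, [/\ rclose r x0 a, orthant x0, zeros x0 = [set j]%SET,
    zeros (th x0) = [set i]%SET & j \in zeros a].
  move=> i.
  have [iz|niz] := boolP (i \in zeros (th a)); last by exists i.
  by have [j [x0 h]] := pt i iz; exists j => _; exists x0.
have van i x : i \in zeros (th a) -> rclose r x a -> orthant x -> x ord0 (sg i) = 0 ->
    U x /\ th x ord0 i = 0.
  move=> iz xa ox xj; have Ux := hrU x xa ox; split=> //.
  have [x0 [x0a o0 z0 t0 sz]] := sgP i iz.
  apply/eqP; apply: contraT => tx.
  have tx0 : 0 < `|th x ord0 i| by rewrite normr_gt0.
  have [d d0 hd] := thc x Ux _ tx0.
  have [|e e0 he] := @small_all R 'I_n (fun k e => `|x ord0 k - a ord0 k| + e < r).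
    move=> k; exists ((r - `|x ord0 k - a ord0 k|) / 2).
      by rewrite divr_gt0// subr_gt0; exact: xa.
    by move=> t t0' te; have := xa k; lra.
  pose t := Num.min e d / 2; have m0 : 0 < Num.min e d by rewrite lt_min e0.
  have tp : 0 < t by rewrite divr_gt0.
  have tm : t < Num.min e d by exact: half_lt.
  pose x1 := bump x (zeros x :\ sg i)%SET t.
  have z1 : zeros x1 = [set sg i]%SET.
    rewrite /x1 zeros_bump//; apply/setP => k; rewrite !inE.
    by case: eqVneq => [->|_] /=; [rewrite xj eqxx|rewrite andNb].
  have o1 : orthant x1 by apply: bump_orthant => //; exact: ltW.
  have x1a : rclose r x1 a.
    move=> k; rewrite mxE; have te : t <= e by apply: le_trans (ltW tm) _; rewrite ge_min lexx.
    apply: le_lt_trans (he t tp te k).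
    rewrite addrAC; apply: le_trans (ler_normD _ _) _; rewrite lerD2l.
    by case: (k \in _); rewrite ?mulr1 ?mulr0 ?normr0 ?(ltW tp)// ger0_norm// ltW.
  have := zeros_segment Ua hrU x0a x1a o0 o1 z0 z1; rewrite t0 => zt1.
  have t1 : th x1 ord0 i = 0 by apply/eqP; have : i \in zeros (th x1) by [rewrite zt1 inE]; rewrite inE.
  have : rclose `|th x ord0 i| (th x1) (th x).
    apply: hd; last exact: hrU.
    by apply: bump_rclose; [exact: ltW|apply: lt_le_trans tm _; rewrite ge_min lexx orbT].
  by move=> /(_ i); rewrite t1 sub0r normrN ltxx.
exists sg, r; split=> //.
- by move=> i iz; have [x0 []] := sgP i iz.
- move=> i j iz jz sij; have [x0 [x0a o0 z0 t0 sz]] := sgP i iz.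
  have xj : x0 ord0 (sg j) = 0.
    by apply/eqP; have : sg i \in zeros x0 by [rewrite z0 inE]; rewrite inE sij.
  have [_ tj] := van j x0 jz x0a o0 xj.
  have : j \in zeros (th x0) by rewrite inE tj.
  by rewrite t0 inE => /eqP.
Qed.

End Facets.

Section StdIso.
Variables (R : realType) (n : nat).
Implicit Types (a b x y : 'rV[R]_n) (U V W : set 'rV[R]_n) (r t e : R).
Implicit Types (th ps : 'rV[R]_n -> 'rV[R]_n) (f g : 'rV[R]_n -> R) (J : {set 'I_n}).

Lemma std_card U V th ps : open_in_orthant U -> open_in_orthant V ->
  homeo U V th ps -> std_map U th -> std_map V ps ->
  forall a, U a -> #|zeros (th a)| = #|zeros a|.
Proof.
move=> oU oV hm st sp; apply: (card_zeros_homeo oU oV hm).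
  exact: (std_leaves oU oV hm).
exact: (std_leaves oV oU (homeo_sym hm)).
Qed.

Lemma gen_card U V th ps : open_in_orthant U -> open_in_orthant V ->
  homeo U V th ps -> gen_pow_map U th -> gen_pow_map V ps ->
  forall a, U a -> #|zeros (th a)| = #|zeros a|.
Proof.
move=> oU oV hm st sp; apply: (card_zeros_homeo oU oV hm).
  exact: (gen_leaves oU oV hm).
exact: (gen_leaves oV oU (homeo_sym hm)).
Qed.

(** Divide by the coordinate [j]. Were the quotient [u] nonpositive at 0, the
    component would be bounded by a product of two quantities linear in [t] on
    the preimage of the ray [bump (th a) [set i] t], on which it equals [t]. *)
Lemma unit_factor U V th ps a i j r : open_in_orthant U -> open_in_orthant V ->
  homeo U V th ps -> std_map U th -> std_map V ps -> U a -> 0 < r ->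
  th a ord0 i = 0 -> a ord0 j = 0 ->
  (forall x, rclose r x a -> orthant x -> x ord0 j = 0 -> U x /\ th x ord0 i = 0) ->
  exists u r', [/\ agerm u, 0 < u 0, 0 < r' & forall x, rclose r' x a -> U x ->
     0 < u (x - a) /\ th x ord0 i = x ord0 j * u (x - a)].
Proof.
move=> oU oV hm st sp Ua r0 bi aj van; have [hUV hVU psK thK [thc psc]] := hm.
have Vb := hUV a Ua; have oa := open_in_orthant_sub oU Ua; have ob := open_in_orthant_sub oV Vb.
have [f [r1 [[r2 [B [r20 rep]]] r10 fE]]] := std_agerm (st i) Ua.
have [u [urep uE]] := Rep_div j (pos_const r20) rep.
have NGu : agerm u by exists r2, (B / (const_mx r2 : 'rV[R]_n) ord0 j).
pose m := Num.min r (Num.min r1 r2).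
have m0 : 0 < m by rewrite !lt_min r0 r10.
have mr : m <= r by rewrite /m ge_min lexx.
have mr1 : m <= r1 by rewrite /m !ge_min lexx orbT.
have mr2 : m <= r2 by rewrite /m !ge_min lexx !orbT.
have thE x : rclose m x a -> U x -> th x ord0 i = x ord0 j * u (x - a).
  move=> xa Ux; have ox := open_in_orthant_sub oU Ux.
  pose x' := kill j x.
  have x'a : rclose m x' a.
    move=> k; rewrite mxE; case: eqP => [->|_]; last exact: xa.
    by rewrite aj subrr normr0.
  have ox' : orthant x' by move=> k; rewrite mxE; case: ifP => // _; exact: ox.
  have x'j : x' ord0 j = 0 by rewrite mxE eqxx.
  have [Ux' thx'] := van x' (rclose_le mr x'a) ox' x'j.
  have kE : kill j (x - a) = x' - a.
    by apply/rowP => k; rewrite !mxE; case: eqP => // ->; rewrite aj subr0.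
  have := uE (x - a); rewrite kE -!fE//; last 2 first.
  - exact: (rclose_le mr1 x'a).
  - exact: (rclose_le mr1 xa).
  rewrite thx' subr0 !mxE aj subr0; apply=> k.
  by rewrite !mxE; split=> //; apply: ltW; apply: lt_le_trans (xa k) mr2.
have u0 : 0 < u 0.
  rewrite ltNge; apply/negP => u0.
  have [r3 [B3 [r30 B30 lip]]] := agerm_lip NGu.
  have [e e0 he] := small_all (fun k => lip_along [set i]%SET (sp k) Vb).
  have {he}hlip := he e e0 (lexx _).
  have ei0 : 0 < e^-1 by rewrite invr_gt0.
  have half (c : R) : 0 < c -> 0 < c / 2 by move=> c0; rewrite divr_gt0.
  have /open_in_orthantP[_ /(_ _ Vb)[r4 r40 hr4]] := oV.
  have [|d d0 hd] := small_and (small_const (half _ r40)) (small_and (small_const e0)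
   (small_and (@small_mul R (e^-1 / r3) 1 ltr01) (small_and (@small_mul R e^-1 _ (half _ m0))
   (@small_mul R (e^-1 * (e^-1 / r3) * B3) (2^-1) _)))); first by rewrite invr_gt0.
  have [tr4 [te [ter [tm tC]]]] := hd d d0 (lexx d).
  move: d d0 tr4 te ter tm tC {hd} => t tp tr4 te ter tm tC.
  have lt2 (c d : R) : 0 < d -> c <= d / 2 -> c < d by lra.
  have Vt : V (bump (th a) [set i]%SET t).
    apply: hr4; last by apply: bump_orthant => //; exact: ltW.
    by apply: bump_rclose; [exact: ltW|exact: lt2].
  pose x := ps (bump (th a) [set i]%SET t); have Ux : U x by exact: hVU.
  have ox := open_in_orthant_sub oU Ux.
  have xa k : `|x ord0 k - a ord0 k| <= e^-1 * t.
    by have := hlip k t tp te Vt; rewrite psK.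
  have xm : rclose m x a.
    by move=> k; apply: le_lt_trans (xa k) _; rewrite mulrC; exact: lt2.
  have := thE x xm Ux; rewrite thK// mxE bi add0r inE eqxx mulr1 => tE.
  have e'1 : 0 <= t * (e^-1 / r3) <= 1 by rewrite ter andbT mulr_ge0 ?(ltW tp)// divr_ge0// ltW.
  have ub : `|u (x - a) - u 0| <= t * (e^-1 / r3) * B3.
    apply: lip => // k; rewrite !mxE mulrA divfK ?gt_eqF// [t * _]mulrC; exact: xa.
  have ule : u (x - a) <= t * (e^-1 / r3) * B3 by move: ub; rewrite ler_norml => /andP[_ ?]; lra.
  have xj0 : 0 <= x ord0 j by exact: ox.
  have xjle : x ord0 j <= e^-1 * t.
    by have := xa j; rewrite aj subr0 => h; apply: le_trans (ler_norm _) h.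
  have H1 : t <= e^-1 * t * (t * (e^-1 / r3) * B3).
    rewrite {1}tE; apply: le_trans (ler_wpM2l xj0 ule) _; apply: ler_wpM2r => //.
    by rewrite mulr_ge0//; case/andP: e'1.
  have H2 : t <= t * (t * (e^-1 * (e^-1 / r3) * B3)).
    by apply: le_trans H1 _; rewrite le_eqVlt; apply/orP; left; apply/eqP; ring.
  have := le_trans H2 (ler_wpM2l (ltW tp) tC); lra.
have [d d0 hd] := agerm_cont NGu u0.
exists u, (Num.min m d); split=> //; first by rewrite lt_min m0.
move=> x xa Ux; have xm : rclose m x a by apply: rclose_le xa; rewrite ge_min lexx.
split; last exact: thE.
have : `|u (x - a) - u 0| < u 0.
  apply: hd => k; rewrite !mxE ltW//; apply: lt_le_trans (xa k) _.
  by rewrite ge_min lexx orbT.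
by rewrite ltr_norml => /andP[? _]; lra.
Qed.

(** The components of a standard isomorphism that vanish at a point are
    coordinates times positive units, by [facet] and [unit_factor]. *)
Lemma std_adapted U V th ps a : open_in_orthant U -> open_in_orthant V ->
  homeo U V th ps -> std_map U th -> std_map V ps -> U a ->
  adapted (nz (th a)) (nz a) U th a.
Proof.
move=> oU oV hm st sp Ua.
have [sg [r [r0 sgz sgi van]]] := facet oU oV hm (std_card oU oV hm st sp) Ua.
have /choice[f fP] : forall i, exists f : 'rV[R]_n -> R, agerm f /\ exists2 r', 0 < r' &
    forall x, rclose r' x a -> U x -> th x ord0 i = f (x - a).
  move=> i.
  by have [f [r' [h1 h2 h3]]] := std_agerm (st i) Ua; exists f; split=> //; exists r'.
have /choice[u uP] : forall i, exists u : 'rV[R]_n -> R, ~~ nz (th a) i ->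
    [/\ agerm u, 0 < u 0 & exists2 r', 0 < r' & forall x, rclose r' x a -> U x ->
     0 < u (x - a) /\ th x ord0 i = x ord0 (sg i) * u (x - a)].
  move=> i.
  have [bi|bi] := boolP (nz (th a) i); first by exists (fun=> 0).
  have iz : i \in zeros (th a) by move: bi; rewrite inE negbK.
  have si : a ord0 (sg i) = 0 by apply/eqP; have := sgz i iz; rewrite inE.
  have b0 : th a ord0 i = 0 by apply/eqP; move: iz; rewrite inE.
  have [u [r' [h1 h2 h3 h4]]] := unit_factor oU oV hm st sp Ua r0 b0 si (fun x xa ox => van i x iz xa ox).
  by exists u => _; split=> //; exists r'.
have [i|m m0 hmE] := @small_all R 'I_n (fun i t => forall x, rclose t x a -> U x ->
    th x ord0 i = f i (x - a) /\ (~~ nz (th a) i -> 0 < u i (x - a) /\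
       th x ord0 i = x ord0 (sg i) * u i (x - a))).
  have [_ [r1 r10 h1]] := fP i.
  have [r2 r20 h2] : exists2 r2, 0 < r2 & forall x, rclose r2 x a -> U x ->
     ~~ nz (th a) i -> 0 < u i (x - a) /\ th x ord0 i = x ord0 (sg i) * u i (x - a).
    have [bi|bi] := boolP (nz (th a) i); first by exists 1.
    by have [_ _ [r' r'0 h]] := uP i bi; exists r' => // x xa Ux _; exact: h.
  exists (Num.min r1 r2); first by rewrite lt_min r10.
  move=> t t0; rewrite le_min => /andP[tr1 tr2] x xa Ux; split.
    by apply: h1 => //; exact: (rclose_le tr1 xa).
  by apply: h2 => //; exact: (rclose_le tr2 xa).
have fa i : f i 0 = th a ord0 i.
  have [_ [r1 r10 h1]] := fP i.
  by rewrite (h1 a (rclose_refl _ r10) Ua) subrr.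
exists (fun i y => if nz (th a) i then f i y - f i 0 else y ord0 (sg i) `^ 1 * expR (ln (u i y))),
  (fun i y => ln (u i y)), sg, (fun=> 1), m; split=> //.
- move=> i bi; cbv beta; rewrite bi; split; last by rewrite subrr.
  by have [NGf _] := fP i; exact: (agerm_add NGf (agerm_cst _ (- f i 0))).
- move=> i bi; have [NGu u0 _] := uP i bi.
  have iz : i \in zeros (th a) by move: bi; rewrite inE negbK.
  split=> //; first exact: agerm_ln.
    by have := sgz i iz; rewrite inE negbK.
  by move=> y _; cbv beta; rewrite (negbTE bi).
- move=> i j bi bj; apply: sgi; rewrite inE; [exact: negbNE bi|exact: negbNE bj].
- move=> x xa Ux; split=> i.
    by rewrite negbK => /eqP ->; exact: (open_in_orthant_sub oU Ux).
  have [h1 h2] := hmE m m0 (lexx _) i x xa Ux.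
  cbv beta; case: ifPn => bi; first by rewrite h1 fa [RHS]addrC subrK.
  have [u0 ->] := h2 bi; have iz : i \in zeros (th a) by move: bi; rewrite inE negbK.
  have si : a ord0 (sg i) = 0 by apply/eqP; have := sgz i iz; rewrite inE.
  have b0 : th a ord0 i = 0 by apply/eqP; move: iz; rewrite inE.
  rewrite b0 add0r lnK ?posrE// !mxE si subr0 powRr1//.
  exact: (open_in_orthant_sub oU Ux).
Qed.

(** Hence enriching a standard structure does not depend on the charts. *)
Lemma gen_comp_std U V th ps g : open_in_orthant U -> open_in_orthant V ->
  homeo U V th ps -> std_map U th -> std_map V ps ->
  gen_analytic V g -> gen_analytic U (g \o th).
Proof.
move=> oU oV hm st sp; apply: gen_comp => //; first by case: hm.
by move=> a Ua; exact: (std_adapted oU oV hm).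
Qed.

End StdIso.

(** * Charts and strata *)

Section Charts.
Variables (R : realType) (n : nat) (M : topologicalType).
Implicit Types (L : presheaf R 'rV[R]_n) (O : presheaf R M).
Implicit Types (U V W D : set M) (phi psi : M -> 'rV[R]_n) (a b : M) (f : M -> R).
Local Notation gen := (@gen_analytic R n).
Local Notation std := (@std_analytic R n).

(** What the two sheaves of functions on the orthant have in common. *)
Definition local_model L :=
  [/\ forall (U : set 'rV[R]_n) g, L U g -> open_in_orthant U,
      forall (U : set 'rV[R]_n) g g', (forall x, U x -> g x = g' x) -> L U g -> L U g',
      forall (U V : set 'rV[R]_n) g, open_in_orthant V -> V `<=` U -> L U g -> L V g,
      forall (U : set 'rV[R]_n) g, L U g -> rcontR U g
    & forall (U : set 'rV[R]_n) g, open_in_orthant U ->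
        (forall y, U y -> exists V : set 'rV[R]_n, [/\ V y, V `<=` U & L V g]) -> L U g].

Lemma gen_model : local_model gen.
Proof.
split.
- by move=> U g [].
- exact: gen_ext.
- exact: gen_sub.
- by move=> U g [_ /within_contP].
- exact: gen_glue.
Qed.

Lemma std_model : local_model std.
Proof.
split.
- by move=> U g [].
- exact: std_ext.
- exact: std_sub.
- exact: std_rcontR.
- exact: std_glue.
Qed.

(** The expression of [f] in the coordinates [phi] over [D], extended by 0. *)
Definition push phi D f : 'rV[R]_n -> R := fun y =>
  xget 0 [set v | exists2 a, D a & phi a = y /\ f a = v].

Lemma pushE phi D f a : {in D &, injective phi} -> D a -> push phi D f (phi a) = f a.
Proof.
move=> inj Da; rewrite /push; case: xgetP => [v -> [b Db [ab <-]]|/(_ (f a))]; last first.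
  by case; exists a.
by congr f; apply: inj => //; exact: mem_set.
Qed.

Definition trans phi psi D : 'rV[R]_n -> 'rV[R]_n := fun y =>
  \row_k push phi D (fun a => psi a ord0 k) y.

Lemma transE phi psi D a : {in D &, injective phi} -> D a -> trans phi psi D (phi a) = psi a.
Proof. by move=> inj Da; apply/rowP => k; rewrite mxE pushE. Qed.

Lemma chart_nbhs L O W phi a d : is_chart L O W phi -> W a -> 0 < d ->
  exists N, [/\ open N, N a, N `<=` W & forall b, N b -> rclose d (phi b) (phi a)].
Proof.
move=> [oW cW _ _ _] Wa d0; move: cW; rewrite continuous_open_subspace// => cW.
have := cW a (mem_set Wa); move/(_ [set y | rclose d y (phi a)]).
have nb : nbhs (phi a) [set y | rclose d y (phi a)] by apply/near_rowP; exists d.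
move=> /(_ nb); rewrite nbhsE => -[N [oN Na] NP].
exists (N `&` W); split.
- exact: openI.
- by [].
- by move=> b [].
- by move=> b [/NP].
Qed.

Lemma chart_sub L O W phi D : local_model L -> is_chart L O W phi -> open D -> D `<=` W ->
  is_chart L O D phi.
Proof.
move=> mL [oW cW inj oim sec] oD DW; split=> //.
- by apply: continuous_subspaceW cW.
- by move=> a b /set_mem/DW/mem_set aW /set_mem/DW/mem_set bW; exact: inj.
- by move=> U oU UD; apply: oim => //; exact: subset_trans UD DW.
- by move=> U f oU UD; apply: sec => //; exact: subset_trans UD DW.
Qed.

Lemma trans_homeo L O D phi psi : is_chart L O D phi -> is_chart L O D psi ->
  homeo (phi @` D) (psi @` D) (trans phi psi D) (trans psi phi D).
Proof.
move=> c1 c2; have [oD _ inj1 oim1 _] := c1; have [_ _ inj2 oim2 _] := c2.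
have half L' O' (ph ps : M -> 'rV[R]_n) : is_chart L' O' D ph -> is_chart L' O' D ps ->
    rcont (ph @` D) (trans ph ps D).
  move=> d1 d2; have [_ _ i1 o1 _] := d1; have [_ _ i2 o2 _] := d2.
  move=> _ [a Da <-] e e0; have [N [oN Na ND hN]] := chart_nbhs d2 Da e0.
  have /open_in_orthantP[_ /(_ (ph a))] := o1 N oN ND.
  case; first by exists a.
  move=> r r0 hr; exists r => // x xa [b Db bx]; move: xa; rewrite -bx => xa; rewrite !transE//.
  have ob : orthant (ph b).
    by apply: (open_in_orthant_sub (o1 D oD (@subset_refl _ _))); exists b.
  have [c Nc cb] := hr _ xa ob.
  by have <- : c = b; [apply: i1 => //; apply: mem_set => //; exact: ND|exact: hN].
split.
- by move=> _ [a Da <-]; exists a => //; rewrite transE.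
- by move=> _ [a Da <-]; exists a => //; rewrite transE.
- by move=> _ [a Da <-]; rewrite !transE.
- by move=> _ [a Da <-]; rewrite !transE.
- by split; [exact: half c1 c2|exact: half c2 c1].
Qed.

Lemma trans_pull L O D phi psi g : local_model L -> is_chart L O D phi -> is_chart L O D psi ->
  L (psi @` D) g -> L (phi @` D) (g \o trans phi psi D).
Proof.
move=> mL c1 c2 Lg; have [_ ext _ _ _] := mL.
have [oD _ inj1 _ sec1] := c1; have [_ _ inj2 _ sec2] := c2.
have : O D (g \o psi) by apply/(sec2 D _ oD (@subset_refl _ _)); exists g.
move=> /(sec1 D _ oD (@subset_refl _ _))[g' Lg' gg'].
apply: ext Lg' => _ [a Da <-] /=; rewrite transE//.
by have /= -> := gg' a (mem_set Da).
Qed.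

Lemma chart_oio L O W phi D : is_chart L O W phi -> open D -> D `<=` W -> open_in_orthant (phi @` D).
Proof. by move=> [_ _ _ h _]; exact: h. Qed.

Lemma chart_orthant L O W phi a : is_chart L O W phi -> W a -> orthant (phi a).
Proof.
move=> [oW _ _ h _] Wa; apply: (open_in_orthant_sub (h W oW (@subset_refl _ _))); by exists a.
Qed.

Lemma std_trans_map O D phi psi : is_chart std O D phi ->
  is_chart std O D psi -> std_map (phi @` D) (trans phi psi D).
Proof.
move=> c1 c2 i; apply: (trans_pull (g := fun x => x ord0 i) std_model c1 c2).
apply: std_coord; have [oD _ _ h _] := c2; exact: h.
Qed.

Lemma gen_trans_map O D phi psi : is_chart gen O D phi ->
  is_chart gen O D psi -> gen_pow_map (phi @` D) (trans phi psi D).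
Proof.
move=> c1 c2 i c c0; apply: (trans_pull (g := fun x => x ord0 i `^ c) gen_model c1 c2).
apply: gen_coord_pow => //; have [oD _ _ h _] := c2; exact: h.
Qed.

(** The coordinates of one chart and all their positive powers are sections,
    hence generalized analytic in the other chart. *)
Lemma gen_chart_card G W W' phi psi a : is_chart gen G W phi ->
  is_chart gen G W' psi -> W a -> W' a -> #|zeros (phi a)| = #|zeros (psi a)|.
Proof.
move=> c1 c2 Wa W'a; have [oW _ _ _ _] := c1; have [oW' _ _ _ _] := c2.
have oD : open (W `&` W') by exact: openI.
have d1 := chart_sub gen_model c1 oD (@subIsetl _ _ _).
have d2 := chart_sub gen_model c2 oD (@subIsetr _ _ _).
have [_ _ inj _ _] := d1.
have := @gen_card R n _ _ _ _ (chart_oio d1 oD (@subset_refl _ _))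
  (chart_oio d2 oD (@subset_refl _ _)) (trans_homeo d1 d2) (gen_trans_map d1 d2) (gen_trans_map d2 d1).
by move=> /(_ (phi a)); rewrite transE// => -> //; exists a.
Qed.

Lemma edim_gen G W phi a : is_chart gen G W phi -> W a ->
  edim gen G a = #|zeros (phi a)|.
Proof.
move=> c Wa; rewrite /edim; case: xgetP => [k -> [W' [psi [c' W'a ->]]]|/(_ #|zeros (phi a)|)].
  by rewrite (gen_chart_card c c' Wa W'a) /zeros cardsE.
by case; exists W, phi; split=> //; rewrite /zeros cardsE.
Qed.

Lemma within_eq_cont U f f' : open U -> (forall a, U a -> f a = f' a) ->
  {within U, continuous f} -> {within U, continuous f'}.
Proof.
move=> oU ff; rewrite !continuous_open_subspace// => h a Ua.
have := h a Ua; rewrite /continuous_at -(ff a (set_mem Ua)); apply: cvg_trans.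
apply: near_eq_cvg; move: (set_mem Ua) => Ua'.
have := open_nbhs_nbhs (conj oU Ua'); apply: filterS => b Ub; exact: ff.
Qed.

Lemma chart_comp_cont L O W phi D g : is_chart L O W phi -> open D -> D `<=` W ->
  rcontR (phi @` D) g -> {within D, continuous (g \o phi)}.
Proof.
move=> c oD DW cg; rewrite continuous_open_subspace// => a /set_mem Da.
apply/cvgrPdist_lt => e e0.
have [d d0 hd] := cg (phi a) (imageP _ Da) e e0.
have [N [oN Na NW hN]] := chart_nbhs c (DW a Da) d0.
have : open_nbhs a (N `&` D) by split; [exact: openI|].
move=> /open_nbhs_nbhs; apply: filterS => b [Nb Db] /=; rewrite distrC; apply: hd; first exact: hN.
by exists b.
Qed.

(** The sections of [G] are by definition generalized analytic in every
    standard chart; conversely a function which is so in one chart is so in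
    all of them because transitions between standard charts are standard
    isomorphisms. *)
Lemma std_chart_gen G O W phi : enrichment n O = G -> is_chart std O W phi ->
  is_chart gen G W phi.
Proof.
move=> OG c; have [oW cW inj oim sec] := c; split=> // U f oU UW; split.
  rewrite -OG => -[_ _ /(_ W phi c)[g gg fg]]; exists g.
    by move: gg; rewrite (setIidl UW).
  by move=> a Ua; apply: fg; rewrite (setIidl UW).
move=> [g gg fg]; rewrite -OG; split=> //.
  apply: (@within_eq_cont _ (g \o phi)) => //.
    by move=> a Ua; rewrite fg//; exact: mem_set.
  by apply: (chart_comp_cont c) => //; have [_ /within_contP] := gg.
move=> W' psi c'; have [oW' _ _ _ _] := c'.
have oD : open (U `&` W') by exact: openI.
have DU : U `&` W' `<=` U by exact: subIsetl.
have d1 := chart_sub std_model c oD (subset_trans DU UW).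
have d2 := chart_sub std_model c' oD (@subIsetr _ _ _).
have o1 := chart_oio d1 oD (@subset_refl _ _).
have o2 := chart_oio d2 oD (@subset_refl _ _).
exists (g \o trans psi phi (U `&` W')).
  apply: (gen_comp_std o2 o1 (trans_homeo d2 d1) (std_trans_map d2 d1) (std_trans_map d1 d2)).
  by apply: gen_sub gg => // _ [a [Ua _] <-]; exists a.
move=> a /set_mem Da /=; rewrite transE//; last by case: d2.
by rewrite fg//; apply: mem_set; case: Da.
Qed.

(** Every chart of a standardization is a chart of the generalized manifold,
    and there the number of zeros is independent of the chart. So both
    structures have the same strata, corner points and open sets V*_p. *)
Lemma edim_std G O : standardization n G O -> edim std O = edim gen G.
Proof.
move=> [_ [_ _ _ ch] OG]; apply/funext => a; have [W [phi [c Wa]]] := ch a.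
rewrite {1}/edim; case: xgetP => [k -> [W' [psi [c' W'a ->]]]|/(_ #|zeros (phi a)|)].
  by rewrite (edim_gen (std_chart_gen OG c') W'a) /zeros cardsE.
by case; exists W, phi; split=> //; rewrite /zeros cardsE.
Qed.

Lemma strata_std G O : standardization n G O ->
  [/\ corner std O = corner gen G &
      forall p, vstar std O p = vstar gen G p].
Proof.
by move=> /edim_std E; split=> [|p]; rewrite /corner /vstar /stratum_closures /stratum_of E.
Qed.

Lemma pw_chart G W phi ga : (forall i, 0 < ga i) -> is_chart gen G W phi ->
  is_chart gen G W (pw ga \o phi).
Proof.
move=> g0 c; have [oW cW inj oim sec] := c.
have gi0 i : 0 < (ga i)^-1 by rewrite invr_gt0.
have Wo a : W a -> orthant (phi a) by exact: chart_orthant c.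
have imE U : (pw ga \o phi) @` U = pw ga @` (phi @` U) by rewrite image_comp.
split=> //.
- rewrite continuous_open_subspace// => a /set_mem Wa N /near_rowP[e e0 hN].
  have [d d0 hd] := pw_rcont g0 (chart_oio c oW (@subset_refl _ _)) (imageP phi Wa) e0.
  have [N' [oN' N'a N'W hN']] := chart_nbhs c Wa d0.
  rewrite /= nbhsE; exists N' => // b N'b /=; apply: hN; apply: hd; first exact: hN'.
  by exists b => //; exact: N'W.
- move=> a b aW bW /= E; apply: inj => //.
  by rewrite -(pwK g0 (Wo a (set_mem aW))) E pwK//; apply: Wo; exact: set_mem.
- by move=> U oU UW; rewrite imE; apply: pw_open => //; exact: oim.
(* Sections correspond because both the power map and its inverse preserve
   generalized analytic functions. *)
- move=> U f oU UW; have s := sec U f oU UW; have oi := oim U oU UW.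
  split=> [/s[g gg fg]|[g gg fg]].
    exists (g \o pw (fun i => (ga i)^-1)).
      rewrite imE; apply: gen_pw gg => //; first exact: pw_open.
      move=> _ [_ [a Ua <-] <-]; have oa : orthant (phi a) by apply: Wo; exact: UW.
      by rewrite pwK//; exists a.
    move=> a Ua; have oa : orthant (phi a) by apply: Wo; apply: UW; exact: set_mem.
    by rewrite fg//= pwK.
  apply/s; exists (g \o pw ga) => //.
  by apply: gen_pw gg => // _ [a Ua <-]; rewrite imE; exists (phi a) => //; exists a.
Qed.

Lemma pw_image W phi ga : (forall i, 0 < ga i) -> phi @` W = @orthant R n ->
  (pw ga \o phi) @` W = @orthant R n.
Proof.
move=> g0 im; apply/seteqP; split=> [_ [a _ <-]|y oy]; first exact: pw_orthant.
have gi0 i : 0 < (ga i)^-1 by rewrite invr_gt0.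
have : (phi @` W) (pw (fun i => (ga i)^-1) y) by rewrite im; exact: pw_orthant.
move=> [a Wa aE]; exists a => //=; rewrite aE.
have := pwK gi0 oy; congr (_ = _).
by apply/rowP => i; rewrite !mxE invrK.
Qed.

End Charts.

(** * Exponents of a monomial atlas *)

Section Powers.
Variable R : realType.
Implicit Types t K A B : R.

Lemma powR_exponent_eq K K' A B t0 : 0 < K -> 0 < K' -> 0 < t0 ->
  (forall t, 0 < t -> t <= t0 -> K * t `^ A = K' * t `^ B) -> A = B.
Proof.
move=> K0 K'0 t00 h; have t2 : 0 < t0 / 2 by rewrite divr_gt0.
have t2le : t0 / 2 <= t0 by rewrite ler_pdivrMr// ler_pMr// ler1n.
have lnE t : 0 < t -> t <= t0 -> ln K + A * ln t = ln K' + B * ln t.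
  move=> tp tle; have := congr1 (@ln R) (h t tp tle).
  by rewrite !lnM ?posrE ?powR_gt0// !ln_powR.
have e1 := lnE _ t00 (lexx _); have e2 := lnE _ t2 t2le.
have : ln t0 - ln (t0 / 2) != 0.
  rewrite -ln_div ?posrE// invfM invrK mulrA divff ?mul1r; last by rewrite gt_eqF.
  by rewrite gt_eqF// ln_gt0// ltr1n.
move=> ne; apply/eqP; rewrite -subr_eq0; apply/eqP.
apply: (mulIf ne); rewrite mul0r; move: e1 e2.
move: (ln t0) (ln (t0 / 2)) (ln K) (ln K') => u v k k' e1 e2.
have -> : (A - B) * (u - v) = (k + A * u - (k' + B * u)) - (k + A * v - (k' + B * v)) by ring.
by rewrite e1 e2; ring.
Qed.

(** A power with exponent below 1 is not Lipschitz at 0. *)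
Lemma powR_exponent_ge1 K B A t0 : 0 < K -> 0 < t0 ->
  (forall t, 0 < t -> t <= t0 -> K * t `^ A <= B * t) -> 1 <= A.
Proof.
move=> K0 t00 h; rewrite leNgt; apply/negP => A1.
have A0 : 0 < 1 - A by rewrite subr_gt0.
have B1 : 0 < `|B| + 1 by rewrite ltr_wpDl.
have K2 : 0 < K / 2 by rewrite divr_gt0.
have [d d0 hd] := small_and (small_const t00) (small_pow A0 ltr01 B1 K2).
have [tt0 ht] := hd d d0 (lexx _); rewrite mulr1 in ht.
have := h d d0 tt0; have dE : d = d `^ A * d `^ (1 - A).
  by rewrite -powRD; [rewrite subrKC powRr1// ltW|rewrite (gt_eqF d0) implybT].
rewrite {2}dE mulrC mulrCA ler_pM2l ?powR_gt0//.
rewrite mulrC => h1; have p0 : 0 < d `^ (1 - A) by rewrite powR_gt0.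
have h2 : d `^ (1 - A) * B <= d `^ (1 - A) * (`|B| + 1).
  by rewrite ler_wpM2l ?(ltW p0)// (le_trans (ler_norm B))// lerDl.
by have := le_trans h1 (le_trans h2 ht); lra.
Qed.

End Powers.

Section Strata.
Variables (R : realType) (n : nat) (M : topologicalType) (G : presheaf R M).
Variables (I : finType) (E : I -> set M) (x : atlas R M I).
Local Notation gen := (@gen_analytic R n).
Hypothesis hM : monomial_manifold gen G E x.
Implicit Types (p q a b : M) (i j : I) (sg : 'I_n -> I) (D : set M).

Local Notation cor := (corner gen G).
Local Notation Vs := (vstar gen G).
Definition coordmap (y : coord_family R M I) sg a : 'rV[R]_n := \row_k y (sg k) a.

(** The orderings of the coordinates at [p] that give a chart; affine charts
    come without a preferred one. *)
Definition chart_ordering p sg := [/\ injective sg, range sg = [set i | E i p],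
  is_chart gen G (Vs p) (coordmap (x p) sg)
  & coordmap (x p) sg @` Vs p = @orthant R n].

Lemma x_affine p : cor p -> affine_chart gen G E p (x p).
Proof. by have [_ _ _ _ [_ h _ _]] := hM; exact: h. Qed.

Lemma ordering_ex p : cor p -> exists sg, chart_ordering p sg.
Proof. by move=> /x_affine[_ _ _ [sg [h1 h2 h3 h4]]]; exists sg. Qed.

Lemma vstar_open p : cor p -> open (Vs p).
Proof. by move=> /ordering_ex[sg [_ _ [h _ _ _ _] _]]. Qed.

Lemma ordering_index p sg i : chart_ordering p sg -> E i p -> exists k, sg k = i.
Proof.
by move=> [_ rg _ _] Ei; have : range sg i by [rewrite rg]; move=> [k _ <-]; exists k.
Qed.

Lemma ordering_E p sg (m : 'I_n) : chart_ordering p sg -> E (sg m) p.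
Proof. by move=> [_ rg _ _]; have : range sg (sg m) by [exists m]; rewrite rg. Qed.

Lemma x_ge0 p i a : cor p -> E i p -> Vs p a -> 0 <= x p i a.
Proof.
move=> cp Ei Va; have [sg gd] := ordering_ex cp; have [k ki] := ordering_index gd Ei.
have [_ _ ch _] := gd; have := chart_orthant ch Va k.
by rewrite mxE ki.
Qed.

Lemma x_zero p i a : cor p -> E i p -> Vs p a -> (E i a <-> x p i a = 0).
Proof. by move=> /x_affine[_ h _ _] Ei; exact: h. Qed.

Lemma vstar_cover a : exists2 p, cor p & Vs p a.
Proof. by have [_ _ _ _ [_ _ h _]] := hM; exact: h. Qed.

Lemma generic_point i : exists s : M,
  E i = closure (stratum_of gen G s) /\ edim gen G s = 1%N.
Proof.
have [_ _ [_ rg] _ _] := hM.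
have : range E (E i) by exists i.
by rewrite rg => -[s /= es <-]; exists s.
Qed.

(** A point of the open stratum whose closure is [E i]. Changes of coordinates
    are compared along curves that start there. *)
Definition generic_pt i : M := sval (cid (generic_point i)).

Lemma generic_ptE i : E i = closure (stratum_of gen G (generic_pt i)).
Proof. by rewrite /generic_pt; case: cid => s []. Qed.

Lemma generic_edim i : edim gen G (generic_pt i) = 1%N.
Proof. by rewrite /generic_pt; case: cid => s []. Qed.

(** This is why V*_p and V*_q both contain the open stratum of any component
    through [p] and [q], so that the change of coordinates can be examined
    there. *)
Lemma vstar_generic p i : E i p <-> Vs p (generic_pt i).
Proof. by rewrite {1}generic_ptE. Qed.

Lemma generic_in i : E i (generic_pt i).
Proof.
rewrite {1}generic_ptE; apply: subset_closure; rewrite /stratum_of.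
exact: connected_component_refl.
Qed.

Lemma vstar_self p : cor p -> Vs p p.
Proof.
move=> cp; apply: subset_closure; rewrite /stratum_of.
exact: connected_component_refl.
Qed.

(** The open set V*_q meets the open stratum dense in [E j], and then contains
    it. *)
Lemma corner_of_meet q j a : cor q -> E j a -> Vs q a -> E j q.
Proof.
move=> cq Ea Va; rewrite generic_ptE in Ea.
have nb : nbhs a (Vs q) by apply: open_nbhs_nbhs; split; [exact: vstar_open|].
have [b [Sb Vb]] := Ea _ nb; rewrite generic_ptE; move: Vb; rewrite /vstar /=.
suff -> : stratum_of gen G b = stratum_of gen G (generic_pt j) by [].
rewrite /stratum_of; have e : edim gen G b = edim gen G (generic_pt j).
  by have := connected_component_sub Sb.
by rewrite e; apply/esym/same_connected_component.
Qed.

Lemma component_corner i : exists p, cor p /\ E i p.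
Proof. by have [p cp /vstar_generic Ep] := vstar_cover (generic_pt i); exists p. Qed.

(** There exactly one coordinate vanishes, as the number of zeros is that of
    any chart. *)
Lemma x_generic p i : cor p -> E i p -> x p i (generic_pt i) = 0 /\
  forall j, E j p -> j != i -> 0 < x p j (generic_pt i).
Proof.
move=> cp Ei; have Va : Vs p (generic_pt i) by apply/vstar_generic.
have xi0 : x p i (generic_pt i) = 0 by apply/(x_zero cp Ei Va); exact: generic_in.
split=> // j Ej ji; have [sg gd] := ordering_ex cp; have [inj _ ch _] := gd.
have [k ki] := ordering_index gd Ei; have [m mj] := ordering_index gd Ej.
have := edim_gen ch Va; rewrite generic_edim => /esym/eqP/cards1P[m0 zE].
have km0 : k \in zeros (coordmap (x p) sg (generic_pt i)) by rewrite inE mxE ki xi0.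
rewrite zE inE in km0.
rewrite lt_neqAle eq_sym x_ge0// andbT; apply: contra ji => /eqP xj0.
have : m \in zeros (coordmap (x p) sg (generic_pt i)) by rewrite inE mxE mj xj0.
by rewrite zE inE => /eqP mm0; rewrite -mj -ki (eqP km0) mm0.
Qed.

(** A curve through the stratum of [generic_pt i], along which [x p i] is the
    parameter and the other coordinates at [p] are constant. *)
Lemma transversal_curve p i D : cor p -> E i p -> open D -> D (generic_pt i) -> D `<=` Vs p ->
  exists2 t0, 0 < t0 & forall t, 0 < t -> t <= t0 -> exists b,
    [/\ D b, x p i b = t & forall j, E j p -> j != i -> x p j b = x p j (generic_pt i)].
Proof.
move=> cp Ei oD Da DV; have [sg gd] := ordering_ex cp; have [inj _ ch _] := gd.
have [m mi] := ordering_index gd Ei; have [xi0 _] := x_generic cp Ei.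
set c := coordmap (x p) sg (generic_pt i).
have oc : orthant c by apply: (chart_orthant ch); exact: DV.
have /open_in_orthantP[_ /(_ c)] := chart_oio ch oD DV; case; first by exists (generic_pt i).
move=> r r0 hr; exists (r / 2); first by rewrite divr_gt0.
move=> t t0 tr; have [|b Db bE] := hr (bump c [set m]%SET t) _ (bump_orthant _ oc (ltW t0)).
  apply: bump_rclose; first exact: ltW.
  by apply: le_lt_trans tr _; exact: half_lt.
have bk k : x p (sg k) b = x p (sg k) (generic_pt i) + t * (k == m)%:R.
  by move/rowP: bE => /(_ k); rewrite !mxE inE.
exists b; split=> //; first by rewrite -mi bk eqxx mulr1 mi xi0 add0r.
move=> j Ej ji; have [k kj] := ordering_index gd Ej; rewrite -kj bk.
by case: eqP => [km|_]; [move: ji; rewrite -kj km mi eqxx|rewrite mulr0 addr0].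
Qed.

Lemma exponents p q : exists C : I -> I -> R, cor p -> cor q ->
  forall i, E i q -> forall a, Vs p a -> Vs q a ->
  x q i a = \prod_(j : I | `[< E j p >]) (x p j a `^ C i j).
Proof.
have [_ _ _ _ [_ _ _ h]] := hM; have [[cp cq]|nc] := pselect (cor p /\ cor q).
  by have [C hC] := h p q cp cq; exists C.
by exists (fun _ _ => 0) => cp cq; case: nc.
Qed.

(** The diagonal entry at [i] is the order of contact of the two coordinates
    that define [E i]; the other entries in its column vanish. *)
Definition transfer_exp p q : I -> I -> R := sval (cid (exponents p q)).

Lemma transfer_expE p q : cor p -> cor q -> forall i, E i q -> forall a, Vs p a -> Vs q a ->
  x q i a = \prod_(j : I | `[< E j p >]) (x p j a `^ transfer_exp p q i j).
Proof. by rewrite /transfer_exp; case: cid. Qed.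

(** Otherwise the coordinate [x q k] would vanish at the generic point of [E
    i]. *)
Lemma transfer_exp_off p q i k : cor p -> cor q -> E i p -> E i q -> E k q -> k != i -> transfer_exp p q k i = 0.
Proof.
move=> cp cq Eip Eiq Ekq ki; have [xi0 _] := x_generic cp Eip; have [_ h] := x_generic cq Eiq.
have := h k Ekq ki; rewrite (transfer_expE cp cq Ekq (iffLR (vstar_generic _ _) Eip) (iffLR (vstar_generic _ _) Eiq)).
rewrite (bigD1 i)/=; last by apply/asboolP.
rewrite xi0; have [//|Cn] := eqVneq (transfer_exp p q k i) 0.
by rewrite powR0// mul0r ltxx.
Qed.

Definition transfer_coef p q i : R := \prod_(j : I | `[< E j p >] && (j != i)) (x p j (generic_pt i) `^ transfer_exp p q i j).

Lemma transfer_coef_gt0 p q i : cor p -> E i p -> 0 < transfer_coef p q i.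
Proof.
move=> cp Ei; apply: prodr_gt0 => j /andP[/asboolP Ej ji]; rewrite powR_gt0//.
by have [_ ->] := x_generic cp Ei.
Qed.

(** Along a transversal curve only [x p i] varies, so the change of
    coordinates is a constant times a power. *)
Lemma transfer_along p q i b : cor p -> cor q -> E i p -> E i q -> Vs p b -> Vs q b ->
  (forall j, E j p -> j != i -> x p j b = x p j (generic_pt i)) ->
  x q i b = transfer_coef p q i * x p i b `^ transfer_exp p q i i /\
  forall k, E k q -> k != i -> x q k b = x q k (generic_pt i).
Proof.
move=> cp cq Eip Eiq Vpb Vqb hb; have Vp := iffLR (vstar_generic _ _) Eip.
have Vq := iffLR (vstar_generic _ _) Eiq; split.
  rewrite (transfer_expE cp cq Eiq Vpb Vqb) (bigD1 i)/=; last by apply/asboolP.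
  rewrite mulrC; congr (_ * _); apply: eq_bigr => j /andP[/asboolP Ej ji].
  by rewrite hb.
move=> k Ek ki; rewrite (transfer_expE cp cq Ek Vpb Vqb) (transfer_expE cp cq Ek Vp Vq).
apply: eq_bigr => j /asboolP Ej; have [->|ji] := eqVneq j i; last by rewrite hb.
by rewrite transfer_exp_off// !powRr0.
Qed.

(** A nonpositive exponent would keep [x q i] away from 0 along a curve that
    tends to a point of [E i]. *)
Lemma transfer_exp_gt0 p q i : cor p -> cor q -> E i p -> E i q -> 0 < transfer_exp p q i i.
Proof.
move=> cp cq Eip Eiq; have Vp := iffLR (vstar_generic _ _) Eip; have Vq := iffLR (vstar_generic _ _) Eiq.
have [xq0 _] := x_generic cq Eiq; have [xp0 _] := x_generic cp Eip; have K0 := transfer_coef_gt0 q cp Eip.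
rewrite ltNge; apply/negP => C0.
have [sg gd] := ordering_ex cq; have [_ _ ch _] := gd; have [m mi] := ordering_index gd Eiq.
have [N [oN Na NV hN]] := chart_nbhs ch Vq K0.
have oD : open (Vs p `&` N) by apply: openI => //; exact: vstar_open.
have [t0 t00 ht] := transversal_curve cp Eip oD (conj Vp Na) (@subIsetl _ _ _).
pose t := Num.min t0 1; have tp : 0 < t by rewrite lt_min t00 ltr01.
have [|b [[Vpb Nb] bt hb]] := ht t tp; first by rewrite /t ge_min lexx.
have [bE _] := transfer_along cp cq Eip Eiq Vpb (NV b Nb) hb.
have := hN b Nb m; rewrite !mxE mi xq0 subr0 bE bt.
rewrite ger0_norm ?mulr_ge0 ?powR_ge0 ?(ltW K0)//.
rewrite -[X in _ < X]mulr1 ltr_pM2l// ltNge => /negP; apply.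
rewrite -(powRr0 t); apply: ger_powR => //; rewrite tp.
by rewrite /t ge_min lexx orbT.
Qed.

(** Compare the two expressions of [x r i] along a curve transversal at [p]. *)
Lemma transfer_exp_cocycle p q r i : cor p -> cor q -> cor r -> E i p -> E i q -> E i r ->
  transfer_exp p r i i = transfer_exp p q i i * transfer_exp q r i i.
Proof.
move=> cp cq cr Ep Eq Er; have Vp := iffLR (vstar_generic _ _) Ep.
have Vq := iffLR (vstar_generic _ _) Eq; have Vr := iffLR (vstar_generic _ _) Er.
have oD : open (Vs p `&` (Vs q `&` Vs r)) by apply: openI; [exact: vstar_open|apply: openI; exact: vstar_open].
have [t0 t00 ht] := transversal_curve cp Ep oD (conj Vp (conj Vq Vr)) (@subIsetl _ _ _).
apply: (@powR_exponent_eq R (transfer_coef p r i) (transfer_coef q r i * transfer_coef p q i `^ transfer_exp q r i i) _ _ t0) => //.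
- exact: transfer_coef_gt0.
- by rewrite mulr_gt0 ?powR_gt0// transfer_coef_gt0.
move=> t tp tle; have [b [[Vpb [Vqb Vrb]] bt hb]] := ht t tp tle.
have [e1 _] := transfer_along cp cr Ep Er Vpb Vrb hb.
have [e2 h2] := transfer_along cp cq Ep Eq Vpb Vqb hb.
have [e3 _] := transfer_along cq cr Eq Er Vqb Vrb h2.
rewrite -{1}bt -e1 e3 e2 bt powRM ?powR_ge0 ?(ltW (transfer_coef_gt0 _ _ _))// -powRrM mulrA//.
Qed.

Lemma transfer_exp_refl p i : cor p -> E i p -> transfer_exp p p i i = 1.
Proof.
move=> cp Ei; have h := transfer_exp_cocycle cp cp cp Ei Ei Ei; have := transfer_exp_gt0 cp cp Ei Ei.
move=> c0; apply: (mulfI (lt0r_neq0 c0)); by rewrite -h mulr1.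
Qed.

End Strata.

(** * The standard structure of a compatible family of exponents *)

Section Construction.
Variables (R : realType) (n : nat) (M : topologicalType) (G : presheaf R M).
Variables (I : finType) (E : I -> set M) (x : atlas R M I).
Hypothesis hM : monomial_manifold (@gen_analytic R n) G E x.
Implicit Types (p q a b : M) (i j : I) (sg ta : 'I_n -> I) (D U : set M).

Local Notation cor := (corner (@gen_analytic R n) G).
Local Notation Vs := (vstar (@gen_analytic R n) G).
Local Notation chart_ordering := (@chart_ordering R n M G I E x).
Local Notation cmap := (@coordmap R n M I).
Local Notation gen := (@gen_analytic R n).
Local Notation std := (@std_analytic R n).

(** The atlas of local m-standardizations with exponents [al], extended by 0
    as in the definition of an affine chart. *)
Definition power_atlas (al : M -> I -> R) : atlas R M I := fun p i a =>
  if `[< cor p /\ E i p /\ Vs p a >] then x p i a `^ al p i else 0.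

Lemma power_atlasE al p i a : cor p -> E i p -> Vs p a ->
  power_atlas al p i a = x p i a `^ al p i.
Proof. by move=> cp Ei Va; rewrite /power_atlas; case: asboolP => // -[]. Qed.

Lemma coordmap_power al p sg a : cor p -> chart_ordering p sg -> Vs p a ->
  cmap (power_atlas al p) sg a = pw (fun m => al p (sg m)) (cmap (x p) sg a).
Proof.
move=> cp gd Va; apply/rowP => m; rewrite !mxE power_atlasE//; exact: ordering_E gd.
Qed.

Lemma chart_ext (L : presheaf R 'rV[R]_n) (O : presheaf R M) W (phi psi : M -> 'rV[R]_n) :
  (forall a, W a -> phi a = psi a) -> is_chart L O W phi -> is_chart L O W psi.
Proof.
move=> e [oW cW inj oim sec].
have imE U : U `<=` W -> psi @` U = phi @` U.
  move=> UW; apply/seteqP; split=> _ [a Ua <-]; exists a => //; first exact/e/UW.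
  exact/esym/e/UW.
split=> //.
- rewrite continuous_open_subspace// => a /set_mem Wa.
  move: cW; rewrite continuous_open_subspace// => /(_ a (mem_set Wa)).
  rewrite /continuous_at -(e a Wa); apply: cvg_trans; apply: near_eq_cvg.
  have := open_nbhs_nbhs (conj oW Wa); apply: filterS => b Wb; exact: e.
- move=> a b aW bW; rewrite -!e; [exact: inj|exact: set_mem..].
- by move=> U oU UW; rewrite imE//; exact: oim.
- move=> U f oU UW; rewrite imE//; split=> [/(sec U f oU UW)[g Lg fg]|[g Lg fg]].
    by exists g => // a Ua /=; rewrite -e ?fg//; exact/UW/set_mem.
  apply/(sec U f oU UW); exists g => // a Ua /=; rewrite fg//= e//; exact/UW/set_mem.
Qed.

Lemma image_ext W (phi psi : M -> 'rV[R]_n) : (forall a, W a -> phi a = psi a) ->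
  psi @` W = phi @` W.
Proof.
by move=> e; apply/seteqP; split=> _ [a Wa <-]; exists a => //; rewrite e.
Qed.

Lemma power_chart al p sg : (forall p i, 0 < al p i) -> cor p -> chart_ordering p sg ->
  is_chart gen G (Vs p) (cmap (power_atlas al p) sg) /\
  cmap (power_atlas al p) sg @` Vs p = @orthant R n.
Proof.
move=> al0 cp gd; have [_ _ ch im] := gd.
have e a : Vs p a -> (pw (fun m => al p (sg m)) \o cmap (x p) sg) a = cmap (power_atlas al p) sg a.
  by move=> Va; rewrite coordmap_power.
split; first by apply: chart_ext e _; apply: pw_chart.
by rewrite (image_ext e); apply: pw_image.
Qed.

Lemma power_affine (L : presheaf R 'rV[R]_n) (O : presheaf R M) al p sg :
  (forall p i, 0 < al p i) -> cor p -> chart_ordering p sg -> vstar L O p = Vs p ->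
  is_chart L O (Vs p) (cmap (power_atlas al p) sg) -> affine_chart L O E p (power_atlas al p).
Proof.
move=> al0 cp gd VE ch; rewrite /affine_chart VE; split.
- move=> i a h; rewrite /power_atlas; case: asboolP => // -[_ [h1 h2]].
  by case: h.
- move=> i Ei a Va; rewrite power_atlasE//; rewrite (x_zero hM cp Ei Va); split=> [->|].
    by rewrite powR0// gt_eqF.
  exact: powR_eq0_eq0.
- move=> i Ei; have Vp : Vs p p by exact: vstar_self.
  have [_ _ h _] := x_affine hM cp.
  by rewrite power_atlasE// h// powR0// gt_eqF.
- exists sg; have [_ im] := power_chart al0 cp gd; have [inj rg _ _] := gd.
  by split.
Qed.

Lemma prod_reindex p sg (F : I -> R) : chart_ordering p sg ->
  \prod_(j : I | `[< E j p >]) F j = \prod_m F (sg m).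
Proof.
move=> gd; have [inj rg _ _] := gd.
transitivity (\prod_(j in [set sg m | m in [set: 'I_n]]%SET) F j).
  apply: eq_bigl => j; apply/asboolP/imsetP => [Ej|[m _ ->]]; last exact: ordering_E gd.
  by have [m mj] := ordering_index gd Ej; exists m; rewrite ?inE.
rewrite big_imset/=; last by move=> ? ? _ _; exact: inj.
by apply: eq_bigl => m; rewrite inE.
Qed.

Variable al : M -> I -> R.
Hypothesis al0 : forall p i, 0 < al p i.
Hypothesis al_rel : forall p q i, cor p -> cor q -> E i p -> E i q ->
  al q i * transfer_exp hM p q i i = al p i.

Local Notation u := (power_atlas al).

Lemma power_change p q i a : cor p -> cor q -> E i q -> Vs p a -> Vs q a ->
  u q i a = \prod_(j : I | `[< E j p >]) (u p j a `^ (transfer_exp hM p q i j * al q i / al p j)).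
Proof.
move=> cp cq Ei Va Vb; rewrite power_atlasE// (transfer_expE hM cp cq Ei Va Vb).
have -> : forall (F : I -> R) c, (forall j, E j p -> 0 <= F j) ->
    (\prod_(j : I | `[< E j p >]) F j) `^ c = \prod_(j : I | `[< E j p >]) (F j `^ c).
  move=> F c F0; apply: (big_rec2 (fun y z => 0 <= y /\ y `^ c = z) _ _).2.
    by rewrite powR1.
  move=> j y z /asboolP Ej [y0 <-]; split; first by rewrite mulr_ge0// F0.
  by rewrite powRM// F0.
  apply: eq_bigr => j /asboolP Ej; rewrite power_atlasE// -!powRrM.
  by congr (_ `^ _); rewrite mulrCA divff ?mulr1// gt_eqF.
by move=> j _; exact: powR_ge0.
Qed.

(** At a point where [x p i] vanishes, [E i] also passes through [q];
    compatibility of the exponents makes the exponent of that coordinate 1 in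
    its counterpart, and 0 in the other components, so [std_monomial] applies. *)
Lemma power_pull p q sg ta D g : cor p -> cor q -> chart_ordering p sg -> chart_ordering q ta -> open D ->
  D `<=` Vs p -> D `<=` Vs q -> std (cmap (u q) ta @` D) g ->
  exists2 g', std (cmap (u p) sg @` D) g' &
    forall b, D b -> g (cmap (u q) ta b) = g' (cmap (u p) sg b).
Proof.
move=> cp cq gp gq oD Dp Dq sg'.
have [ch _] := power_chart al0 cp gp.
pose A (k m : 'I_n) := transfer_exp hM p q (ta k) (sg m) * al q (ta k) / al p (sg m).
pose th (y : 'rV[R]_n) : 'rV[R]_n := \row_k \prod_m (y ord0 m `^ A k m).
have thE b : D b -> th (cmap (u p) sg b) = cmap (u q) ta b.
  move=> Db; apply/rowP => k; rewrite !mxE.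
  rewrite (power_change cp cq (ordering_E k gq) (Dp b Db) (Dq b Db)) (prod_reindex _ gp).
  by apply: eq_bigr => m _; rewrite mxE.
exists (g \o th); last by move=> b Db /=; rewrite thE.
apply: (@std_monomial R n _ (cmap (u q) ta @` D) th g A) => //.
- exact: chart_oio ch oD Dp.
- by move=> _ [b Db <-]; exists b => //; rewrite thE.
- by move=> y _ k; rewrite mxE.
- move=> _ [b Db <-] m; rewrite mxE => um k.
  have Ep := ordering_E m gp; have Vpb := Dp b Db.
  have xm : x p (sg m) b = 0.
    by move: um; rewrite power_atlasE//; exact: powR_eq0_eq0.
  have Eb : E (sg m) b by apply/(x_zero hM cp Ep Vpb).
  have Eq : E (sg m) q := corner_of_meet hM cq Eb (Dq b Db).
  rewrite /A; have [->|km] := eqVneq (ta k) (sg m).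
    by right; have := al_rel cp cq Ep Eq; rewrite mulrC => ->; rewrite divff// gt_eqF.
  by left; rewrite (transfer_exp_off hM cp cq Ep Eq (ordering_E k gq) km) !mul0r.
Qed.

(** Functions that are standard analytic in all the coordinate systems of
    [power_atlas]. *)
Definition power_sheaf : presheaf R M := fun U f => open U /\
  forall p sg, cor p -> chart_ordering p sg -> exists2 g, std (cmap (u p) sg @` (U `&` Vs p)) g &
    forall b, U b -> Vs p b -> f b = g (cmap (u p) sg b).

Lemma power_std_chart p sg : cor p -> chart_ordering p sg -> is_chart std power_sheaf (Vs p) (cmap (u p) sg).
Proof.
move=> cp gp; have [[oW cW inj oim sec] _] := power_chart al0 cp gp.
split=> // U f oU UV; split=> [[_ /(_ p sg cp gp)[g]]|[g sg' fg]].
  rewrite (setIidl UV) => sg' fg; exists g => // a /set_mem Ua /=.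
  by apply: fg => //; exact: UV.
split=> // q ta cq gq.
have oD : open (U `&` Vs q) by apply: openI => //; exact: (vstar_open hM).
have sgD : std (cmap (u p) sg @` (U `&` Vs q)) g.
  apply: std_sub sg'; last by move=> _ [a [Ua _] <-]; exists a.
  by apply: oim => // a [Ua _]; exact: UV.
have [g' sg'' gg'] := power_pull cq cp gq gp oD (@subIsetr _ _ _) (subset_trans (@subIsetl _ _ _) UV) sgD.
exists g' => // b Ub Vb; rewrite fg ?inE//=; exact: gg'.
Qed.

Lemma G_sheaf : is_sheaf G.
Proof. by have [[_ _ h _] _ _ _ _] := hM. Qed.

Lemma local_G U f : open U ->
  (forall p sg, cor p -> chart_ordering p sg -> G (U `&` Vs p) f) -> G U f.
Proof.
move=> oU h; have [_ _ _ _ glue] := G_sheaf; apply: glue => // a Ua.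
have [p cp Va] := vstar_cover hM a; have [sg gd] := ordering_ex hM cp.
by exists (U `&` Vs p); split=> //; exact: h gd.
Qed.

Lemma power_sub_G U : power_sheaf U `<=` G U.
Proof.
move=> f [oU h]; apply: local_G => // p sg cp gd.
have [[_ _ _ _ sec] _] := power_chart al0 cp gd; have [g sg' fg] := h p sg cp gd.
have oD : open (U `&` Vs p) by apply: openI => //; exact: (vstar_open hM).
apply/(sec _ f oD (@subIsetr _ _ _)); exists g; first exact: std_gen.
by move=> a /set_mem[Ua Va] /=; exact: fg.
Qed.

Lemma power_is_sheaf : is_sheaf power_sheaf.
Proof.
have [_ Gc _ _ _] := G_sheaf; split.
- by move=> U f [].
- by move=> U f /power_sub_G; exact: Gc.
- move=> U f g [oU h] fg; split=> // p sg cp gd; have [g' sg' fg'] := h p sg cp gd.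
  by exists g' => // b Ub Vb; rewrite -fg ?inE//; exact: fg'.
- move=> U V f oV VU [oU h]; split=> // p sg cp gd; have [g sg' fg] := h p sg cp gd.
  have [ch _] := power_chart al0 cp gd.
  have oD : open (V `&` Vs p) by apply: openI => //; exact: (vstar_open hM).
  exists g; last by move=> b Vb Vpb; apply: fg => //; exact: VU.
  apply: std_sub sg'; first exact: (chart_oio ch oD (@subIsetr _ _ _)).
  by move=> _ [a [Va Vpa] <-]; exists a => //; split=> //; exact: VU.
- move=> U f oU h; split=> // p sg cp gd; have [ch _] := power_chart al0 cp gd.
  have [_ _ inj _ _] := ch.
  have injD D : D `<=` Vs p -> {in D &, injective (cmap (u p) sg)}.
    by move=> DV a b /set_mem/DV/mem_set ? /set_mem/DV/mem_set ?; exact: inj.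
  have oD : open (U `&` Vs p) by apply: openI => //; exact: (vstar_open hM).
  exists (push (cmap (u p) sg) (U `&` Vs p) f); last first.
    by move=> b Ub Vb; rewrite pushE//; exact: (injD _ (@subIsetr _ _ _)).
  apply: std_glue; first exact: (chart_oio ch oD (@subIsetr _ _ _)).
  move=> _ [a [Ua Va] <-]; have [V [V'a VU [oV hV]]] := h a Ua.
  have [g sg' fg] := hV p sg cp gd.
  exists (cmap (u p) sg @` (V `&` Vs p)); split; first by exists a.
    by move=> _ [b [Vb Vpb] <-]; exists b => //; split=> //; exact: VU.
  apply: std_ext sg' => _ [b [Vb Vpb] <-]; rewrite -fg//.
  have Db : (U `&` Vs p) b by split=> //; exact: VU.
  by rewrite pushE//; exact: (injD _ (@subIsetr _ _ _)).
Qed.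

Lemma power_manifold : is_manifold std power_sheaf.
Proof.
have [[sc hd _ _] _ _ _ _] := hM; split=> //; first exact: power_is_sheaf.
move=> a; have [p cp Va] := vstar_cover hM a; have [sg gd] := ordering_ex hM cp.
by exists (Vs p), (cmap (u p) sg); split=> //; exact: power_std_chart.
Qed.

(** One inclusion is read in the charts of the atlas; for the other one, a
    section of [G] is carried from a chart of the atlas to an arbitrary
    standard chart by [gen_comp_std]. *)
Lemma power_enrichment : enrichment n power_sheaf = G.
Proof.
have [Go Gc _ Gr _] := G_sheaf.
apply/funext => U; apply/funext => f; apply/propext; split.
  move=> [oU cf h]; apply: local_G => // p sg cp gd.
  have [[_ _ _ _ sec] _] := power_chart al0 cp gd.
  have oD : open (U `&` Vs p) by apply: openI => //; exact: (vstar_open hM).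
  have [g gg fg] := h _ _ (power_std_chart cp gd).
  by apply/(sec _ f oD (@subIsetr _ _ _)); exists g.
move=> Gf; have oU := Go _ _ Gf; split=> //; first exact: Gc.
move=> W phi ch; have [oW _ inj oim _] := ch.
have injD D : D `<=` W -> {in D &, injective phi}.
  by move=> DV a b /set_mem/DV/mem_set ? /set_mem/DV/mem_set ?; exact: inj.
have oUW : open (U `&` W) by exact: openI.
exists (push phi (U `&` W) f); last first.
  by move=> a /set_mem Ua /=; rewrite pushE//; exact: (injD _ (@subIsetr _ _ _)).
apply: gen_glue; first exact: (chart_oio ch oUW (@subIsetr _ _ _)).
move=> _ [a [Ua Wa] <-]; have [p cp Va] := vstar_cover hM a; have [sg gd] := ordering_ex hM cp.
have [chG _] := power_chart al0 cp gd.
have chO := power_std_chart cp gd.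
pose D := U `&` W `&` Vs p.
have oD : open D by apply: openI => //; exact: (vstar_open hM).
have DW : D `<=` W by move=> b [[]].
have DV : D `<=` Vs p by move=> b [].
have DU : D `<=` U by move=> b [[]].
have d1 := chart_sub (std_model R n) ch oD DW.
have d2 := chart_sub (std_model R n) chO oD DV.
have d3 := chart_sub (gen_model R n) chG oD DV.
have [_ _ _ _ sec] := d3.
have /(sec D f oD (@subset_refl _ _))[g gg fg] : G D f by exact: Gr Gf.
exists (phi @` D); split; first by exists a.
  by move=> _ [b Db <-]; exists b => //; case: Db.
have := gen_comp_std (chart_oio d1 oD (@subset_refl _ _)) (chart_oio d2 oD (@subset_refl _ _))
  (trans_homeo d1 d2) (std_trans_map d1 d2) (std_trans_map d2 d1) gg.
apply: gen_ext => _ [b Db <-] /=; rewrite transE//; last exact: injD.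
rewrite pushE//; [|exact: (injD _ (@subIsetr _ _ _))|by case: Db].
by rewrite fg ?inE.
Qed.

Lemma power_standardization : standardization n G power_sheaf.
Proof.
by split; [exact: power_sub_G|exact: power_manifold|exact: power_enrichment].
Qed.

Lemma power_m_standardization : m_standardizations n G E x (power_sheaf, u).
Proof.
have st := power_standardization; have [cE VE] := strata_std st.
split=> //=; last first.
  move=> p cp; have [sg gd] := ordering_ex hM cp; have [ch _] := power_chart al0 cp gd.
  split; first exact: (power_affine al0 cp gd erefl ch).
  by exists (al p); split=> // i Ei a Va; rewrite power_atlasE.
split.
- move=> p; rewrite cE => ncp; apply/funext => i; apply/funext => a.
  by rewrite /power_atlas; case: asboolP => // -[].
- move=> p; rewrite cE => cp; have [sg gd] := ordering_ex hM cp.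
  apply: (power_affine al0 cp gd (VE p)); exact: power_std_chart.
- by move=> a; have [p cp Va] := vstar_cover hM a; exists p; rewrite ?cE ?VE.
- move=> p q; rewrite cE => cp cq; exists (fun i j => transfer_exp hM p q i j * al q i / al p j).
  move=> i Ei a; rewrite !VE => Va Vb; exact: power_change.
Qed.

(** A sheaf is determined by charts that cover the space. *)
Lemma power_sheaf_unique O : is_sheaf O ->
  (forall p, cor p -> exists2 sg, chart_ordering p sg & is_chart std O (Vs p) (cmap (u p) sg)) ->
  O = power_sheaf.
Proof.
move=> [Oo _ _ Or Og] ch; have [Po _ _ Pr Pg] := power_is_sheaf.
apply/funext => U; apply/funext => f; apply/propext; split=> h.
  have oU := Oo _ _ h; apply: Pg => // a Ua; have [p cp Va] := vstar_cover hM a.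
  have oD : open (U `&` Vs p) by apply: openI => //; exact: (vstar_open hM).
  have [sg gd [_ _ _ _ sec]] := ch p cp; have [_ _ _ _ sec'] := power_std_chart cp gd.
  exists (U `&` Vs p); split=> //; apply/(sec' _ f oD (@subIsetr _ _ _)).
  by apply/(sec _ f oD (@subIsetr _ _ _)); apply: Or h.
have oU := Po _ _ h; apply: Og => // a Ua; have [p cp Va] := vstar_cover hM a.
have oD : open (U `&` Vs p) by apply: openI => //; exact: (vstar_open hM).
have [sg gd [_ _ _ _ sec]] := ch p cp; have [_ _ _ _ sec'] := power_std_chart cp gd.
exists (U `&` Vs p); split=> //; apply/(sec _ f oD (@subIsetr _ _ _)).
by apply/(sec' _ f oD (@subIsetr _ _ _)); apply: Pr h.
Qed.

End Construction.

(** * Classification of the m-standardizations *)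

Section Classification.
Variables (R : realType) (n : nat) (M : topologicalType) (G : presheaf R M).
Variables (I : finType) (E : I -> set M) (x : atlas R M I).
Hypothesis hM : monomial_manifold (@gen_analytic R n) G E x.
Implicit Types (p q a b : M) (i j : I) (sg ta : 'I_n -> I) (D U : set M).

Local Notation cor := (corner (@gen_analytic R n) G).
Local Notation Vs := (vstar (@gen_analytic R n) G).
Local Notation chart_ordering := (@chart_ordering R n M G I E x).
Local Notation cmap := (@coordmap R n M I).
Local Notation gen := (@gen_analytic R n).
Local Notation std := (@std_analytic R n).
Local Notation patlas := (@power_atlas R n M G I E x).
Local Notation psheaf := (@power_sheaf R n M G I E x).
Local Notation texp := (transfer_exp hM).

(** Along a transversal curve parametrized by t = u_(p,i), the coordinate
    u_(q,i) is a constant times t^D with D = al q i * texp p q i i / al p i.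
    It is standard analytic in the chart at [p], hence Lipschitz, so D >= 1. *)
Lemma power_exponent_ge1 al O p q sg ta i : (forall p i, 0 < al p i) -> cor p -> cor q ->
  E i p -> E i q -> chart_ordering p sg -> chart_ordering q ta ->
  is_chart std O (Vs p) (cmap (patlas al p) sg) ->
  is_chart std O (Vs q) (cmap (patlas al q) ta) ->
  al p i <= al q i * texp p q i i.
Proof.
move=> al0 cp cq Ep Eq gp gq cP cQ.
have oD : open (Vs p `&` Vs q) by apply: openI; exact: (vstar_open hM).
pose D := Vs p `&` Vs q.
have Vp := iffLR (vstar_generic hM _ _) Ep; have Vq := iffLR (vstar_generic hM _ _) Eq.
have d1 := chart_sub (std_model R n) cP oD (@subIsetl _ _ _).
have d2 := chart_sub (std_model R n) cQ oD (@subIsetr _ _ _).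
have [_ _ inj1 _ _] := d1.
have [m mi] := ordering_index gp Ep; have [k ki] := ordering_index gq Eq.
have Da : D (generic_pt hM i) by [].
have := lip_along [set m]%SET (std_trans_map d1 d2 k) (imageP (cmap (patlas al p) sg) Da).
rewrite !transE// mxE ki => -[e e0 /(_ e e0 (lexx _)) lip].
(* The curve is parametrized by x_(p,i); the time t of the ray corresponds to
   the parameter t^(1 / al p i). *)
have [t0 t00 ht] := transversal_curve cp Ep oD (conj Vp Vq) (@subIsetl _ _ _).
have [xp0 _] := x_generic hM cp Ep; have [xq0 _] := x_generic hM cq Eq.
have ap0 := al0 p i; have aq0 := al0 q i.
have K0 : 0 < transfer_coef hM p q i `^ al q i by rewrite powR_gt0// transfer_coef_gt0.
have t1 : 0 < Num.min e (t0 `^ al p i) by rewrite lt_min e0 powR_gt0.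
suff : 1 <= al q i * texp p q i i / al p i by rewrite ler_pdivlMr// mul1r.
apply: (@powR_exponent_ge1 R _ e^-1 _ _ K0 t1) => t tp; rewrite le_min => /andP[te tle].
have t'0 : 0 < t `^ (al p i)^-1 by rewrite powR_gt0.
have t'le : t `^ (al p i)^-1 <= t0.
  have ai0 : 0 <= (al p i)^-1 by rewrite invr_ge0 ltW.
  apply: le_trans (powR_le (ltW tp) tle ai0) _.
  by rewrite -powRrM divff ?gt_eqF// powRr1// ltW.
have [b [[Vpb Vqb] bt hb]] := ht _ t'0 t'le.
have bE : cmap (patlas al p) sg b = bump (cmap (patlas al p) sg (generic_pt hM i)) [set m]%SET t.
  apply/rowP => l; have El := ordering_E l gp; rewrite !mxE !power_atlasE// inE.
  have [->|lm] := eqVneq l m.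
    by rewrite mi bt xp0 powR0 ?gt_eqF// add0r mulr1 -powRrM mulVf ?gt_eqF// powRr1// ltW.
  rewrite mulr0 addr0 hb//; apply: contra lm => /eqP li; apply/eqP.
  by have [inj _ _ _] := gp; apply: inj; rewrite li mi.
have Db : D b by [].
have := lip t tp te; rewrite -bE => /(_ (imageP _ Db)).
rewrite transE// mxE ki !power_atlasE// xq0 powR0 ?gt_eqF// subr0.
have [-> _] := transfer_along cp cq Ep Eq Vpb Vqb hb.
have Kge0 := ltW (transfer_coef_gt0 hM q cp Ep).
rewrite bt powRM ?powR_ge0//.
rewrite -!powRrM ger0_norm ?mulr_ge0 ?powR_ge0//.
by have -> : (al p i)^-1 * (texp p q i i * al q i) = al q i * texp p q i i / al p i by ring.
Qed.

Lemma eq_power_atlas al al' : (forall p i, cor p -> E i p -> al p i = al' p i) ->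
  patlas al = patlas al'.
Proof.
move=> h; apply/funext => p; apply/funext => i; apply/funext => a.
by rewrite /power_atlas; case: asboolP => // -[cp [Ei _]]; rewrite h.
Qed.

(** Exchanging the two corner points inverts the exponent D of
    [power_exponent_ge1], so D = 1: this is the compatibility of the
    exponents. The sheaf is then determined by the atlas. *)
Lemma m_standardization_exponents (O : presheaf R M) (b : atlas R M I) : m_standardizations n G E x (O, b) ->
  exists al, [/\ forall p i, 0 < al p i,
    forall p q i, cor p -> cor q -> E i p -> E i q -> al q i * texp p q i i = al p i,
    b = patlas al & O = psheaf al].
Proof.
move=> [/= st [b0 baff bcov bch] loc]; have [cE VE] := strata_std st.
have [_ [_ _ shO _] OG] := st.
have /choice[al alP] : forall p, exists alpha : I -> R, (forall i, 0 < alpha i) /\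
    (cor p -> forall i, E i p -> forall a, Vs p a -> b p i a = x p i a `^ alpha i).
  move=> p; have [cp|ncp] := pselect (cor p); last by exists (fun=> 1); split.
  by have [_ [alpha [h1 h2]]] := loc p cp; exists alpha.
have al0 p i : 0 < al p i by have [h _] := alP p.
have bE : b = patlas al.
  apply/funext => p; have [cp|ncp] := pselect (cor p); last first.
    rewrite b0 ?cE//; apply/funext => i; apply/funext => a.
    by rewrite /power_atlas; case: asboolP => // -[].
  apply/funext => i; apply/funext => a; have [[h0 _ _ _] _] := loc p cp.
  rewrite /power_atlas; case: asboolP => [[_ [Ei Va]]|nh]; last by apply: h0 => -[? ?]; exact: nh.
  by have [_ h] := alP p; exact: h.
have ch p : cor p -> exists2 sg, chart_ordering p sg & is_chart std O (Vs p) (cmap (patlas al p) sg).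
  move=> cp; have := baff p; rewrite cE => /(_ cp)[_ _ _ [sg [inj rg ch im]]].
  rewrite VE in ch im.
  exists sg; last by rewrite -bE.
  have chG := std_chart_gen OG ch.
  have gi m : 0 < (al p (sg m))^-1 by rewrite invr_gt0.
  have Em m : E (sg m) p.
    by have : range sg (sg m) by [exists m]; rewrite rg.
  have e a : Vs p a -> (pw (fun m => (al p (sg m))^-1) \o cmap (b p) sg) a = cmap (x p) sg a.
    move=> Va; apply/rowP => m; rewrite !mxE bE power_atlasE// -powRrM divff ?gt_eqF// powRr1//.
    exact: (x_ge0 hM).
  split=> //; first by apply: chart_ext e _; exact: pw_chart.
  by rewrite (image_ext e); exact: pw_image.
have rel p q i : cor p -> cor q -> E i p -> E i q -> al q i * texp p q i i = al p i.
  move=> cp cq Ep Eq; have [sg gp c1] := ch p cp; have [ta gq c2] := ch q cq.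
  have h1 := power_exponent_ge1 al0 cp cq Ep Eq gp gq c1 c2.
  have h2 := power_exponent_ge1 al0 cq cp Eq Ep gq gp c2 c1.
  (* The two transfer exponents are inverse to each other, so the two
     inequalities h1 and h2 are opposite. *)
  have CC : texp q p i i * texp p q i i = 1 by rewrite mulrC -transfer_exp_cocycle// transfer_exp_refl.
  apply/le_anti/andP; split=> //; have Cp := transfer_exp_gt0 hM cp cq Ep Eq.
  have := ler_wpM2r (ltW Cp) h2; rewrite -mulrA CC mulr1 => h3; exact: h3.
exists al; split=> //; apply: (power_sheaf_unique al0 rel shO ch).
Qed.

(** A corner point of [E i], at which the exponent of the coordinate of [E i]
    can be prescribed. *)
Definition base_pt i : M := sval (cid (component_corner hM i)).

Lemma base_corner i : cor (base_pt i).
Proof. by rewrite /base_pt; case: cid => p []. Qed.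

Lemma base_E i : E i (base_pt i).
Proof. by rewrite /base_pt; case: cid => p []. Qed.

(** The exponents at all corner points that compatibility forces from those at
    the base points. *)
Definition spread (be : I -> R) p i : R :=
  if `[< cor p /\ E i p >] then be i / texp (base_pt i) p i i else 1.

Lemma spreadE be p i : cor p -> E i p -> spread be p i = be i / texp (base_pt i) p i i.
Proof. by move=> cp Ei; rewrite /spread; case: asboolP => // -[]. Qed.

Lemma spread_gt0 be p i : (forall i, 0 < be i) -> 0 < spread be p i.
Proof.
move=> b0; rewrite /spread; case: asboolP => // -[cp Ei].
by rewrite divr_gt0// transfer_exp_gt0//; [exact: base_corner|exact: base_E].
Qed.

Lemma spread_rel be p q i : cor p -> cor q -> E i p -> E i q ->
  spread be q i * texp p q i i = spread be p i.
Proof.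
move=> cp cq Ep Eq; rewrite !spreadE//.
have cb := base_corner i; have Eb := base_E i.
rewrite (transfer_exp_cocycle hM cb cp cq Eb Ep Eq).
have c1 := transfer_exp_gt0 hM cb cp Eb Ep; have c2 := transfer_exp_gt0 hM cp cq Ep Eq.
by rewrite invfM mulrA mulfVK// gt_eqF.
Qed.

Definition mstd (be : I -> R) := (psheaf (spread be), patlas (spread be)).

Lemma mstdP be : (forall i, 0 < be i) -> m_standardizations n G E x (mstd be).
Proof.
move=> b0; apply: (@power_m_standardization R n M G I E x hM).
  by move=> p i; exact: spread_gt0.
exact: spread_rel.
Qed.

(** The chart being onto the orthant, the coordinate takes the value 2
    somewhere. *)
Lemma exponent_inj p i A B : cor p -> E i p ->
  (forall a, Vs p a -> x p i a `^ A = x p i a `^ B) -> A = B.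
Proof.
move=> cp Ei h; have [sg gd] := ordering_ex hM cp; have [_ _ _ im] := gd.
have [m mi] := ordering_index gd Ei.
have : (cmap (x p) sg @` Vs p) (const_mx 2) by rewrite im => l; rewrite mxE.
move=> [a Va /rowP/(_ m)]; rewrite !mxE mi => a2.
have := congr1 (@ln R) (h a Va); rewrite a2 !ln_powR; apply: mulIf.
by rewrite gt_eqF// ln_gt0// ltr1n.
Qed.

Lemma mstd_inj be be' : (mstd be).2 = (mstd be').2 -> be = be'.
Proof.
move=> /= h; apply/funext => i; have cb := base_corner i; have Eb := base_E i.
suff : spread be (base_pt i) i = spread be' (base_pt i) i.
  by rewrite !spreadE// transfer_exp_refl// !divr1.
apply: (exponent_inj cb Eb) => a Va.
by rewrite -!(@power_atlasE R n M G I E x)// h.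
Qed.

Lemma mstd_surj Ob : m_standardizations n G E x Ob ->
  exists2 be, forall i, 0 < be i & mstd be = Ob.
Proof.
case: Ob => O b h; have [al [al0 rel -> ->]] := m_standardization_exponents h.
exists (fun i => al (base_pt i) i) => //.
rewrite /mstd; have e : patlas (spread (fun i => al (base_pt i) i)) = patlas al.
  apply: eq_power_atlas => p i cp Ei; rewrite spreadE//.
  have cb := base_corner i; have Eb := base_E i.
  by rewrite -(rel _ _ _ cb cp Eb Ei) mulfK// gt_eqF// transfer_exp_gt0.
congr (_, _) => //; rewrite /power_sheaf.
by apply/funext => U; apply/funext => f; rewrite e.
Qed.

End Classification.

Section Parametrize.
Variables (R : realType) (I : finType) (m : nat) (e : 'I_m -> I) (be0 : I -> R).
Hypothesis e_inj : injective e.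
Hypothesis be0_gt0 : forall i, 0 < be0 i.

(** Families of positive reals with prescribed values off the range of [e];
    the range is everything in the first part of the theorem, and the set of
    components that avoid [p] in the second one. *)
Definition extend_row (v : 'rV[R]_m) (i : I) : R :=
  if [pick k | e k == i] is Some k then v ord0 k else be0 i.

Lemma extend_e v k : extend_row v (e k) = v ord0 k.
Proof.
rewrite /extend_row; case: pickP => [l /eqP /e_inj -> //|/(_ k)].
by rewrite eqxx.
Qed.

Lemma extend_off v i : (forall k, e k != i) -> extend_row v i = be0 i.
Proof. by move=> h; rewrite /extend_row; case: pickP => // k; rewrite (negbTE (h k)). Qed.

Lemma extend_gt0 v i : pos_orthant v -> 0 < extend_row v i.
Proof. by move=> v0; rewrite /extend_row; case: pickP => [k _|_]. Qed.

Lemma extend_inj v v' : extend_row v = extend_row v' -> v = v'.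
Proof. by move=> h; apply/rowP => k; rewrite -!extend_e h. Qed.

Lemma extend_surj be : (forall i, 0 < be i) -> (forall i, (forall k, e k != i) -> be i = be0 i) ->
  exists2 v, pos_orthant v & extend_row v = be.
Proof.
move=> b0 off; exists (\row_k be (e k)); first by move=> k; rewrite mxE.
apply/funext => i; have [[k ki]|nk] := pselect (exists k, e k = i).
  by rewrite -ki extend_e mxE.
have h k : e k != i by apply/eqP => ki; apply: nk; exists k.
by rewrite extend_off// off.
Qed.

End Parametrize.

Theorem proposition3p17 (R : realType) (n : nat) (M : topologicalType)
    (G : presheaf R M) (I : finType) (E : I -> set M) (x : atlas R M I)
    (hM : monomial_manifold (@gen_analytic R n) G E x) :
  (exists F : 'rV[R]_#|I| -> presheaf R M * atlas R M I,
     set_bij (@pos_orthant R #|I|) (m_standardizations n G E x) F) /\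
  (forall (p : M) (u : coord_family R M I),
     corner (@gen_analytic R n) G p ->
     local_m_standardization n G E x p u ->
     exists F : 'rV[R]_(#|I| - n) -> presheaf R M * atlas R M I,
       set_bij (@pos_orthant R (#|I| - n))
         (m_standardizations_extending n G E x p u) F).
Proof.
split.
  have einj : injective (@enum_val I predT) by exact: enum_val_inj.
  have be0 (i : I) : 0 < (fun=> 1 : R) i by [].
  exists (fun v => mstd hM (extend_row (@enum_val I predT) (fun=> 1) v)); split.
  - by move=> v v0; apply: mstdP => i; exact: extend_gt0.
  - by move=> v v' _ _ h; apply: (extend_inj einj (mstd_inj (congr1 snd h))).
  - move=> Ob /(mstd_surj hM)[be b0 <-].
    have [|v v0 <-] := extend_surj einj b0 (be0 := fun=> 1); last by exists v.
    by move=> i /(_ (enum_rank i)); rewrite enum_rankK eqxx.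
move=> p u cp [uaff [alpha [al0 uE]]].
have [sg gd] := ordering_ex hM cp; have [sinj _ _ _] := gd.
pose T := [set i : I | ~~ `[< E i p >]]%SET.
have cT : (#|I| - n = #|T|)%N.
  have <- : #|[set sg m | m in [set: 'I_n]]%SET| = n by rewrite card_imset// cardsT card_ord.
  have -> : T = (~: [set sg m | m in [set: 'I_n]])%SET.
    apply/setP => i; rewrite !inE; congr (~~ _); apply/asboolP/imsetP => [Ei|[m _ ->]].
      by have [m mi] := ordering_index gd Ei; exists m; rewrite ?inE.
    exact: ordering_E gd.
  by rewrite [RHS]cardsCs finset.setCK.
pose e (k : 'I_(#|I| - n)) : I := enum_val (cast_ord cT k).
have einj : injective e by move=> k l /enum_val_inj/cast_ord_inj.
have eT k : ~ E (e k) p by have := enum_valP (cast_ord cT k); rewrite inE => /asboolPn.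
have offE i : (forall k, e k != i) <-> E i p.
  split=> [h|Ei k]; last by apply/eqP => ki; apply: (eT k); rewrite ki.
  apply: contrapT => nE; have iT : i \in T by rewrite inE; apply/asboolPn.
  have := h (cast_ord (esym cT) (enum_rank_in iT i)).
  by rewrite /e cast_ordKV enum_rankK_in// eqxx.
pose be0 i := if `[< E i p >] then alpha i * transfer_exp hM (base_pt hM i) p i i else 1.
have be0_gt0 i : 0 < be0 i.
  rewrite /be0; case: asboolP => // Ei; rewrite mulr_gt0//.
  by apply: transfer_exp_gt0 => //; [exact: base_corner|exact: base_E].
have Cn i : E i p -> transfer_exp hM (base_pt hM i) p i i != 0.
  by move=> Ei; rewrite gt_eqF//; apply: transfer_exp_gt0 => //; [exact: base_corner|exact: base_E].
have spE be i : E i p -> (spread hM be p i = alpha i <-> be i = be0 i).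
  move=> Ei; rewrite spreadE// /be0; case: asboolP => // _; split=> [<-|->].
    by rewrite mulfVK// Cn.
  by rewrite mulfK// Cn.
have uP be : (mstd hM be).2 p = u <-> forall i, E i p -> be i = be0 i.
  split=> [h i Ei|h].
    apply/(spE be i Ei); apply: (exponent_inj hM cp Ei) => a Va.
    by rewrite -uE// -h /= power_atlasE.
  apply/funext => i; apply/funext => a /=; have [u0 _ _ _] := uaff.
  rewrite /power_atlas; case: asboolP => [[_ [Ei Va]]|nh].
    by rewrite uE// (iffRL (spE be i Ei) (h i Ei)).
  by rewrite u0// => -[Ei Va]; apply: nh.
exists (fun v => mstd hM (extend_row e be0 v)); split.
- move=> v v0; split; first by apply: mstdP => i; exact: extend_gt0.
  by apply/uP => i /offE; exact: extend_off.
- by move=> v v' _ _ h; apply: (extend_inj einj (mstd_inj (congr1 snd h))).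
- move=> Ob [/(mstd_surj hM)[be b0 <-] /uP hu].
  have [|v v0 <-] := extend_surj einj b0 (be0 := be0); last by exists v.
  by move=> i /offE; exact: hu.
Qed.
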